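(* For each $e\in S^{d-1}$, the random variable $\omega\mapsto\tilde{\varphi}^{\omega}(e)$ is $\Sigma$-measurable.
   Context: Setting: $\lambda,\Lambda\in(0,\infty)$; $(\Omega,\mathscr{B},\mathbb{P})$ probability space with measurable $\Phi:\Omega\to\mathscr{F}_{d}(\lambda,\Lambda)$ (continuous $\varphi:S^{d-1}\to[\sqrt{\lambda},\sqrt{\Lambda}]$ with convex one-homogeneous extension; Borel $\sigma$-algebra of sup norm) and a jointly measurable, $\mathbb{P}$-preserving, ergodic group action $\tau$ of $\mathbb{R}^{d}$ on $\Omega$. $\varphi^{\omega}(x,p)=\|p\|\Phi^{\tau_{x}\omega}(p/\|p\|)$, $\varphi^{\omega}(x,0)=0$. $W:[-1,1]\to[0,\infty)$ continuous with zero set $\{-1,1\}$; $\mathcal{F}^{\omega}(u;A)=\int_{A}(\frac{1}{2}\varphi^{\omega}(x,Du)^{2}+W(u))\,dx$. $q:\mathbb{R}\to[-1,1]$ smooth, $q(\pm\infty)=\pm1$, $\int_{\mathbb{R}}(\frac{\Lambda}{2}q'^{2}+W(q))\,ds<\infty$; $q_{e}(y)=q(\langle y,e\rangle)$. $O_{e}$ fixed linear isometry of $\mathbb{R}^{d-1}$ onto $\langle e\rangle^{\perp}$, $A\oplus_{e}B=\{O_{e}(a)+be : a\in A, b\in B\}$; orthonormal basis $e_{1},\dots,e_{d-1}$ of $\mathbb{R}^{d-1}$ fixed, $Q(y,r)=\{x\in\mathbb{R}^{d-1}:\max_{i}|\langle x-y,e_{i}\rangle|<r/2\}$. $\tilde{\varphi}^{\omega}(e,A,h)=\inf\{\mathcal{F}^{\omega}(u;A\oplus_{e}(-h,h)):u\in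 H^{1}(A\oplus_{e}(-h,h);[-1,1]),\ u-q_{e}\in H^{1}_{0}(A\oplus_{e}(-h,h))\}$ and $\tilde{\varphi}^{\omega}(e) = \liminf_{R\to\infty}R^{1-d}\tilde{\varphi}^{\omega}(e,Q(0,R),R)$. $\Sigma$ is the $\sigma$-algebra of events $E\in\mathscr{B}$ with $\tau_{x}^{-1}(E)=E$ for all $x\in\mathbb{R}^{d}$. *)

(* Defs.v *)
From HB Require Import structures.
From mathcomp Require Import all_boot all_order all_algebra.
From mathcomp Require Import all_classical all_reals all_analysis measurable_realfun.
Set Implicit Arguments. Unset Strict Implicit. Unset Printing Implicit Defensive.
Import Order.TTheory GRing.Theory Num.Theory.
Import numFieldNormedType.Exports.
Local Open Scope classical_set_scope.
Local Open Scope ring_scope.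

Section Defs.
Variable R : realType.

Definition dotp d (x y : 'rV[R]_d) : R := \sum_i x 0 i * y 0 i.
Definition enorm d (x : 'rV[R]_d) : R := Num.sqrt (dotp x x).
Definition usphere d : set 'rV[R]_d := [set e | enorm e = 1].

(* coordinates: R^d as a d-tuple, carrying the product (Borel) sigma-algebra *)
Definition rowt d (t : d.-tuple R) : 'rV[R]_d := \row_i tnth t i.
Definition rmeasurable d (f : 'rV[R]_d -> R) : Prop :=
  measurable_fun [set: d.-tuple R] (fun t => f (rowt t)).

(* Lebesgue integral on R^d of a nonnegative function: iterated integral
   of one-dimensional Lebesgue integrals (equal to the product-measure
   integral by Tonelli) *)
Fixpoint iint (d : nat) : (d.-tuple R -> \bar R) -> \bar R :=
  match d return (d.-tuple R -> \bar R) -> \bar R with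
  | 0 => fun f => f [tuple]
  | d'.+1 => fun f =>
      (\int[@lebesgue_measure R]_(x in [set: R])
          iint (fun t : d'.-tuple R => f [tuple of x :: t]))%E
  end.

Definition lint d (A : set 'rV[R]_d) (f : 'rV[R]_d -> \bar R) : \bar R :=
  iint (fun t => if `[< A (rowt t) >] then f (rowt t) else 0%E).

Definition Lint d (A : set 'rV[R]_d) (f : 'rV[R]_d -> R) : R :=
  fine (lint A (fun x => (Num.max (f x) 0)%:E)) -
  fine (lint A (fun x => (Num.max (- f x) 0)%:E)).

Definition L2 d (A : set 'rV[R]_d) (f : 'rV[R]_d -> R) : Prop :=
  rmeasurable (fun x => if `[< A x >] then f x else 0) /\
  (lint A (fun x => (f x ^+ 2)%:E) < +oo)%E.

Definition pd d (i : 'I_d) (f : 'rV[R]_d -> R) : 'rV[R]_d -> R :=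
  'D_(delta_mx 0 i) f.

Definition iter_pd d (s : seq 'I_d) (f : 'rV[R]_d -> R) : 'rV[R]_d -> R :=
  foldr (fun i g => pd i g) f s.

Definition smooth d (f : 'rV[R]_d -> R) : Prop :=
  forall s : seq 'I_d, continuous (iter_pd s f) /\
    forall (i : 'I_d) (x : 'rV[R]_d), derivable (iter_pd s f) x (delta_mx 0 i).

Definition test_fun d (U : set 'rV[R]_d) (f : 'rV[R]_d -> R) : Prop :=
  smooth f /\ exists K : set 'rV[R]_d, compact K /\ K `<=` U /\
    (forall x, ~ K x -> f x = 0).

Definition weak_grad d (U : set 'rV[R]_d) (u : 'rV[R]_d -> R)
    (G : 'I_d -> 'rV[R]_d -> R) : Prop :=
  forall (i : 'I_d) (phi : 'rV[R]_d -> R), test_fun U phi ->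
    Lint U (fun x => u x * pd i phi x) = - Lint U (fun x => G i x * phi x).

Definition H1 d (U : set 'rV[R]_d) (u : 'rV[R]_d -> R)
    (G : 'I_d -> 'rV[R]_d -> R) : Prop :=
  L2 U u /\ (forall i, L2 U (G i)) /\ weak_grad U u G.

Definition H10 d (U : set 'rV[R]_d) (v : 'rV[R]_d -> R) : Prop :=
  exists G : 'I_d -> 'rV[R]_d -> R, H1 U v G /\
    exists psi : nat -> 'rV[R]_d -> R, (forall k, test_fun U (psi k)) /\
      ((fun k => (lint U (fun x => ((v x - psi k x) ^+ 2)%:E) +
          \sum_(i < d) lint U (fun x => ((G i x - pd i (psi k) x) ^+ 2)%:E))%E)
        @ \oo --> 0%E).

(* the class F_d(lambda, Lambda), functions given by their values on S^{d-1} *)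
Definition hom_ext d (phi : 'rV[R]_d -> R) (x : 'rV[R]_d) : R :=
  if x == 0 then 0 else enorm x * phi ((enorm x)^-1 *: x).

Definition Fd d (lam Lam : R) (phi : 'rV[R]_d -> R) : Prop :=
  {within (@usphere d), continuous phi} /\
  (forall e, (@usphere d) e -> Num.sqrt lam <= phi e <= Num.sqrt Lam) /\
  (forall (x y : 'rV[R]_d) (t : R), 0 <= t <= 1 ->
     hom_ext phi (t *: x + (1 - t) *: y) <=
       t * hom_ext phi x + (1 - t) * hom_ext phi y).

Definition supdist d (f g : 'rV[R]_d -> R) : \bar R :=
  ereal_sup [set (`|f e - g e|)%:E | e in (@usphere d)].

Definition Fd_open d (lam Lam : R) (O : set ('rV[R]_d -> R)) : Prop :=
  O `<=` Fd lam Lam /\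
  forall f, O f -> exists r : R, 0 < r /\
    forall g, Fd lam Lam g -> (supdist f g < r%:E)%E -> O g.

Definition Fd_borel d (lam Lam : R) : set (set ('rV[R]_d -> R)) :=
  <<s Fd_open lam Lam >>.

Definition strip n (O : 'rV[R]_n -> 'rV[R]_n.+1) (e : 'rV[R]_n.+1)
    (A : set 'rV[R]_n) (h : R) : set 'rV[R]_n.+1 :=
  [set x | exists a b, A a /\ - h < b < h /\ x = O a + b *: e].

Definition cube n (bs : 'I_n -> 'rV[R]_n) (y : 'rV[R]_n) (r : R) : set 'rV[R]_n :=
  [set x | forall i, `|dotp (x - y) (bs i)| < r / 2].

Definition phiw d (Omega : Type) (Phi : Omega -> 'rV[R]_d -> R)
    (tau : 'rV[R]_d -> Omega -> Omega) (w : Omega) (x p : 'rV[R]_d) : R :=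
  if p == 0 then 0 else enorm p * Phi (tau x w) ((enorm p)^-1 *: p).

Definition energy d (Omega : Type) (Phi : Omega -> 'rV[R]_d -> R)
    (tau : 'rV[R]_d -> Omega -> Omega) (W : R -> R) (w : Omega)
    (u : 'rV[R]_d -> R) (G : 'I_d -> 'rV[R]_d -> R) (A : set 'rV[R]_d) : \bar R :=
  lint A (fun x => ((2^-1) * phiw Phi tau w x (\row_i G i x) ^+ 2 + W (u x))%:E).

Definition phit_loc n (Omega : Type) (Phi : Omega -> 'rV[R]_n.+1 -> R)
    (tau : 'rV[R]_n.+1 -> Omega -> Omega) (W q : R -> R)
    (O : 'rV[R]_n -> 'rV[R]_n.+1) (w : Omega) (e : 'rV[R]_n.+1)
    (A : set 'rV[R]_n) (h : R) : \bar R :=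
  let D := strip O e A h in
  ereal_inf [set E | exists u G, H1 D u G /\
      (forall x, D x -> -1 <= u x <= 1) /\
      H10 D (fun x => u x - q (dotp x e)) /\
      E = energy Phi tau W w u G D].

(* phi~^omega(e) = liminf_{R -> oo} R^{1-d} phi~^omega(e, Q(0,R), R) *)
Definition phit n (Omega : Type) (Phi : Omega -> 'rV[R]_n.+1 -> R)
    (tau : 'rV[R]_n.+1 -> Omega -> Omega) (W q : R -> R)
    (O : 'rV[R]_n -> 'rV[R]_n.+1) (bs : 'I_n -> 'rV[R]_n)
    (w : Omega) (e : 'rV[R]_n.+1) : \bar R :=
  ereal_sup [set ereal_inf [set ((r ^- n)%:E *
                   phit_loc Phi tau W q O w e (cube bs 0 r) r)%E
                 | r in [set r | M <= r]]
             | M in [set M : R | 0 < M]].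

End Defs.

(* Main.v *)
(** Let [D_r] be the strip of half-height [r] over the cube of side [r], and let [u] be
    admissible on [D_r] for the environment [tau x w]. By stationarity its translate by [x]
    has the same energy on [x + D_r] for [w]. It is continued to [D_r'], where
    [r' = r + O(1)], by a smooth interpolation between [q <y - x, e>] and [q <y, e>].
    On the layer [D_r' \ (x + D_r)] the energy density is at most [h <y, e> + eps] with [h]
    integrable on the line, while the slice of the layer at height [s] has measure
    [O(r^(n-1))] unless [s] is within [O(1)] of the two ends; so the layer costs only
    [o(r^n)]. Hence [phit w <= phit (tau x w)] for all [x], which gives invariance, and the
    same comparison with [x = 0] reduces the liminf to integer radii.

    For a fixed competitor the energy is measurable in [w], because the integrand is a
    Caratheodory function. The energy is continuous for L2 convergence of the competitor and
    of its gradient, so on each strip the infimum runs over a countable dense set of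
    competitors. *)
Require Import Defs.
From HB Require Import structures.
From mathcomp Require Import all_boot all_order all_algebra.
From mathcomp Require Import all_classical all_reals all_analysis measurable_realfun.
From mathcomp Require Import ring lra.
Import Order.TTheory GRing.Theory Num.Theory.
Import numFieldNormedType.Exports.
Local Open Scope classical_set_scope.
Local Open Scope ring_scope.
Set Implicit Arguments. Unset Strict Implicit. Unset Printing Implicit Defensive.

(** * Lebesgue measure on row vectors *)

Section row_measurable.
Variable R : realType.

(** The [eps] in the density on the layer comes from [W] being merely continuous: its value at an
    interpolation between two values of the profile is not dominated by its values there, and only
    its decay to 0 far from the interface is available. Since the layer has volume O(r^n), an
    arbitrarily small constant density is still affordable. Gluing rests on the zero trace of
    [u - Q], where [Q] is the planar profile: extended by zero and translated, it stays a Sobolev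
    function, and it is added to the smooth interpolation. The thresholds and constants of the layer
    estimate see the environment only through the bound [Lam], so they are uniform in [w];
    invariance thus holds for every [w], with no exceptional null set. The radius r' may be taken
    anywhere in an interval of length 1, which lets it be an integer. The class of competitors does
    not depend on [w], so one countable family serves all environments. The dimension is [n.+1], so
    that R^(1-d) is [r ^- n]. The strips are tilted with respect to the coordinates in which
    integrals are iterated, whence a linear change of variables, with some constant factor. *)

Definition trow d (x : 'rV[R]_d) : d.-tuple R := [tuple x 0 i | i < d].

Lemma rowtK d : cancel (@rowt R d) (@trow d).
Proof. by move=> t; apply: eq_from_tnth => i; rewrite tnth_mktuple mxE. Qed.

Lemma trowK d : cancel (@trow d) (@rowt R d).
Proof. by move=> x; apply/rowP => i; rewrite mxE tnth_mktuple. Qed.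

(** The sigma-algebra is transported from tuples along the bijection [rowt], so that [rmeasurable]
    becomes plain measurability on rows. *)
Definition row_measurable d : set (set 'rV[R]_d) :=
  [set A | measurable ((@rowt R d) @^-1` A)].

Let row_set0 d : @row_measurable d set0.
Proof. by rewrite /row_measurable/= preimage_set0. Qed.

Let row_setC d A : @row_measurable d A -> @row_measurable d (~` A).
Proof. by rewrite /row_measurable/= preimage_setC => /measurableC. Qed.

Let row_bigcup d (F : (set 'rV[R]_d)^nat) : (forall i, row_measurable (F i)) ->
  row_measurable (\bigcup_i F i).
Proof.
by move=> mF; rewrite /row_measurable/= preimage_bigcup; apply: bigcup_measurable => k _; exact: mF.
Qed.

Definition row_display : measure_display.
Proof. exact: (measure_tuple_display default_measure_display). Qed.

HB.instance Definition _ d := @isMeasurable.Build row_display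
  'rV[R]_d (@row_measurable d) (@row_set0 d) (@row_setC d) (@row_bigcup d).

Lemma measurable_rowt d : measurable_fun [set: d.-tuple R] (@rowt R d).
Proof. by move=> _ Y mY; rewrite setTI. Qed.

Lemma measurable_trow d : measurable_fun [set: 'rV[R]_d] (@trow d).
Proof.
move=> _ Y mY; rewrite setTI /measurable/= /row_measurable/= -comp_preimage.
by rewrite (_ : _ \o _ = id)//; apply/funext => t /=; rewrite rowtK.
Qed.

Lemma rmeasurableP d (f : 'rV[R]_d -> R) :
  rmeasurable f <-> measurable_fun [set: 'rV[R]_d] f.
Proof.
split=> mf; last by apply: measurableT_comp => //; exact: measurable_rowt.
rewrite (_ : f = (fun t => f (rowt t)) \o (@trow d)).
  by apply: measurableT_comp => //; exact: measurable_trow.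
by apply/funext => x /=; rewrite trowK.
Qed.

Lemma measurable_coord d (i : 'I_d) : measurable_fun [set: 'rV[R]_d] (fun x => x 0 i).
Proof.
rewrite (_ : (fun x : 'rV[R]_d => x 0 i) = (fun t => tnth t i) \o (@trow d)).
  by apply: measurableT_comp; [exact: measurable_tnth|exact: measurable_trow].
by apply/funext => x /=; rewrite tnth_mktuple.
Qed.

Lemma measurable_fun_row d d' (T : measurableType d') (f : T -> 'rV[R]_d) :
  (forall i, measurable_fun [set: T] (fun t => f t 0 i)) ->
  measurable_fun [set: T] f.
Proof.
move=> mf; rewrite (_ : f = (@rowt R d) \o (fun t => trow (f t))); last first.
  by apply/funext => x /=; rewrite trowK.
apply: measurableT_comp; first exact: measurable_rowt.
apply/measurable_fun_tnthP => i; apply: eq_measurable_fun (mf i) => x _ /=.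
by rewrite tnth_mktuple.
Qed.

End row_measurable.

Section pushforward_sigma_finite.
Local Open Scope ereal_scope.
Context d1 d2 (T1 : measurableType d1) (T2 : measurableType d2) (R : realType).
Variables (m : {sigma_finite_measure set T1 -> \bar R}) (f : T1 -> T2) (g : T2 -> T1).
Hypotheses (mf : measurable_fun setT f) (mg : measurable_fun setT g) (gf : cancel f g).

(** The three proofs are arguments so that the measure structures below can be attached to the term.
    The measurable left inverse [g] is what carries a sigma-finite exhaustion over to the image. *)
Definition pushforward_can of measurable_fun setT f & measurable_fun setT g &
  cancel f g : set T2 -> \bar R := pushforward m f.

Let pf := pushforward_can mf mg gf.

Let pf0 : pf set0 = 0.
Proof. exact: measure0. Qed.

Let pf_ge0 A : 0 <= pf A.
Proof. exact: measure_ge0. Qed.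

Let pf_sigma : semi_sigma_additive pf.
Proof.
move=> F mF tF mUF; rewrite /pf /pushforward_can /pushforward preimage_bigcup.
apply: measure_semi_sigma_additive.
- by move=> k; rewrite -[X in measurable X]setTI; exact: mf.
- apply/trivIsetP => /= i j _ _ ij; rewrite -preimage_setI.
  by move/trivIsetP : tF => /(_ _ _ _ _ ij) ->//; rewrite preimage_set0.
- by rewrite -preimage_bigcup -[X in measurable X]setTI; exact: mf.
Qed.

HB.instance Definition _ := isMeasure.Build _ _ _ pf pf0 pf_ge0 pf_sigma.

Let pf_sigma_finite : sigma_finite setT pf.
Proof.
have /sigma_finiteP[F [TF ndF Foo]] := sigma_finiteT m.
exists (fun n => g @^-1` F n); first by rewrite -preimage_bigcup -TF preimage_setT.
move=> k; have [mFk Fk] := Foo k; split; first by rewrite -[X in measurable X]setTI; exact: mg.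
rewrite /pf /pushforward_can /pushforward -comp_preimage (_ : g \o f = id)//.
by apply/funext => x /=; rewrite gf.
Qed.

HB.instance Definition _ := Measure_isSigmaFinite.Build _ _ _ pf pf_sigma_finite.

End pushforward_sigma_finite.

Section product_sigma_finite.
Local Open Scope ereal_scope.
Context d1 d2 (T1 : measurableType d1) (T2 : measurableType d2) (R : realType).
Variable m1 : {sigma_finite_measure set T1 -> \bar R}.
Variable m2 : {sigma_finite_measure set T2 -> \bar R}.
(** A name for the product measure to which sigma-finiteness is attached, so that products can be
    iterated over the dimension. *)
Definition sfprod : set (T1*T2)%type -> \bar R := (m1 \x m2)%E.
HB.instance Definition _ := Measure.on sfprod.
Lemma sfprod_sigma_finite : sigma_finite setT sfprod.
Proof.
have /sigma_finiteP[F [TF ndF Foo]] := sigma_finiteT m1.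
have /sigma_finiteP[G [TG ndG Goo]] := sigma_finiteT m2.
exists (fun n => F n `*` G n); last first.
  move=> k; have [mF Fk] := Foo k; have [mG Gk] := Goo k.
  split; first exact: measurableX.
  by rewrite [X in X < _]product_measure1E// lte_mul_pinfty// ge0_fin_numE.
apply/esym/seteqP; split=> // -[x y] _.
have [i _ Fix] : (\bigcup_i F i) x by rewrite -TF.
have [j _ Gjy] : (\bigcup_i G i) y by rewrite -TG.
exists (maxn i j) => //; split => /=.
  by move: Fix; exact/subsetPset/ndF/leq_maxl.
by move: Gjy; exact/subsetPset/ndG/leq_maxr.
Qed.
HB.instance Definition _ := Measure_isSigmaFinite.Build _ _ _ sfprod sfprod_sigma_finite.

End product_sigma_finite.

Section row_lebesgue.
Local Open Scope ereal_scope.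
Variable R : realType.
Notation leb := (@lebesgue_measure R).

(* [lebesgue_measure] lives on [measurableTypeR R], whose measurable sets are
   those of [R] but which carries another display. *)
Notation RR := (measurableTypeR R).

Lemma measurable_RR d (T : measurableType d) D (f : T -> R) :
  measurable_fun D (f : T -> RR) <-> measurable_fun D f.
Proof. by []. Qed.

Definition tcons d (p : RR * d.-tuple R) : d.+1.-tuple R := [tuple of p.1 :: p.2].
Definition tuncons d (t : d.+1.-tuple R) : RR * d.-tuple R :=
  (thead t, [tuple of behead t]).

Lemma tconsK d : cancel (@tcons d) (@tuncons d).
Proof.
by case=> x t; rewrite /tuncons /tcons/=; congr pair; apply/val_inj.
Qed.

Lemma measurable_tcons d : measurable_fun [set: RR * d.-tuple R] (@tcons d).
Proof. by apply: measurable_cons => //; exact/measurable_RR. Qed.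

Lemma measurable_tuncons d : measurable_fun [set: d.+1.-tuple R] (@tuncons d).
Proof.
apply: measurable_fun_pair; last exact: measurable_behead.
exact: measurable_tnth.
Qed.

Fixpoint tmu (d : nat) : {sigma_finite_measure set (d.-tuple R) -> \bar R} :=
  match d with
  | 0 => [the {sigma_finite_measure set (0.-tuple R) -> \bar R} of dirac [tuple]]
  | d'.+1 => [the {sigma_finite_measure set (d'.+1.-tuple R) -> \bar R} of
      @pushforward_can _ _ (RR * d'.-tuple R)%type _ R
        (sfprod leb (tmu d')) _ _ (@measurable_tcons d') (@measurable_tuncons d')
        (@tconsK d')]
  end.

(** Tonelli, one coordinate at a time; the integrals of the definitions thereby become integrals
    against a single measure. *)
Lemma iintE d (f : d.-tuple R -> \bar R) : measurable_fun setT f ->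
  (forall t, 0 <= f t) -> iint f = \int[tmu d]_t f t.
Proof.
elim: d f => [|d IH] f mf f0.
  by rewrite /= integral_dirac// diracT mul1e.
rewrite /= ge0_integral_pushforward//; last exact: measurable_tcons.
rewrite preimage_setT fubini_tonelli1//; last 2 first.
- exact: (measurableT_comp mf (@measurable_tcons d)).
- by move=> x; exact: f0.
apply: eq_integral => x _; rewrite IH//=.
exact: (measurableT_comp mf (measurableT_comp (@measurable_tcons d)
  (@pair1_measurable _ _ RR _ x))).
Qed.

Definition vmu d : {sigma_finite_measure set 'rV[R]_d -> \bar R} :=
  [the {sigma_finite_measure set 'rV[R]_d -> \bar R} of
    pushforward_can (tmu d) (@measurable_rowt R d) (@measurable_trow R d) (@rowtK R d)].

Lemma integral_vmu d (f : 'rV[R]_d -> \bar R) : measurable_fun setT f ->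
  (forall t, 0 <= f t) -> \int[vmu d]_x f x = iint (f \o @rowt R d).
Proof.
move=> mf f0; rewrite iintE; last 2 first.
- exact: (measurableT_comp mf (@measurable_rowt R d)).
- by move=> t; exact: f0.
by rewrite /= ge0_integral_pushforward//; exact: measurable_rowt.
Qed.

Lemma lintE d (A : set 'rV[R]_d) (f : 'rV[R]_d -> \bar R) : measurable A ->
  measurable_fun A f -> (forall x, A x -> 0 <= f x) ->
  lint A f = \int[vmu d]_(x in A) f x.
Proof.
move=> mA mf f0; rewrite integral_mkcond integral_vmu.
- by congr iint; apply/funext => t /=; rewrite patchE.
- exact/(measurable_restrictT _ mA).
- by move=> x; rewrite patchE; case: ifPn => // /[!inE]; exact: f0.
Qed.

End row_lebesgue.
Arguments tmu : simpl never.
Arguments vmu : simpl never.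

(** * Fubini on rows, translations and linear changes of variables *)

Section row_cons.
Variable R : realType.

Definition row_cons d (s : R) (a : 'rV[R]_d) : 'rV[R]_d.+1 :=
  \row_i (if unlift ord0 i is Some j then a 0 j else s).

Lemma row_cons0 d s (a : 'rV[R]_d) : row_cons s a 0 ord0 = s.
Proof. by rewrite mxE unlift_none. Qed.

Lemma row_consS d s (a : 'rV[R]_d) i : row_cons s a 0 (lift ord0 i) = a 0 i.
Proof. by rewrite mxE liftK. Qed.

Lemma row_consD d s (a : 'rV[R]_d) (c : 'rV[R]_d.+1) :
  row_cons s a + c = row_cons (s + c 0 ord0) (a + \row_i c 0 (lift ord0 i)) :> 'rV[R]_d.+1.
Proof.
apply/rowP => i; rewrite mxE; case: (unliftP ord0 i) => [j ->|->].
  by rewrite !row_consS !mxE.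
by rewrite !row_cons0.
Qed.

Lemma rowt_cons d (x : R) (t : d.-tuple R) : rowt [tuple of x :: t] = row_cons x (rowt t).
Proof.
apply/rowP => i; rewrite mxE; case: (unliftP ord0 i) => [j ->|->].
  by rewrite row_consS tnthS mxE.
by rewrite row_cons0 tnth0.
Qed.

(** Here [r] is the half-side, whereas it is the side in [cube]. *)
Definition vcube d (c : 'rV[R]_d) (r : R) : set 'rV[R]_d :=
  [set x | forall i, `|x 0 i - c 0 i| < r].

End row_cons.

Section row_fubini.
Local Open Scope ereal_scope.
Variable R : realType.
Notation leb := (@lebesgue_measure R).
Notation RR := (measurableTypeR R).

Lemma measurable_row_cons d : measurable_fun [set: RR * 'rV[R]_d] (fun p => row_cons p.1 p.2).
Proof.
apply: measurable_fun_row => i; case: (unliftP ord0 i) => [j ->|->].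
  apply: eq_measurable_fun (measurableT_comp (@measurable_coord R d j) measurable_snd).
  by move=> p _ /=; rewrite row_consS.
apply: eq_measurable_fun (_ : measurable_fun setT (fst : RR * 'rV[R]_d -> R)).
  by move=> p _ /=; rewrite row_cons0.
exact/measurable_RR.
Qed.

Lemma measurable_row_cons2 d s : measurable_fun [set: 'rV[R]_d] (row_cons s).
Proof.
exact: (measurableT_comp (@measurable_row_cons d) (@pair1_measurable _ _ RR _ s)).
Qed.

Lemma measurable_section_int d d' (T : measurableType d') (f : T * 'rV[R]_d -> \bar R) :
  measurable_fun setT f -> (forall p, 0 <= f p) ->
  measurable_fun setT (fun s => \int[vmu R d]_a f (s, a)).
Proof. by move=> mf f0; apply: (measurable_fun_fubini_tonelli_F f). Qed.

Lemma integral_vmuS d (f : 'rV[R]_d.+1 -> \bar R) : measurable_fun setT f ->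
  (forall x, 0 <= f x) ->
  \int[vmu R d.+1]_x f x = \int[leb]_s \int[vmu R d]_a f (row_cons s a).
Proof.
move=> mf f0; rewrite integral_vmu//=; apply: eq_integral => s _.
rewrite integral_vmu//; last exact: (measurableT_comp mf (@measurable_row_cons2 d s)).
by congr iint; apply/funext => t /=; rewrite rowt_cons.
Qed.

Lemma lebesgue_measure_shift (a : R) (A : set R) : measurable A ->
  pushforward leb ((fun x => x + a)%R : RR -> RR) A = leb A.
Proof.
move=> mA; apply/esym/lebesgue_measure_unique => //=.
  by apply/measurable_RR; apply: measurable_funD.
move=> _ _ [[b c]] _ <-.
rewrite /pushforward (_ : _ @^-1` _ = `](b - a)%R, (c - a)%R]%classic); last first.
  by apply/seteqP; split => x /=; rewrite !in_itv/= ltrBlDr lerBrDr.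
rewrite !lebesgue_measure_itv/= !lte_fin ltrD2r; case: ifP => // _.
by rewrite -!EFinD; congr EFin; ring.
Qed.

Lemma ge0_integral_lebesgue_shift (a : R) (f : R -> \bar R) :
  measurable_fun setT f -> (forall x, 0 <= f x) ->
  \int[leb]_x f (x + a)%R = \int[leb]_x f x.
Proof.
move=> mf f0.
have ma : measurable_fun setT ((fun x => x + a)%R : RR -> RR).
  by apply/measurable_RR; apply: measurable_funD.
have := @ge0_integral_pushforward _ _ _ _ _ _ ma leb setT f measurableT mf.
rewrite preimage_setT /comp => <-//.
by apply: eq_measure_integral => A mA _; exact: lebesgue_measure_shift.
Qed.

Lemma measurable_addv d (a : 'rV[R]_d) :
  measurable_fun setT (fun x : 'rV[R]_d => x + a)%R.
Proof.
apply: measurable_fun_row => i.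
rewrite (_ : (fun t => _) = (fun x : 'rV[R]_d => (x 0 i)%R + (a 0 i)%R)%R).
  by apply: measurable_funD => //; exact: measurable_coord.
by apply/funext => x; rewrite mxE.
Qed.

(** Induction on the dimension: Tonelli splits off the first coordinate, shifted by invariance on
    the line, and the induction hypothesis shifts the remaining ones. *)
Lemma ge0_integral_vmu_shift d (a : 'rV[R]_d) (f : 'rV[R]_d -> \bar R) :
  measurable_fun setT f -> (forall x, 0 <= f x) ->
  \int[vmu R d]_x f (x + a)%R = \int[vmu R d]_x f x.
Proof.
elim: d a f => [|d IH] a f mf f0.
  by apply: eq_integral => x _; congr f; apply/rowP => -[].
rewrite (integral_vmuS mf f0) (integral_vmuS (measurableT_comp mf (measurable_addv a)) (fun x => f0 _)).
pose b : 'rV[R]_d := \row_i a 0%R (lift ord0 i).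
transitivity (\int[leb]_s \int[vmu R d]_x f (row_cons (s + a 0%R ord0)%R x)).
  apply: eq_integral => s _.
  rewrite -(IH b (fun x => f (row_cons (s + a 0%R ord0)%R x)))//.
    by apply: eq_integral => x _; rewrite /= row_consD.
  exact: (measurableT_comp mf (@measurable_row_cons2 d _)).
rewrite (ge0_integral_lebesgue_shift _ (f := fun s => \int[vmu R d]_x f (row_cons s x)))//.
- apply: (@measurable_section_int d _ RR (fun p => f (row_cons p.1 p.2))) => //.
  exact: (measurableT_comp mf (@measurable_row_cons d)).
- by move=> s; apply: integral_ge0.
Qed.

Lemma vmuE d (A : set 'rV[R]_d) : measurable A ->
  vmu R d A = \int[vmu R d]_x (\1_A x)%:E.
Proof. by move=> mA; rewrite integral_indic// setIT. Qed.

Lemma vmu_shift d (a : 'rV[R]_d) (A : set 'rV[R]_d) : measurable A ->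
  vmu R d ((fun x => x + a)%R @^-1` A) = vmu R d A.
Proof.
move=> mA.
have mD : measurable ((fun x => x + a)%R @^-1` A).
  by rewrite -[X in measurable X]setTI; exact: measurable_addv.
rewrite !vmuE// -(@ge0_integral_vmu_shift d a (fun x => (\1_A x)%:E))//.
exact/measurable_EFinP/measurable_indic.
Qed.

Lemma measurable_forall_ord d' (T : measurableType d') n (F : 'I_n -> set T) :
  (forall i, measurable (F i)) -> measurable [set x | forall i, F i x].
Proof.
move=> mF; rewrite (_ : [set x | _] = \bigcap_(i in [set: 'I_n]) F i); last first.
  by apply/seteqP; split => x /=; [move=> h i _; exact: h|move=> h i; exact: h].
by apply: fin_bigcap_measurable => //; exact: finite_finset.
Qed.

Lemma measurable_ballR (f : R -> R) c (r : R) : f =1 (fun x => x - c)%R ->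
  measurable [set s | `|f s| < r]%R.
Proof.
move=> fE; have mf : measurable_fun setT f.
  by rewrite (_ : f = fun x => x - c)%R; [exact: measurable_funB|exact/funext].
rewrite (_ : [set s | _] = (fun s => `|f s|%R) @^-1` `]-oo, r[%classic).
  by rewrite -[X in measurable X]setTI; apply: (measurableT_comp (@normr_measurable _ setT) mf).
by apply/seteqP; split => x /=; rewrite in_itv.
Qed.

Lemma measurable_vcube d (c : 'rV[R]_d) (r : R) :
  measurable (vcube c r).
Proof.
apply: measurable_forall_ord => i.
have := @measurable_ballR (fun x => x - c 0 i)%R (c 0 i)%R r (fun=> erefl).
move=> h; suff : measurable ((fun x : 'rV[R]_d => x 0%R i) @^-1` [set s | `|s - c 0%R i| < r]%R) by [].
by rewrite -[X in measurable X]setTI; apply: measurable_coord.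
Qed.

Lemma vmu_cube d (c : 'rV[R]_d) (r : R) : (0 < r)%R ->
  vmu R d (vcube c r) = ((r * 2) ^+ d)%:E.
Proof.
move=> r0; elim: d c => [|d IH] c; rewrite vmuE; try exact: measurable_vcube.
  rewrite integral_vmu//; last first.
    by apply/measurable_EFinP/measurable_indic; exact: measurable_vcube.
  by rewrite /= /indic mem_set// => -[].
rewrite integral_vmuS//; last first.
    by apply/measurable_EFinP/measurable_indic; exact: measurable_vcube.
pose b : 'rV[R]_d := \row_i c 0%R (lift ord0 i).
pose I0 := [set s : R | `|s - c 0 ord0| < r]%R.
have mI0 : measurable I0 by exact: (@measurable_ballR _ (c 0 ord0)%R).
transitivity (\int[leb]_s ((\1_I0 s)%:E * ((r * 2) ^+ d)%:E)).
  apply: eq_integral => s _; rewrite -(IH b) vmuE; last exact: measurable_vcube.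
  rewrite -ge0_integralZl//; last first.
    by apply/measurable_EFinP/measurable_indic; exact: measurable_vcube.
  apply: eq_integral => a _; rewrite !indicE -EFinM; congr EFin.
  rewrite -natrM mulnb; congr ((nat_of_bool _)%:R); rewrite -in_setI.
  apply/idP/idP => /[!inE] /=.
    move=> h; split; first by have := h ord0; rewrite row_cons0.
    by move=> i; have := h (lift ord0 i); rewrite row_consS /b mxE.
  move=> [h1 h2] i; case: (unliftP ord0 i) => [j ->|->]; last by rewrite row_cons0.
  by have := h2 j; rewrite row_consS /b mxE.
have k0 : 0 <= ((r * 2) ^+ d)%:E by rewrite lee_fin exprn_ge0// mulr_ge0// ltW.
rewrite ge0_integralZr//; last exact/measurable_EFinP/measurable_indic.
rewrite integral_indic// setIT exprS EFinM; congr (_ * _).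
rewrite (_ : I0 = ball (c 0 ord0)%R r); first by apply: (etrans (lebesgue_measure_ball _ (ltW r0))); rewrite mulr_natr.
by apply/seteqP; split => x; rewrite /I0 /ball/= distrC.
Qed.

Lemma measurable_fun_addv d d' (T : measurableType d') (f g : T -> 'rV[R]_d) :
  measurable_fun setT f -> measurable_fun setT g ->
  measurable_fun setT (fun x => f x + g x)%R.
Proof.
move=> mf mg; apply: measurable_fun_row => i.
rewrite (_ : (fun t => _) = (fun x => f x 0 i + g x 0 i)%R).
  apply: measurable_funD; first exact: (measurableT_comp (@measurable_coord R d i) mf).
  exact: (measurableT_comp (@measurable_coord R d i) mg).
by apply/funext => x; rewrite mxE.
Qed.

Lemma measurable_fun_oppv d d' (T : measurableType d') (f : T -> 'rV[R]_d) :
  measurable_fun setT f -> measurable_fun setT (fun x => - f x)%R.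
Proof.
move=> mf; apply: measurable_fun_row => i.
rewrite (_ : (fun t => _) = (fun x => - f x 0 i)%R).
  apply: (measurableT_comp (@oppr_measurable _ setT)).
  exact: (measurableT_comp (@measurable_coord R d i) mf).
by apply/funext => x; rewrite mxE.
Qed.

Lemma measurable_mulmx d d' (M : 'M[R]_(d, d')) :
  measurable_fun setT (fun x : 'rV[R]_d => x *m M).
Proof.
apply: measurable_fun_row => i.
rewrite (_ : (fun t => _) = (fun x : 'rV[R]_d => \sum_j x 0 j * M j i)%R).
  apply: measurable_sum => j; apply: measurable_funM => //.
  exact: measurable_coord.
by apply/funext => x; rewrite mxE.
Qed.

(** The classical uniqueness argument for Haar measure. Both sides are the double integral of
    [\1_A (x + y) * \1_B y]: integrating in [x] first gives the left side; exchanging the order,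
    translating [y] by [x] and exchanging back gives the right side. *)
Lemma haar_product d (nu : {sigma_finite_measure set 'rV[R]_d -> \bar R})
    (A B : set 'rV[R]_d) :
  (forall (a : 'rV[R]_d) (E : set 'rV[R]_d), measurable E ->
    nu ((fun x => x + a)%R @^-1` E) = nu E) ->
  measurable A -> measurable B ->
  vmu R d A * nu B = nu A * vmu R d (-%R @^-1` B).
Proof.
move=> nuD mA mB.
have nuI a (g : 'rV[R]_d -> \bar R) : measurable_fun setT g -> (forall x, 0 <= g x) ->
    \int[nu]_x g (x + a)%R = \int[nu]_x g x.
  move=> mg g0.
  have := @ge0_integral_pushforward _ _ _ _ _ _ (measurable_addv a) nu setT g measurableT mg.
  rewrite preimage_setT /comp => <-//.
  apply: eq_measure_integral; first exact: measurable_addv.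
  by move=> ? E mE _; exact: nuD.
have mN : measurable (-%R @^-1` B) by rewrite -[X in measurable X]setTI; exact: measurable_fun_oppv.
have mAB : measurable_fun setT
    (fun p : 'rV[R]_d * 'rV[R]_d => (\1_A (p.2 + p.1)%R : R)%:E * (\1_B p.1 : R)%:E).
  apply: emeasurable_funM; apply/measurable_EFinP.
    apply: (measurableT_comp (measurable_indic mA)).
    exact: measurable_fun_addv.
  exact: (measurableT_comp (measurable_indic mB) measurable_fst).
have mAB2 : measurable_fun setT
    (fun p : 'rV[R]_d * 'rV[R]_d => (\1_A p.1 : R)%:E * (\1_B (p.1 - p.2)%R : R)%:E).
  apply: emeasurable_funM; apply/measurable_EFinP.
    exact: (measurableT_comp (measurable_indic mA) measurable_fst).
  apply: (measurableT_comp (measurable_indic mB)).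
  apply: measurable_fun_addv => //.
  exact: measurable_fun_oppv.
have i0 (E F : set 'rV[R]_d) x y : 0 <= (\1_E x)%:E * (\1_F y)%:E :> \bar R.
  by rewrite -EFinM lee_fin mulr_ge0.
transitivity (\int[nu]_y \int[vmu R d]_x ((\1_A (x + y))%:E * (\1_B y)%:E)).
  rewrite (_ : nu B = \int[nu]_y (\1_B y)%:E); last by rewrite integral_indic// setIT.
  rewrite -ge0_integralZl//; last exact/measurable_EFinP/measurable_indic.
  apply: eq_integral => y _.
  rewrite ge0_integralZr//; last first.
    apply/measurable_EFinP.
    exact: (measurableT_comp (measurable_indic mA) (measurable_addv y)).
  rewrite (@ge0_integral_vmu_shift d y (fun x => (\1_A x)%:E))// -?vmuE//.
  exact/measurable_EFinP/measurable_indic.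
rewrite (fubini_tonelli (m1 := nu) (m2 := vmu R d)
  (fun p => (\1_A (p.2 + p.1)%R)%:E * (\1_B p.1)%:E))//.
transitivity (\int[vmu R d]_x \int[nu]_y ((\1_A y)%:E * (\1_B (y - x)%R)%:E)).
  apply: eq_integral => x _.
  rewrite -[RHS](nuI x)//.
    by apply: eq_integral => y _; rewrite addrK addrC.
  exact: (measurableT_comp mAB2 (@pair2_measurable _ _ _ _ x)).
rewrite -(fubini_tonelli (m1 := nu) (m2 := vmu R d)
  (fun p => (\1_A p.1)%:E * (\1_B (p.1 - p.2)%R)%:E))//=.
rewrite (_ : nu A = \int[nu]_y (\1_A y)%:E); last by rewrite integral_indic// setIT.
rewrite -ge0_integralZr//; last exact/measurable_EFinP/measurable_indic.
apply: eq_integral => y _; rewrite ge0_integralZl//; last first.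
  apply/measurable_EFinP; apply: (measurableT_comp (measurable_indic mB)).
  apply: measurable_fun_addv => //; exact: measurable_fun_oppv.
congr (_ * _); rewrite vmuE// -(@ge0_integral_vmu_shift d (- y)%R)//.
  by apply: eq_integral => x _; rewrite -[in LHS](opprB x y).
exact/measurable_EFinP/measurable_indic.
Qed.

(** The image of [vmu] under [M] is again translation invariant, hence proportional to [vmu] by
    [haar_product]. The test set is the unit cube, which is symmetric, so the reflection in
    [haar_product] disappears. *)
Lemma vmu_linear_change d (M N : 'M[R]_d) : M *m N = 1%:M -> N *m M = 1%:M ->
  exists c : R, (0 <= c)%R /\ forall f : 'rV[R]_d -> \bar R,
    measurable_fun setT f -> (forall x, 0 <= f x) ->
    \int[vmu R d]_x f (x *m M) = c%:E * \int[vmu R d]_x f x.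
Proof.
move=> MN NM.
have MK : cancel (fun x : 'rV[R]_d => x *m M) (fun x => x *m N).
  by move=> x; rewrite -mulmxA MN mulmx1.
pose nu : {sigma_finite_measure set 'rV[R]_d -> \bar R} :=
  [the {sigma_finite_measure set 'rV[R]_d -> \bar R} of
    pushforward_can (vmu R d) (measurable_mulmx M) (measurable_mulmx N) MK].
have nuD (a : 'rV[R]_d) (E : set 'rV[R]_d) : measurable E -> nu ((fun x => x + a)%R @^-1` E) = nu E.
  move=> mE.
  have nuE0 F : nu F = vmu R d ((fun x => x *m M) @^-1` F) by [].
  rewrite !nuE0.
  rewrite -[in RHS](vmu_shift (a *m N)); last first.
    by rewrite -[X in measurable X]setTI; exact: measurable_mulmx.
  congr (vmu R d _); apply/seteqP; split => x /=; by rewrite mulmxDl -mulmxA NM mulmx1.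
pose B := vcube (0%R : 'rV[R]_d) 1%R.
have mB : measurable B by exact: measurable_vcube.
have BN : -%R @^-1` B = B.
  by apply/seteqP; split => x /= h i; have := h i; rewrite !mxE !subr0 normrN.
have vB : vmu R d B = ((1 * 2) ^+ d)%:E by exact: vmu_cube.
(* If [x *m M] lies in the unit cube then [x = (x *m M) *m N] has coordinates bounded by the column
   sums of [N]; the cube of half-side [K] therefore contains the preimage, which has finite
   measure. *)
pose K : R := (1 + \sum_i \sum_j `|N j i|)%R.
have K0 : (0 < K)%R by rewrite ltr_pwDl// sumr_ge0// => i _; rewrite sumr_ge0.
have nuB : nu B \is a fin_num.
  rewrite ge0_fin_numE//.
  apply: (@le_lt_trans _ _ (vmu R d (vcube 0%R K)));
    last by rewrite vmu_cube// ltry.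
  apply: (@le_measure _ _ _ (vmu R d)); rewrite ?inE; try exact: measurable_vcube.
    by rewrite -[X in measurable X]setTI; exact: measurable_mulmx.
  move=> x /= h i; rewrite -(MK x) !mxE subr0.
  apply: (le_lt_trans (ler_norm_sum _ _ _)).
  apply: (@le_lt_trans _ _ (\sum_j `|N j i|)%R).
    apply: ler_sum => j _; rewrite normrM ler_piMl//.
    by have := h j; rewrite [X in `|_ - X|%R]mxE subr0 => /ltW.
  rewrite /K; apply: (@le_lt_trans _ _ (\sum_i \sum_j `|N j i|)%R); last by rewrite ltrDr.
  rewrite [leRHS](bigD1 i)//= lerDl sumr_ge0// => k _; exact: sumr_ge0.
have k0 : (0 < (1 * 2) ^+ d :> R)%R by rewrite exprn_gt0// mulr_gt0.
pose c := (fine (nu B) / (1 * 2) ^+ d)%R.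
have c0 : (0 <= c)%R by rewrite divr_ge0 ?fine_ge0// ltW.
exists c; split => // f mf f0.
have nuE A : measurable A -> nu A = c%:E * vmu R d A.
  move=> mA; have := haar_product nuD mA mB.
  rewrite BN vB -(fineK nuB) => /(congr1 (fun x => x * (((1 * 2) ^+ d)^-1)%:E)).
  by rewrite -!muleA -!EFinM divff ?gt_eqF// mule1 -/c muleC => ->.
transitivity (\int[nu]_x f x).
  have := @ge0_integral_pushforward _ _ _ _ _ _ (measurable_mulmx M) (vmu R d) setT f measurableT mf.
  by rewrite preimage_setT => <-.
rewrite -[c]/((NngNum c0)%:num) -ge0_integral_mscale//.
by apply: eq_measure_integral => A mA _; exact: nuE.
Qed.

End row_fubini.

(** * Caratheodory functions *)

Section caratheodory.
Variable R : realType.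

Lemma measurable_exists_count d' (T : measurableType d') (K : countType)
  (F : K -> set T) : (forall k, measurable (F k)) -> measurable [set x | exists k, F k x].
Proof.
move=> mF; rewrite (_ : [set x | _] =
    \bigcup_n (if unpickle n is Some k then F k else set0)); last first.
  apply/seteqP; split => x /=.
    by move=> [k Fkx]; exists (pickle k) => //; rewrite pickleK.
  by move=> [n _]; case: unpickle => // k Fkx; exists k.
by apply: bigcupT_measurable => n; case: unpickle.
Qed.

Definition round_row d (k : nat) (x : 'rV[R]_d) : 'rV[int]_d :=
  \row_i Num.floor (x 0 i * k.+1%:R).

Definition unround_row d (k : nat) (z : 'rV[int]_d) : 'rV[R]_d :=
  \row_i ((z 0 i)%:~R / k.+1%:R).

Lemma round_row_dist d k (x : 'rV[R]_d) i :
  `|x 0 i - unround_row k (round_row k x) 0 i| <= k.+1%:R^-1.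
Proof.
rewrite !mxE; set y := x 0 i; have k0 : 0 < k.+1%:R :> R by [].
have -> : y - (Num.floor (y * k.+1%:R))%:~R / k.+1%:R =
    (y * k.+1%:R - (Num.floor (y * k.+1%:R))%:~R) / k.+1%:R.
  by rewrite mulrBl mulfK// gt_eqF.
rewrite normrM [X in _ * X]ger0_norm ?invr_ge0// ler_piMl ?invr_ge0//.
have /andP[h1 h2] := floor_itv (y * k.+1%:R).
rewrite ger0_norm ?subr_ge0// lerBlDr addrC ltW//.
by rewrite (lt_le_trans h2)// intrD.
Qed.

Lemma cvg_round_row d (x : 'rV[R]_d) :
  unround_row k (round_row k x) @[k --> \oo] --> x.
Proof.
apply/cvg_ballP => e e0.
have /cvgrPdist_lt/(_ e e0) := @cvg_harmonic R.
apply: filterS => k /= h.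
split => // i j; rewrite ord1 /ball/=.
apply: le_lt_trans (round_row_dist k x j) _.
by move: h; rewrite sub0r normrN ger0_norm// invr_ge0.
Qed.

Lemma measurable_round_row d k (z : 'rV[int]_d) : measurable [set x | round_row k x = z].
Proof.
rewrite (_ : [set x | _] = [set x : 'rV[R]_d | forall i,
    ((fun x : 'rV[R]_d => x 0 i * k.+1%:R) @^-1`
      [set` `[(z 0 i)%:~R, (z 0 i + 1)%:~R[]) x]);
    last first.
  apply/seteqP; split => x /=.
    move=> <- i; rewrite in_itv/= mxE; exact: floor_itv.
  move=> h; apply/rowP => i; rewrite mxE; apply: floor_def.
  by have := h i; rewrite in_itv.
apply: measurable_forall_ord => i; rewrite -[X in measurable X]setTI.
by apply: measurable_funM => //; exact: measurable_coord.
Qed.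

(* The second argument is rounded on a grid of step [1 / k]. *)
Lemma measurable_caratheodory d' (T : measurableType d') d (F : T -> 'rV[R]_d -> R) :
  (forall p, measurable_fun setT (F^~ p)) -> (forall t, continuous (F t)) ->
  measurable_fun setT (fun z : T * 'rV[R]_d => F z.1 z.2).
Proof.
move=> mF cF.
apply: (@measurable_fun_cvg _ _ _ _
  (fun k z => F z.1 (unround_row k (round_row k z.2)))) => [k|z _].
  move=> _ Y mY; rewrite setTI.
  (* The rounded point takes countably many values, so the preimage is a countable union of
     measurable rectangles. *)
  rewrite (_ : _ @^-1` Y = [set z : T * 'rV[R]_d | exists m : 'rV[int]_d,
     ((fun t => F t (unround_row k m)) @^-1` Y `*` [set x | round_row k x = m]) z]).
    apply: measurable_exists_count => m; apply: measurableX.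
      by rewrite -[X in measurable X]setTI; exact: mF.
    exact: measurable_round_row.
  apply/seteqP; split => -[t x]/=; first by exists (round_row k x).
  by move=> [m [? ->]].
apply: (@cvg_comp _ _ _ (fun k => unround_row k (round_row k z.2)) (F z.1) _ (nbhs z.2)).
  exact: cvg_round_row.
exact: cF.
Qed.

(** A Caratheodory function with a dummy parameter. This links the topology of rows to their product
    sigma-algebra. *)
Lemma continuous_measurable_row d (f : 'rV[R]_d -> R) : continuous f ->
  measurable_fun setT f.
Proof.
move=> cf.
have h := @measurable_caratheodory _ R d (fun=> f) (fun p => measurable_cst (f p)) (fun=> cf).
exact: (measurableT_comp h (@pair1_measurable _ _ _ _ (0 : R))).
Qed.

End caratheodory.

(** * Separability of L2 *)

Section L2_separable.
Local Open Scope ereal_scope.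
Context d (T : measurableType d) (R : realType) (mu : {measure set T -> \bar R}).
Variables (D : set T) (K : countType) (A : K -> set T) (kT : K).
Hypotheses (mD : measurable D) (muD : mu D < +oo).
Hypotheses (AE : @measurable _ T = <<s range A >>) (AI : setI_closed (range A)).
Hypothesis AT : A kT = setT.

Let sq (f : T -> R) : \bar R := \int[mu]_(x in D) ((f x) ^+ 2)%:E.

(** The index type is countable because both the coefficients and the generating pi-system are. *)
Definition rat_comb (l : seq (rat * K)) (x : T) : R :=
  (\sum_(p <- l) ratr p.1 * \1_(A p.2) x)%R.

Let mA k : measurable (A k).
Proof. by rewrite AE; apply: sub_sigma_algebra; exists k. Qed.

Lemma measurable_rat_comb l : measurable_fun setT (rat_comb l).
Proof.
by apply: measurable_sum => p; apply: measurable_funM.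
Qed.

Let msq (f : T -> R) : measurable_fun setT f ->
  measurable_fun D (fun x => ((f x) ^+ 2)%:E).
Proof.
by move=> mf; apply/measurable_EFinP; apply: measurable_funX; exact: measurable_funTS.
Qed.

Let sq_ge0 f : 0 <= sq f.
Proof. by apply: integral_ge0 => x _; rewrite lee_fin sqr_ge0. Qed.

Let sqD (f g : T -> R) : measurable_fun setT f -> measurable_fun setT g ->
  sq (fun x => f x + g x)%R <= 2%:E * sq f + 2%:E * sq g.
Proof.
move=> mf mg; rewrite /sq -!ge0_integralZl//; last 4 first.
- exact: msq. - by move=> x _; rewrite lee_fin sqr_ge0.
- exact: msq. - by move=> x _; rewrite lee_fin sqr_ge0.
rewrite -ge0_integralD//; last 4 first.
- by move=> x _; rewrite mule_ge0// lee_fin sqr_ge0.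
- by apply: measurable_funeM; exact: msq.
- by move=> x _; rewrite mule_ge0// lee_fin sqr_ge0.
- by apply: measurable_funeM; exact: msq.
apply: ge0_le_integral => //.
- by move=> x _; rewrite lee_fin sqr_ge0.
- by apply: msq; exact: measurable_funD.
- by apply: emeasurable_funD; apply: measurable_funeM; exact: msq.
- move=> x _; rewrite -!EFinM -EFinD lee_fin.
  have := sqr_ge0 (f x - g x)%R; rewrite !sqrrD !sqrrN; lra.
Qed.

Let sqZ (a : R) (f : T -> R) : measurable_fun setT f -> sq (fun x => a * f x)%R = (a ^+ 2)%:E * sq f.
Proof.
move=> mf; rewrite /sq -ge0_integralZl//; last 3 first.
- exact: msq.
- by move=> x _; rewrite lee_fin sqr_ge0.
- by rewrite lee_fin sqr_ge0.
by apply: eq_integral => x _; rewrite exprMn EFinM.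
Qed.

(** Membership in the L2(D)-closure of the rational combinations. This class is shown to be a real
    vector space closed under L2 limits and to contain all indicators, hence all square-integrable
    functions. *)
Let app (f : T -> R) := measurable_fun setT f /\
  forall e : R, (0 < e)%R -> exists l, sq (fun x => f x - rat_comb l x)%R < e%:E.

Let app_eq f g : f =1 g -> app f -> app g.
Proof. by move=> /funext ->. Qed.

Let app_closed (f : T -> R) : measurable_fun setT f ->
  (forall e : R, (0 < e)%R -> exists2 g, app g & sq (fun x => f x - g x)%R < e%:E) ->
  app f.
Proof.
move=> mf h; split => // e e0.
(* The quarter compensates the factor 2 in [sqD], for each of two terms. *)
have e4 : (0 < e / 4)%R by rewrite divr_gt0.
have [g [mg /(_ _ e4)[l gl]] fg] := h _ e4.
exists l; have mgl : measurable_fun setT (fun x => g x - rat_comb l x)%R.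
  by apply: measurable_funB => //; exact: measurable_rat_comb.
have mfg : measurable_fun setT (fun x => f x - g x)%R by exact: measurable_funB.
have := sqD mfg mgl.
rewrite (_ : (fun x => _) = (fun x => f x - rat_comb l x)%R); last first.
  by apply/funext => x; rewrite addrA subrK.
move=> /le_lt_trans; apply.
rewrite (_ : e%:E = 2%:E * (e / 4)%:E + 2%:E * (e / 4)%:E).
  by apply: lteD; rewrite lte_pmul2l.
by rewrite -!EFinM -EFinD; congr EFin; field.
Qed.

Let appD f g : app f -> app g -> app (fun x => f x + g x)%R.
Proof.
move=> [mf hf] [mg hg]; split; first exact: measurable_funD.
move=> e e0; have e4 : (0 < e / 4)%R by rewrite divr_gt0.
have [l1 h1] := hf _ e4; have [l2 h2] := hg _ e4.
exists (l1 ++ l2).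
have m1 : measurable_fun setT (fun x => f x - rat_comb l1 x)%R.
  by apply: measurable_funB => //; exact: measurable_rat_comb.
have m2 : measurable_fun setT (fun x => g x - rat_comb l2 x)%R.
  by apply: measurable_funB => //; exact: measurable_rat_comb.
have := sqD m1 m2.
rewrite (_ : (fun x => _) = (fun x => f x + g x - rat_comb (l1 ++ l2) x)%R); last first.
  by apply/funext => x; rewrite /rat_comb big_cat/=; ring.
move=> /le_lt_trans; apply.
rewrite (_ : e%:E = 2%:E * (e / 4)%:E + 2%:E * (e / 4)%:E).
  by apply: lteD; rewrite lte_pmul2l.
by rewrite -!EFinM -EFinD; congr EFin; field.
Qed.

Let appQ (r : rat) f : app f -> app (fun x => ratr r * f x)%R.
Proof.
move=> [mf hf]; split; first exact: measurable_funM.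
move=> e e0.
have q0 : (0 < (ratr r : R) ^+ 2 + 1)%R by rewrite ltr_wpDl// sqr_ge0.
have [l hl] := hf _ (divr_gt0 e0 q0).
exists [seq ((r * p.1)%R, p.2) | p <- l].
have ml : measurable_fun setT (fun x => f x - rat_comb l x)%R.
  by apply: measurable_funB => //; exact: measurable_rat_comb.
rewrite (_ : (fun x => _) = (fun x => ratr r * (f x - rat_comb l x))%R); last first.
  apply/funext => x; rewrite mulrBr; congr (_ - _)%R.
  rewrite /rat_comb big_map mulr_sumr; apply: eq_bigr => p _.
  transitivity (ratr r * ratr p.1 * \1_(A p.2) x : R)%R; last exact/esym/mulrA.
  congr (_ * _)%R; exact: (rmorphM (@ratr R)).
rewrite sqZ//; have l0 := sq_ge0 (fun x => f x - rat_comb l x)%R.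
have lf : sq (fun x => f x - rat_comb l x)%R \is a fin_num.
  by rewrite ge0_fin_numE// (lt_trans hl)// ltry.
move: hl; rewrite -(fineK lf) -EFinM !lte_fin ltr_pdivlMr// => /le_lt_trans -> //.
have : (0 <= fine (sq (fun x => f x - rat_comb l x)))%R by exact: fine_ge0.
set u := fine _; have := sqr_ge0 (ratr r : R); set v := (_ ^+ 2)%R; nra.
Qed.

Let app_fin f : app f -> sq f < +oo.
Proof.
move=> [mf /(_ 1%R ltr01)[l hl]].
have ml := measurable_rat_comb l.
have m2 : measurable_fun setT (fun x => f x - rat_comb l x)%R by exact: measurable_funB.
have := sqD m2 ml.
rewrite (_ : (fun x => _) = f); last by apply/funext => x; rewrite subrK.
move=> /le_lt_trans; apply; apply: lte_add_pinfty.
  by rewrite lte_mul_pinfty// ?ge0_fin_numE// (lt_trans hl)// ltry.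
rewrite lte_mul_pinfty//.
pose M : R := (\sum_(p <- l) `|ratr p.1|)%R.
have bM x : (rat_comb l x ^+ 2 <= M ^+ 2)%R.
  rewrite -real_normK ?num_real// ler_pXn2r ?nnegrE ?sumr_ge0//.
  apply: (le_trans (ler_norm_sum _ _ _)); apply: ler_sum => p _.
  by rewrite normrM ler_piMr// indicE; case: (_ \in _); rewrite ?normr0 ?normr1.
apply: (@le_lt_trans _ _ (\int[mu]_(x in D) (M ^+ 2)%:E)).
  apply: ge0_le_integral => //.
  - by move=> x _; rewrite lee_fin sqr_ge0.
  - exact: msq.
  - by move=> x _; rewrite lee_fin.
rewrite integral_cst// lte_mul_pinfty// lee_fin; exact: sqr_ge0.
Qed.

Let appZ (a : R) f : app f -> app (fun x => a * f x)%R.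
Proof.
move=> af; have [mf hf] := af; have ff := app_fin af.
apply: app_closed; first exact: measurable_funM.
move=> e e0.
have ffin : sq f \is a fin_num by rewrite ge0_fin_numE.
have b0 : (0 < fine (sq f) + 1)%R by rewrite ltr_wpDl// fine_ge0.
(* For a rational within [dl] of [a] the squared error is at most [dl ^+ 2 * sq f], and [dl <= 1]
   bounds this by [dl * sq f < e]. *)
pose dl := Num.min 1%R (e / (fine (sq f) + 1))%R.
have dl0 : (0 < dl)%R by rewrite lt_min ltr01/= divr_gt0.
have [r] : exists r : rat, (ratr r \in `]a, (a + dl)%R[)%R.
  by apply: rat_in_itvoo; rewrite ltrDl.
rewrite in_itv/= => /andP[ar ra].
exists (fun x => ratr r * f x)%R; first exact: appQ.
rewrite (_ : (fun x => _) = (fun x => (a - ratr r) * f x)%R); last first.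
  by apply/funext => x; rewrite mulrBl.
rewrite sqZ// -(fineK ffin) -EFinM lte_fin.
have dl1 : (dl <= 1)%R by rewrite ge_min lexx.
have dle : (dl * (fine (sq f) + 1) <= e)%R by rewrite -ler_pdivlMr// ge_min lexx orbT.
apply: (@le_lt_trans _ _ (dl * fine (sq f))%R).
  apply: ler_wpM2r; first exact: fine_ge0.
  rewrite -real_normK ?num_real// (@le_trans _ _ (dl ^+ 2)%R)//.
    rewrite ler_pXn2r ?nnegrE//; last exact: ltW.
    by rewrite ltr0_norm ?subr_lt0//; lra.
  by rewrite expr2 ler_piMl// ltW.
by apply: lt_le_trans dle; rewrite ltr_pM2l// ltrDl.
Qed.

(** Pi-lambda induction: the generators are approximable by definition, complements use that the
    whole space is a generator, and disjoint unions are L2 limits of their finite parts because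
    [mu D] is finite. *)
Let app_indic (S : set T) : measurable S -> app (\1_S : T -> R).
Proof.
have appA k : app (\1_(A k) : T -> R).
  split; first exact: measurable_indic.
  move=> e e0; exists [:: (1%R, k)].
  rewrite /sq (eq_integral (fun=> 0)) ?integral0 ?lte_fin// => x _.
  by rewrite /rat_comb big_seq1/= rmorph1 mul1r subrr expr0n.
rewrite AE; apply: (dynkin_induction (P := fun S => app (\1_S : T -> R)) AE AI) => //.
- by rewrite -AT.
- by move=> _ [k _ <-].
- move=> {}S mS aS; apply: app_eq (appD (appA kT) (appZ (-1) aS)) => x.
  by rewrite AT !indicE in_setT in_setC mulN1r; case: (_ \in _) => /=; rewrite ?subrr ?subr0.
move=> F mF tF aF.
have aFn n : app (\1_(\bigcup_(i < n) F i) : T -> R).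
  elim: n => [|n IH].
    apply: app_eq (appZ 0 (appA kT)) => x.
    by rewrite mul0r indicE bigcup_mkord big_ord0 in_set0.
  apply: app_eq (appD IH (aF n)) => x.
  rewrite !bigcup_mkord big_ord_recr/= !indicE in_setU -bigcup_mkord.
  have [h1|h1] /= := boolP (x \in \bigcup_(i < n) F i); last by rewrite add0r.
  have [h2|h2] /= := boolP (x \in F n); last by rewrite addr0.
  exfalso; move: h1 h2; rewrite !inE => -[i /= ilt Fi] Fn.
  have : i = n by apply: (tF i n) => //; exists x.
  by move=> iE; move: ilt; rewrite iE ltnn.
have mU : measurable (\bigcup_k F k) by exact: bigcupT_measurable.
apply: app_closed; first exact: measurable_indic.
move=> e e0.
(* The measure of [G n] is the squared L2(D) distance from the union to its first [n] sets; it tends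
   to 0 by continuity from above. *)
pose G n := D `&` (\bigcup_k F k `\` \bigcup_(i < n) F i).
have mG n : measurable (G n).
  apply: measurableI => //; apply: measurableD => //.
  by apply: bigcup_measurable => k _.
have ndG : nonincreasing_seq G.
  move=> m n mn; apply/subsetPset => x [Dx [Ux nx]]; split => //; split => //.
  by move=> [i /= im Fi]; apply: nx; exists i => //=; exact: leq_trans mn.
have capG : \bigcap_n G n = set0.
  apply/seteqP; split => // x h.
  have [_ [[k _ Fk] _]] := h 0%N I.
  by have [_ [_]] := h k.+1 I; apply; exists k => /=.
have G0 : mu (G 0%N) < +oo by rewrite (le_lt_trans _ muD)// le_measure ?inE//; exact: subIsetl.
have := nonincreasing_cvg_mu G0 mG (bigcapT_measurable mG) ndG.
rewrite capG measure0 => /fine_cvgP[_ /cvgrPdist_lt/(_ _ e0)[N _ hN]].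
have := hN N (leqnn N); rewrite /= sub0r normrN ger0_norm ?fine_ge0// => GN.
exists (\1_(\bigcup_(i < N) F i)) => //.
rewrite /sq (eq_integral (fun x => (\1_(\bigcup_k F k `\` \bigcup_(i < N) F i) x)%:E)).
  rewrite integral_indic//; last by apply: measurableD => //; apply: bigcup_measurable => k _.
  rewrite setIC -/(G N) -[ltLHS]fineK ?lte_fin//.
  by rewrite ge0_fin_numE// (le_lt_trans _ muD)// le_measure ?inE//; exact: subIsetl.
move=> x _; rewrite !indicE in_setD; congr EFin.
have [h|h] /= := boolP (x \in \bigcup_(i < N) F i); last first.
  by rewrite subr0 andbT; case: (x \in \bigcup_k F k); rewrite /= ?expr1n ?expr0n.
rewrite andbF (_ : x \in \bigcup_k F k) ?subrr ?expr0n//.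
by move: h; rewrite !inE => -[i _ Fi]; exists i.
Qed.

Let app_sum (I : Type) (s : seq I) (g : I -> T -> R) : (forall i, app (g i)) ->
  app (fun x => \sum_(i <- s) g i x)%R.
Proof.
move=> ag; elim: s => [|i s IH].
  apply: app_eq (appZ 0 (app_indic measurableT)) => x; by rewrite big_nil mul0r.
by apply: app_eq (appD (ag i) IH) => x; rewrite big_cons.
Qed.

Import HBNNSimple.

Let app_nnsfun (f : {nnsfun T >-> R}) : app f.
Proof.
pose s : seq R := finmap.enum_fset (fset_set (range f)).
apply: (@app_eq (fun x => \sum_(y <- s) y * \1_(f @^-1` [set y]) x)%R).
  by move=> x; rewrite [RHS]fimfunE fsbig_finite.
by apply: app_sum => y; apply: appZ; exact: app_indic.
Qed.

Let app_ge0 (f : T -> R) : measurable_fun setT f -> (forall x, 0 <= f x)%R ->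
  sq f < +oo -> app f.
Proof.
move=> mf f0 ff; apply: app_closed => // e e0.
have mEf : measurable_fun setT (EFin \o f) by exact/measurable_EFinP.
pose g := nnsfun_approx measurableT mEf.
have gf x : g n x @[n --> \oo] --> f x.
  have := @cvg_nnsfun_approx _ _ _ _ measurableT _ mEf (fun x _ => f0 x) x I.
  by move=> /fine_cvg.
have ndg x : nondecreasing_seq (g ^~ x).
  by move=> m n mn; exact/lefP/nd_nnsfun_approx.
have gle n x : (g n x <= f x)%R.
  have <- : limn (g ^~ x) = f x by apply: cvg_lim.
  by apply: nondecreasing_cvgn_le => //; apply/cvg_ex; exists (f x).
have mg n : measurable_fun setT (fun x => f x - g n x)%R by apply: measurable_funB.
(* The simple functions increase to [f] from below, so [f ^+ 2] dominates the squared errors. *)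
have [] := @dominated_convergence _ _ _ mu D mD (fun n x => ((f x - g n x) ^+ 2)%:E)
  (cst 0) (fun x => (f x ^+ 2)%:E) (fun n => msq (mg n)) (measurable_cst _).
- apply: aeW => x Dx; apply/cvg_EFin; first by near=> n.
  rewrite (_ : (0 : R) = (f x - f x) * (f x - f x))%R; last by rewrite subrr mul0r.
  have h : (f x - g n x)%R @[n --> \oo] --> (f x - f x)%R by apply: cvgB => //; exact: cvg_cst.
  exact: (cvgM h h).
- apply/integrableP; split; first exact: msq.
  rewrite (eq_integral (fun x => (f x ^+ 2)%:E))// => x _.
  by rewrite gee0_abs// lee_fin sqr_ge0.
- apply: aeW => x n Dx; rewrite gee0_abs ?lee_fin ?sqr_ge0// ler_pXn2r ?nnegrE ?subr_ge0//.
  by rewrite gerBl.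
move=> _ _; rewrite integral0 => /fine_cvgP[[N1 _ h1] /cvgrPdist_lt/(_ _ e0)[N2 _ h2]].
pose N := maxn N1 N2.
have := h2 N (leq_maxr _ _); have := h1 N (leq_maxl _ _) => /= fN.
rewrite sub0r normrN ger0_norm ?fine_ge0 => [hN| |]; last exact: sq_ge0.
exists (g N); first exact: app_nnsfun.
by rewrite -[ltLHS](fineK fN) lte_fin.
Unshelve. all: by end_near.
Qed.

Lemma L2_separable (f : T -> R) (e : R) : measurable_fun setT f ->
  \int[mu]_(x in D) ((f x) ^+ 2)%:E < +oo -> (0 < e)%R ->
  exists l, \int[mu]_(x in D) ((f x - rat_comb l x) ^+ 2)%:E < e%:E.
Proof.
move=> mf ff e0.
have pf (h : T -> R) : (forall x, h x ^+ 2 <= f x ^+ 2)%R ->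
    measurable_fun setT h -> sq h < +oo.
  move=> hf mh; apply: le_lt_trans ff; apply: ge0_le_integral => //.
  - by move=> x _; rewrite lee_fin sqr_ge0.
  - exact: msq.
  - exact: msq.
  - by move=> x _; rewrite lee_fin.
have mp : measurable_fun setT (fun x => Num.max (f x) 0)%R by exact: measurable_maxr.
have mn : measurable_fun setT (fun x => Num.max (- f x) 0)%R.
  by apply: measurable_maxr => //; apply: measurableT_comp.
have ap : app (fun x => Num.max (f x) 0)%R.
  apply: app_ge0 => //; first by move=> x; rewrite le_max lexx orbT.
  apply: pf => // x; case: (leP (f x) 0)%R => // _.
  by rewrite expr0n sqr_ge0.
have an : app (fun x => Num.max (- f x) 0)%R.
  apply: app_ge0 => //; first by move=> x; rewrite le_max lexx orbT.
  apply: pf => // x; case: (leP (- f x) 0)%R => // _; last by rewrite sqrrN.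
  by rewrite expr0n sqr_ge0.
have [_ /(_ _ e0)//] : app f.
apply: app_eq (appD ap (appZ (-1) an)) => x; rewrite mulN1r.
case: (leP (f x) 0)%R => fx; case: (leP (- f x) 0)%R => fx2; lra.
Qed.

End L2_separable.

Section L2_separable_row.
Variable R : realType.

(** Finite intersections of half-spaces with rational bounds. Indexing by sequences makes the family
    countable, with concatenation as intersection and the empty sequence as the whole space, as
    [L2_separable] requires. *)
Definition lower_box d (s : seq ('I_d * rat)) : set 'rV[R]_d :=
  [set x | all (fun p => x 0 p.1 <= ratr p.2) s].

Lemma measurable_lower_box d (s : seq ('I_d * rat)) : measurable (lower_box s).
Proof.
elim: s => [|[i q] s IH]; first by rewrite (_ : lower_box _ = setT)//; apply/seteqP.
rewrite (_ : lower_box _ = (fun x : 'rV[R]_d => x 0 i) @^-1` [set` `]-oo, ratr q]] `&` lower_box s).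
  apply: measurableI => //; rewrite -[X in measurable X]setTI.
  by apply: measurable_coord.
by apply/seteqP; split => x; rewrite /lower_box/= in_itv/= => /andP.
Qed.

Lemma lower_box_measurableE d :
  @measurable _ 'rV[R]_d = <<s range (@lower_box d) >>.
Proof.
apply/seteqP; split; last first.
  apply: smallest_sub; first exact: sigma_algebra_measurable.
  by move=> _ [s _ <-]; exact: measurable_lower_box.
pose GT := g_sigma_algebraType (range (@lower_box d)).
suff mid : measurable_fun setT (id : GT -> 'rV[R]_d).
  by move=> A mA; have := mid measurableT A mA; rewrite setTI.
apply: measurable_fun_row => i.
apply: (measurability _ (RGenInftyO.measurableE R)) => //.
move=> /= _ [_ [r ->] <-]; rewrite setTI.
(* An open half-line is the countable union of the closed rational half-lines inside it. *)
rewrite (_ : _ @^-1` _ = [set x : GT | exists q : rat, (ratr q < r) /\ @lower_box d [:: (i, q)] x]).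
  apply: measurable_exists_count => q.
  have [qr|qr] := boolP ((ratr q : R) < r); last first.
    by rewrite (_ : (fun _ => _) = set0)//; apply/seteqP; split => // x [].
  rewrite (_ : (fun _ => _) = @lower_box d [:: (i, q)]).
    by apply: sub_sigma_algebra; exists [:: (i, q)].
  by apply/seteqP; split => x // [].
apply/seteqP; split => x /=; rewrite in_itv/=.
  move=> /rat_in_itvoo[q]; rewrite in_itv/= => /andP[xq qr].
  by exists q; split => //; rewrite /lower_box/= ltW.
by move=> [q [qr]]; rewrite /lower_box/= andbT => /le_lt_trans; exact.
Qed.

Lemma L2_separable_row d (D : set 'rV[R]_d) : measurable D -> (vmu R d D < +oo)%E ->
  exists (J : countType) (C : J -> 'rV[R]_d -> R),
    (forall j, measurable_fun setT (C j)) /\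
    forall (f : 'rV[R]_d -> R) (e : R), measurable_fun setT f ->
      (\int[vmu R d]_(x in D) ((f x) ^+ 2)%:E < +oo)%E -> 0 < e ->
      exists j, (\int[vmu R d]_(x in D) ((f x - C j x) ^+ 2)%:E < e%:E)%E.
Proof.
move=> mD fD.
have AI : setI_closed (range (@lower_box d)).
  move=> _ _ [s _ <-] [t _ <-]; exists (s ++ t) => //.
  by apply/seteqP; split => x; rewrite /lower_box/= all_cat => /andP.
have AT : @lower_box d [::] = setT by apply/seteqP.
exists (seq (rat * seq ('I_d * rat))), (@rat_comb _ _ R _ (@lower_box d)); split.
  by move=> j; apply: measurable_rat_comb; exact: lower_box_measurableE.
move=> f e mf ff e0.
exact: (L2_separable mD fD (@lower_box_measurableE d) AI AT mf ff e0).
Qed.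

End L2_separable_row.

(** * Smooth functions and cutoffs *)

Section Ck.
Variables (R : realType) (V : normedModType R) (I : Type) (vs : I -> V).

(** Derivatives are taken only along the directions [vs], so the same lemmas serve the line and rows
    with their coordinate directions. The recursion on the order, unlike the sequences of indices in
    [smooth], suits proofs about products and compositions. Order 0 is continuity, whatever [vs]. *)
Fixpoint Ck (k : nat) (f : V -> R) : Prop :=
  match k with
  | 0 => continuous f
  | k'.+1 => continuous f /\
      forall i, (forall x, derivable f x (vs i)) /\ Ck k' ('D_(vs i) f)
  end.

Lemma CkW k f : Ck k.+1 f -> Ck k f.
Proof.
elim: k f => [f []//|k IH f [cf h]]; split => // i.
by have [df Df] := h i; split => //; exact: IH.
Qed.

Lemma Ck_cst k (c : R) : Ck k (fun=> c).
Proof.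
elim: k c => [|k IH] c; first by move=> x; exact: cvg_cst.
split; first by move=> x; exact: cvg_cst.
move=> i; split; first by move=> x; exact: derivable_cst.
rewrite (_ : 'D_(vs i) _ = fun=> 0)//.
by apply/funext => x; exact: derive_cst.
Qed.

Lemma CkD k f g : Ck k f -> Ck k g -> Ck k (fun x => f x + g x).
Proof.
elim: k f g => [|k IH] f g.
  by move=> cf cg x; apply: cvgD; [exact: cf|exact: cg].
move=> [cf hf] [cg hg]; split.
  by move=> x; apply: cvgD; [exact: cf|exact: cg].
move=> i; have [df Df] := hf i; have [dg Dg] := hg i.
split; first by move=> x; apply: derivableD.
rewrite (_ : 'D_(vs i) _ = fun x => 'D_(vs i) f x + 'D_(vs i) g x); first exact: IH.
by apply/funext => x; exact: deriveD.
Qed.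

Lemma CkM k f g : Ck k f -> Ck k g -> Ck k (fun x => f x * g x).
Proof.
elim: k f g => [|k IH] f g.
  by move=> cf cg x; apply: cvgM; [exact: cf|exact: cg].
move=> Cf Cg; have := CkW Cf; have := CkW Cg => Cg' Cf'.
move: Cf Cg => [cf hf] [cg hg]; split.
  by move=> x; apply: cvgM; [exact: cf|exact: cg].
move=> i; have [df Df] := hf i; have [dg Dg] := hg i.
split; first by move=> x; apply: derivableM.
rewrite (_ : 'D_(vs i) _ = fun x => f x * 'D_(vs i) g x + g x * 'D_(vs i) f x).
  by apply: CkD; exact: IH.
by apply/funext => x; exact: deriveM.
Qed.

Lemma CkZ k c f : Ck k f -> Ck k (fun x => c * f x).
Proof. by move=> Cf; apply: CkM => //; exact: Ck_cst. Qed.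

Lemma CkB k f g : Ck k f -> Ck k g -> Ck k (fun x => f x - g x).
Proof.
move=> Cf Cg; rewrite (_ : (fun x => _) = fun x => f x + (-1) * g x).
  by apply: CkD => //; exact: CkZ.
by apply/funext => x; rewrite mulN1r.
Qed.

Lemma CkV k f : (forall x, f x != 0) -> Ck k f -> Ck k (fun x => (f x)^-1).
Proof.
move=> f0; elim: k => [|k IH].
  by move=> cf x; apply: cvgV => //; exact: cf.
move=> Cf; have := IH (CkW Cf) => Ci; move: Cf => [cf hf]; split.
  by move=> x; apply: cvgV => //; exact: cf.
move=> i; have [df Df] := hf i.
split; first by move=> x; apply: derivableV.
rewrite (_ : 'D_(vs i) _ = fun x => (-1) * ((f x)^-1 * (f x)^-1 * 'D_(vs i) f x)).
  by apply: CkZ; apply: CkM => //; apply: CkM.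
apply/funext => x; rewrite deriveV//= mulN1r scaleNr; congr (- (_ * _)).
by rewrite -exprVn expr2.
Qed.

Lemma Ck_prod k (J : Type) (s : seq J) (f : J -> V -> R) : (forall j, Ck k (f j)) ->
  Ck k (fun x => \prod_(j <- s) f j x).
Proof.
move=> Cf; elim: s => [|j s IH].
  by under eq_fun do rewrite big_nil; exact: Ck_cst.
by under eq_fun do rewrite big_cons; exact: CkM.
Qed.

(** In the Leibniz sum each term has one differentiated factor, bounded by [B], and other factors in
    [0, 1]. *)
Lemma derive_prod_bound (J : Type) (s : seq J) (f : J -> V -> R) (B : R) x v :
  (forall j x, 0 <= f j x <= 1) -> (forall j, derivable (f j) x v) ->
  (forall j, `|'D_v (f j) x| <= B) ->
  derivable (fun x => \prod_(j <- s) f j x) x v /\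
  `|'D_v (fun x => \prod_(j <- s) f j x) x| <= (size s)%:R * B.
Proof.
move=> f01 df Bf; elim: s => [|j s [IHd IH]].
  rewrite (_ : (fun x => _) = cst 1); last by apply/funext => y; rewrite big_nil.
  by split; [exact: derivable_cst|rewrite derive_cst normr0 mul0r].
rewrite (_ : (fun x => _) = f j * (fun x => \prod_(j <- s) f j x)); last first.
  by apply/funext => y; rewrite big_cons.
split; first exact: (derivableM (df j) IHd).
rewrite (deriveM (df j) IHd)/= /GRing.scale/= mulrC -natr1 mulrDl mul1r mulrC.
apply: (le_trans (ler_normD _ _)); apply: lerD.
  rewrite normrM; apply: le_trans IH; rewrite ler_piMl//.
  by have /andP[h0 h1] := f01 j x; rewrite ger0_norm.
rewrite normrM; apply: le_trans (Bf j); rewrite ler_piMl//.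
have /andP[p0 p1] : 0 <= \prod_(j <- s) f j x <= 1.
  apply: (big_ind (fun y => 0 <= y <= 1)) => //; first by rewrite ler01 lexx.
  by move=> a b /andP[a0 a1] /andP[b0 b1]; rewrite mulr_ge0//= mulr_ile1.
by rewrite ger0_norm.
Qed.

End Ck.

Section Ck_comp.
Variables (R : realType) (V : normedModType R) (I : Type) (vs : I -> V).
Notation C1 := (@Ck R R unit (fun=> 1)).

(** As [L] is affine along [v], the difference quotient of [g \o L] along [v] is literally that of
    [g] along [l]. *)
Lemma derive_comp_affine (g : R -> R) (L : V -> R) (v : V) (l : R) (x : V) :
  (forall h x, L (h *: v + x) = h * l + L x) -> derivable g (L x) 1 ->
  derivable (g \o L) x v /\ 'D_v (g \o L) x = l * 'D_1 g (L x).
Proof.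
move=> hL dg.
have E : (fun h : R => h^-1 *: (((g \o L) \o shift x) (h *: v) - (g \o L) x)) =
         (fun h : R => h^-1 *: ((g \o shift (L x)) (h *: l) - g (L x))).
  by apply/funext => h; rewrite /= hL.
have dfg : differentiable g (L x) by exact/derivable1_diffP.
split; first by rewrite /derivable E; exact: diff_derivable.
have -> : 'D_v (g \o L) x = 'D_l g (L x) by rewrite /derive E.
rewrite !deriveE// -[in LHS](mulr1 l) -[l * 1]/(l *: (1 : R)) linearZ.
by [].
Qed.

Lemma Ck_comp_affine k (g : R -> R) (L : V -> R) (l : I -> R) : continuous L ->
  (forall i h x, L (h *: vs i + x) = h * l i + L x) -> C1 k g -> Ck vs k (g \o L).
Proof.
move=> cL hL; elim: k g => [|k IH] g.
  by move=> cg x; apply: continuous_comp; [exact: cL|exact: cg].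
move=> [cg hg]; split; first by move=> x; apply: continuous_comp; [exact: cL|exact: cg].
have [dg Dg] := hg tt.
move=> i; split; first by move=> x; apply: (derive_comp_affine (hL i) (dg (L x))).1.
rewrite (_ : 'D_(vs i) _ = fun x => l i * ('D_1 g \o L) x); first exact/CkZ/IH.
by apply/funext => x; exact: (derive_comp_affine (hL i) (dg (L x))).2.
Qed.

Lemma derive_translate (f : V -> R) (a x v : V) :
  (derivable f (x + a) v -> derivable (fun y => f (y + a)) x v) /\
  'D_v (fun y => f (y + a)) x = 'D_v f (x + a).
Proof.
have E : (fun h : R => h^-1 *: (((fun y => f (y + a)) \o shift x) (h *: v) - f (x + a))) =
         (fun h : R => h^-1 *: ((f \o shift (x + a)) (h *: v) - f (x + a))).
  by apply/funext => h; rewrite /= addrA.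
by split; rewrite /derivable /derive E.
Qed.

Lemma Ck_translate k (f : V -> R) (a : V) : Ck vs k f -> Ck vs k (fun y => f (y + a)).
Proof.
have ct (h : V -> R) : continuous h -> continuous (fun y => h (y + a)).
  move=> ch x; apply: (@continuous_comp _ _ _ (fun y => y + a) h); last exact: ch.
  by apply: cvgD; [exact: cvg_id|exact: cvg_cst].
elim: k f => [|k IH] f; first exact: ct.
move=> [cf hf]; split; first exact: ct.
move=> i; have [df Df] := hf i; split.
  by move=> x; apply: (derive_translate f a x (vs i)).1.
rewrite (_ : 'D_(vs i) _ = fun y => 'D_(vs i) f (y + a)); first exact: (IH _ Df).
by apply/funext => x; exact: (derive_translate f a x (vs i)).2.
Qed.

End Ck_comp.

Section smooth_Ck.
Variable R : realType.
Notation C1 := (@Ck R R unit (fun=> 1)).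
Notation Cr := (@Ck R 'rV[R]__ 'I__ (fun i => delta_mx 0 i)).

Lemma C1_derive1n (q : R -> R) : (forall k s, derivable (derive1n k q) s 1) ->
  forall k, C1 k q.
Proof.
move=> hq k; elim: k q hq => [|k IH] q hq.
  by move=> x; apply: differentiable_continuous; apply/derivable1_diffP; exact: (hq 0%N).
split; first by move=> x; apply: differentiable_continuous; apply/derivable1_diffP; exact: (hq 0%N).
move=> _; split; first exact: (hq 0%N).
have -> : 'D_1 q = derive1 q by apply/funext => x; rewrite derive1E.
by apply: IH => j s; rewrite -derive1Sn; exact: hq.
Qed.

Lemma smoothP d (f : 'rV[R]_d -> R) :
  smooth f <-> forall k, Ck (fun i : 'I_d => delta_mx 0 i : 'rV[R]_d) k f.
Proof.
split.
  move=> sf k; elim: k f sf => [|k IH] f sf; first by have [] := sf [::].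
  have [cf df] := sf [::]; split => // i; split; first exact: df.
  (* [iter_pd] applies the last index of the sequence first, so a first derivative is appended at
     the end. *)
  apply: IH => s; have := sf (rcons s i).
  by rewrite /iter_pd foldr_rcons.
move=> Cf s; suff h k : forall s, Ck (fun i : 'I_d => delta_mx 0 i : 'rV[R]_d) k (iter_pd s f).
  by have [c hd] := h 1%N s; split => // i; exact: (hd i).1.
move=> {}s; elim: s k => [|i s IH] k; first exact: Cf.
by have [_ h] := IH k.+1; exact: (h i).2.
Qed.

End smooth_Ck.

(** * A smooth step function *)

Section flat_function.
Variable R : realType.
Notation C1 := (@Ck R R unit (fun=> 1)).

(** The powers of 1/t in front of the classical flat function make the family stable under
    differentiation, up to linear combinations. *)
Definition flat (j : nat) (t : R) : R := if 0 < t then t ^- j * expR (- t^-1) else 0.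

Lemma flat_ge0 j t : 0 <= flat j t.
Proof.
rewrite /flat; case: ifPn => // t0; rewrite mulr_ge0 ?expR_ge0// invr_ge0 exprn_ge0//.
exact: ltW.
Qed.

(* [expR y >= (y / m) ^ m], with [y = 1 / t] and [m = j + 1]. *)
Lemma flat_le j (t : R) : 0 < t -> flat j t <= j.+1%:R ^+ j.+1 * t.
Proof.
move=> t0; rewrite /flat t0.
have m0 : 0 < j.+1%:R :> R by [].
have h : (t^-1 / j.+1%:R) ^+ j.+1 <= expR t^-1.
  rewrite -[in leRHS](@divfK _ j.+1%:R _ t^-1) ?gt_eqF// expRM_natr.
  rewrite ler_pXn2r ?nnegrE ?expR_ge0 ?divr_ge0 ?invr_ge0 ?(ltW t0)//.
  by apply: (le_trans _ (expR_ge1Dx _)); rewrite lerDr.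
rewrite expRN -(@ler_pM2r _ (expR t^-1 * t ^+ j)) ?mulr_gt0 ?expR_gt0 ?exprn_gt0//.
rewrite (_ : t ^- j * _ * _ = 1); last first.
  rewrite mulrACA; rewrite [X in X * _]mulrC; field; rewrite gt_eqF ?expR_gt0// expf_neq0// gt_eqF//.
apply: (@le_trans _ _ (j.+1%:R ^+ j.+1 * t * ((t^-1 / j.+1%:R) ^+ j.+1 * t ^+ j))).
  rewrite !exprMn exprVn exprS -exprVn.
  rewrite (_ : _ * _ * _ = (j.+1%:R ^+ j.+1 * j.+1%:R^-1 ^+ j.+1) * ((t * t^-1) * (t^-1 * t) ^+ j)).
    rewrite -exprMn divff ?gt_eqF// expr1n mul1r divff ?gt_eqF// mulVf ?gt_eqF// expr1n mulr1//.
  by rewrite !exprMn !exprS; move: (j.+1%:R^-1 : R) (t^-1) => a b; ring.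
rewrite ler_pM2l ?mulr_gt0 ?exprn_gt0//; rewrite ler_pM2r ?exprn_gt0//.
Qed.

Lemma flat0 j : flat j 0 = 0. Proof. by rewrite /flat ltxx. Qed.

Lemma cvg_flat0 j : flat j t @[t --> 0] --> (0 : R).
Proof.
apply/cvgrPdist_lt => e e0; near=> t; rewrite sub0r normrN ger0_norm ?flat_ge0//.
have K0 : 0 < j.+1%:R ^+ j.+1 :> R by rewrite exprn_gt0.
have [t0|t0] := ltP 0 t; last by rewrite /flat (ltNge 0 t) t0.
apply: (le_lt_trans (flat_le j t0)).
rewrite -ltr_pdivlMl// (le_lt_trans (ler_norm _))//.
near: t; apply/nbhs_normP; exists ((j.+1%:R ^+ j.+1)^-1 * e) => /=.
  by rewrite mulr_gt0// invr_gt0.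
by move=> t /=; rewrite sub0r normrN.
Unshelve. all: by end_near. Qed.

(** The derivative is a combination of members of the family, so smoothness follows by induction on
    the order, for all [j] at once. The only delicate point is [t = 0]. *)
Lemma is_derive_flat (j : nat) (t : R) : is_derive t 1 (flat j) (- j%:R * flat j.+1 t + flat j.+2 t).
Proof.
have [t0|] := ltP 0 t.
  have E : {near t, (fun t : R => t ^- j * expR (- t^-1)) =1 flat j}.
    near=> s; have s0 : 0 < s by near: s; exact: lt_nbhsr.
    by rewrite /flat s0.
  apply: (near_eq_is_derive E).
  rewrite /flat t0.
  have tn0 : t != 0 by rewrite gt_eqF.
  have d2 : is_derive t 1 (fun t : R => - t^-1) (t ^- 2).
    apply: is_derive_eq.
      by apply: is_deriveN; apply: is_deriveV.
    by rewrite scaleNr opprK /GRing.scale/= mulr1.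
  have d3 : is_derive t 1 (fun t : R => expR (- t^-1)) (t ^- 2 * expR (- t^-1)).
    apply: (is_derive_eq (is_derive1_comp (f := expR) (g := fun t => - t^-1)
      (is_derive_expR (- t^-1)) d2)).
    by rewrite /GRing.scale/= mulrC.
  elim: j {E} => [|j IH].
    rewrite (_ : (fun x => _) = fun x : R => expR (- x^-1)); last first.
      by apply/funext => x; rewrite expr0 invr1 mul1r.
    by rewrite oppr0 mul0r add0r.
  rewrite (_ : (fun x => _) = (fun x : R => x^-1) * (fun x => x ^- j * expR (- x^-1)));
    last by apply/funext => x; rewrite /= exprS invfM mulrA.
  have d4 : is_derive t 1 (fun t : R => t^-1) (- t ^- 2).
    by apply: is_derive_eq; [exact: is_deriveV|rewrite /GRing.scale/= mulr1].
  apply: (is_derive_eq (is_deriveM d4 IH)).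
  rewrite /GRing.scale/= -!exprVn !exprS expr0 -natr1.
  by move: (t^-1) (expR _) => a b; ring.
rewrite le_eqVlt => /predU1P[->|t0].
  rewrite !flat0 mulr0 addr0.
  have E : (fun h : R => h^-1 *: ((flat j \o shift 0) (h *: 1) - flat j 0)) =
      flat j.+1.
    apply/funext => h; rewrite /= addr0 /GRing.scale/= mulr1 flat0 subr0 /flat.
    case: ifPn => // h0; last by rewrite mulr0.
    by rewrite mulrA exprS invfM.
  have h : (fun h : R => h^-1 *: ((flat j \o shift 0) (h *: 1) - flat j 0)) @ 0^' --> (0 : R).
    by rewrite E; apply: cvg_within_filter; exact: cvg_flat0.
  by apply: DeriveDef; [apply/cvg_ex; exists 0|exact: cvg_lim].
have E : {near t, cst 0 =1 flat j}.
  near=> s; have s0 : s < 0 by near: s; exact: lt_nbhsl.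
  by rewrite /flat ltNge ltW.
apply: (near_eq_is_derive E).
rewrite /flat ltNge (ltW t0)/= mulr0 addr0; exact: is_derive_cst.
Unshelve. all: by end_near. Qed.

Lemma C1_flat k j : C1 k (flat j).
Proof.
have cf i : continuous (flat i).
  move=> x; apply: differentiable_continuous; apply/derivable1_diffP.
  exact: (@ex_derive _ _ _ _ _ _ _ (is_derive_flat i x)).
elim: k j => [|k IH] j; first exact: cf.
split; first exact: cf.
move=> _; split; first by move=> x; exact: (@ex_derive _ _ _ _ _ _ _ (is_derive_flat j x)).
rewrite (_ : 'D_(1 : R) _ = fun t : R => - j%:R * flat j.+1 t + flat j.+2 t).
  by apply: CkD => //; exact: CkZ.
by apply/funext => x; exact: (@derive_val _ _ _ _ _ _ _ (is_derive_flat j x)).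
Qed.

End flat_function.

Section step_function.
Variable R : realType.
Notation C1 := (@Ck R R unit (fun=> 1)).

Lemma flat0_gt0 (t : R) : 0 < t -> 0 < flat 0 t.
Proof. by move=> t0; rewrite /flat t0 expr0 invr1 mul1r expR_gt0. Qed.

Lemma flat_le0 j (t : R) : t <= 0 -> flat j t = 0.
Proof. by move=> t0; rewrite /flat ltNge t0. Qed.

(** The standard smooth transition from 0 on the negative half-line to 1 beyond 1; the denominator
    is positive because [t] or [1 - t] is. *)
Definition step (t : R) : R := flat 0 t / (flat 0 t + flat 0 (1 - t)).

Let den_gt0 (t : R) : 0 < flat 0 t + flat 0 (1 - t).
Proof.
have [t0|t0] := ltP 0 t; first by rewrite ltr_pwDl ?flat0_gt0// flat_ge0.
by rewrite ltr_wpDl ?flat_ge0// flat0_gt0// subr_gt0 (le_lt_trans t0).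
Qed.

Lemma step01 t : 0 <= step t <= 1.
Proof.
rewrite /step divr_ge0 ?flat_ge0 ?(ltW (den_gt0 t))//=.
by rewrite ler_pdivrMr ?den_gt0// mul1r lerDl flat_ge0.
Qed.

Lemma step_le0 t : t <= 0 -> step t = 0.
Proof. by move=> t0; rewrite /step flat_le0// mul0r. Qed.

Lemma step_ge1 t : 1 <= t -> step t = 1.
Proof.
move=> t1; rewrite /step [flat 0 (1 - t)]flat_le0 ?subr_le0// addr0 divff//.
by rewrite gt_eqF// flat0_gt0// (lt_le_trans _ t1).
Qed.

Lemma C1_step k : C1 k step.
Proof.
have c1 : C1 k (flat 0 \o (fun t : R => 1 - t)).
  apply: (@Ck_comp_affine R R unit (fun=> 1) k (flat 0) (fun t => 1 - t) (fun=> -1)).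
  - by move=> x; apply: cvgB; [exact: cvg_cst|exact: cvg_id].
  - by move=> _ h x; rewrite /GRing.scale/=; ring.
  - exact: C1_flat.
apply: CkM; first exact: C1_flat.
apply: CkV; first by move=> x; rewrite gt_eqF// den_gt0.
by apply: CkD => //; exact: C1_flat.
Qed.

(** Extreme value theorem on [0, 1]; outside, [step] is locally constant. *)
Lemma derive_step_bounded : exists2 B : R, 0 <= B & forall t, `|'D_1 step t| <= B.
Proof.
have [cs hs] := C1_step 1; have [ds cd] := hs tt.
have [c _ hc] : exists2 c : R, c \in `[0, 1] & forall t, t \in `[0, 1] ->
    `|'D_1 step t| <= `|'D_1 step c|.
  apply: (@EVT_max R (fun t => `|'D_1 step t|)) => //; apply: continuous_subspaceT => x.
  by apply: (@continuous_comp _ _ _ ('D_(1 : R) step) (@Num.norm _ R)); [exact: cd|exact: norm_continuous].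
exists `|'D_1 step c|; [exact: normr_ge0|move=> t]; have [t0|t0] := ltP t 0.
  have -> : 'D_1 step t = 'D_(1 : R) (cst (0 : R)) t.
    apply: near_eq_derive; near=> s; rewrite step_le0// ltW//.
    by near: s; exact: lt_nbhsl.
  by rewrite derive_cst normr0.
have [t1|t1] := ltP 1 t.
  have -> : 'D_1 step t = 'D_(1 : R) (cst (1 : R)) t.
    apply: near_eq_derive; near=> s; rewrite step_ge1// ltW//.
    by near: s; exact: lt_nbhsr.
  by rewrite derive_cst normr0.
by apply: hc; rewrite in_itv/= t0 t1.
Unshelve. all: by end_near. Qed.

End step_function.

Section dotp_theory.
Variable R : realType.

Lemma dotpDl d (x y z : 'rV[R]_d) : dotp (x + y) z = dotp x z + dotp y z.
Proof. by rewrite /dotp -big_split/=; apply: eq_bigr => i _; rewrite mxE mulrDl. Qed.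

Lemma dotpZl d (a : R) (x z : 'rV[R]_d) : dotp (a *: x) z = a * dotp x z.
Proof. by rewrite /dotp mulr_sumr; apply: eq_bigr => i _; rewrite mxE mulrA. Qed.

Lemma dotpC d (x y : 'rV[R]_d) : dotp x y = dotp y x.
Proof. by apply: eq_bigr => i _; rewrite mulrC. Qed.

Lemma dotpNl d (x z : 'rV[R]_d) : dotp (- x) z = - dotp x z.
Proof. by rewrite -scaleN1r dotpZl mulN1r. Qed.

Lemma dotpBl d (x y z : 'rV[R]_d) : dotp (x - y) z = dotp x z - dotp y z.
Proof. by rewrite dotpDl dotpNl. Qed.

Lemma dotp_ge0 d (x : 'rV[R]_d) : 0 <= dotp x x.
Proof. by apply: sumr_ge0 => i _; rewrite -expr2 sqr_ge0. Qed.

Lemma dotp_delta d (i : 'I_d) (y : 'rV[R]_d) : dotp (delta_mx 0 i) y = y 0 i.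
Proof.
rewrite /dotp (bigD1 i)//= big1 ?addr0 => [|j ji]; first by rewrite mxE !eqxx mul1r.
by rewrite mxE (negbTE ji) andbF mul0r.
Qed.

Lemma enorm_sqr d (x : 'rV[R]_d) : enorm x ^+ 2 = dotp x x.
Proof. by rewrite /enorm sqr_sqrtr// dotp_ge0. Qed.

Lemma Ck_sum (V : normedModType R) (I J : Type) (vs : I -> V) k (s : seq J) (f : J -> V -> R) :
  (forall j, Ck vs k (f j)) -> Ck vs k (fun x => \sum_(j <- s) f j x).
Proof.
move=> Cf; elim: s => [|j s IH].
  by under eq_fun do rewrite big_nil; exact: Ck_cst.
by under eq_fun do rewrite big_cons; exact: CkD.
Qed.

Lemma dotp_continuous d (v : 'rV[R]_d) : continuous (fun x => dotp x v).
Proof.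
(* [Ck] of order 0 is continuity, here with a dummy direction. *)
apply: (@Ck_sum _ unit _ (fun=> 0) 0) => i x.
by apply: continuousM; [exact: coord_continuous|exact: cst_continuous].
Qed.

Lemma measurable_dotp d (v : 'rV[R]_d) : measurable_fun setT (fun x : 'rV[R]_d => dotp x v).
Proof. by apply: continuous_measurable_row; exact: dotp_continuous. Qed.

End dotp_theory.

(** * Orthonormal frames, boxes and cutoffs *)

Section frame.
Variables (R : realType) (d : nat) (f : 'I_d -> 'rV[R]_d).
Hypothesis hf : forall i j, dotp (f i) (f j) = (i == j)%:R.

Definition frame_mx : 'M[R]_d := \matrix_j f j.

Lemma frame_mxT (x : 'rV[R]_d) j : (x *m frame_mx^T) 0 j = dotp x (f j).
Proof. by rewrite mxE; apply: eq_bigr => i _; rewrite !mxE. Qed.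

Lemma frame_mx_orth : frame_mx *m frame_mx^T = 1%:M.
Proof.
apply/matrixP => i j; rewrite mxE [RHS]mxE -(hf i j).
by apply: eq_bigr => k _; rewrite !mxE.
Qed.

Lemma frame_mx_orthT : frame_mx^T *m frame_mx = 1%:M.
Proof. exact: (mulmx1C frame_mx_orth). Qed.

Lemma frame_coord_le1 i j : `|f j 0 i| <= 1.
Proof.
have h : (f j 0 i) ^+ 2 <= 1.
  have <- : dotp (f j) (f j) = 1 by rewrite hf eqxx.
  rewrite /dotp (bigD1 i)//= -expr2 lerDl.
  by apply: sumr_ge0 => k _; rewrite -expr2 sqr_ge0.
by rewrite -(@expr_le1 _ 2)// -normrX ger0_norm ?sqr_ge0.
Qed.

Lemma coord_frame_le (x : 'rV[R]_d) i : `|x 0 i| <= \sum_j `|dotp x (f j)|.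
Proof.
have -> : x = (x *m frame_mx^T) *m frame_mx by rewrite -mulmxA frame_mx_orthT mulmx1.
rewrite [in leLHS]mxE; apply: (le_trans (ler_norm_sum _ _ _)); apply: ler_sum => j _.
rewrite normrM -frame_mxT -[in leRHS]mulmxA frame_mx_orth mulmx1.
by rewrite ler_piMr// mxE frame_coord_le1.
Qed.

(** The strips of the problem are boxes of this kind, by [strip_obox]; the closed boxes below serve
    as compact supports. *)
Definition obox (rho : 'I_d -> R) : set 'rV[R]_d :=
  [set x | forall j, `|dotp x (f j)| < rho j].

Definition cbox (rho : 'I_d -> R) : set 'rV[R]_d :=
  [set x | forall j, `|dotp x (f j)| <= rho j].

Lemma measurable_obox rho : measurable (obox rho).
Proof.
apply: measurable_forall_ord => j.
suff : measurable ((fun x => dotp x (f j)) @^-1` [set s | `|s| < rho j]) by [].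
rewrite -[X in measurable X]setTI; apply: measurable_dotp => //.
by apply: (@measurable_ballR _ _ 0) => x; rewrite subr0.
Qed.

Lemma compact_cbox rho : compact (cbox rho).
Proof.
pose C := \sum_j `|rho j|.
apply: (@subclosed_compact _ _ [set v : 'rV[R]_d | forall i, `[- C, C]%classic (v ord0 i)]).
- rewrite (_ : cbox rho = \bigcap_(j in [set: 'I_d])
      (fun x => dotp x (f j)) @^-1` [set` `[- rho j, rho j]]); last first.
    apply/seteqP; split => x /=; first by move=> h j _; rewrite /= in_itv/= -ler_norml.
    by move=> h j; have := h j I; rewrite /= in_itv/= -ler_norml.
  apply: closed_bigI => j _; apply: closed_comp; last exact: interval_closed.
  by move=> x _; exact: dotp_continuous.
- by apply: (@rV_compact _ _ (fun=> `[- C, C]%classic)) => i; exact: segment_compact.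
- move=> x /= h i; rewrite in_itv/= -ler_norml.
  apply: (le_trans (coord_frame_le x i)); apply: ler_sum => j _.
  by apply: le_trans (h j) _; exact: ler_norm.
Qed.

Lemma vmu_obox_fin rho : (vmu R d (obox rho) < +oo)%E.
Proof.
pose C := 1 + \sum_j `|rho j|.
have C0 : 0 < C by rewrite ltr_pwDl// sumr_ge0.
apply: (@le_lt_trans _ _ (vmu R d (vcube 0 C))); last by rewrite vmu_cube// ltry.
apply: le_measure; rewrite ?inE; [exact: measurable_obox|exact: measurable_vcube|].
move=> x h i; rewrite mxE subr0; apply: (le_lt_trans (coord_frame_le x i)).
rewrite /C (@le_lt_trans _ _ (\sum_j `|rho j|)) ?ltrDr//; apply: ler_sum => j _.
by apply: le_trans (ltW (h j)) _; exact: ler_norm.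
Qed.

(** One factor for each of the 2d faces, the boolean choosing the sign. A factor rises from 0 at its
    face to 1 at depth 1/k inside the box, and avoiding absolute values keeps the product smooth. *)
Definition cutoff (k : R) (rho : 'I_d -> R) (x : 'rV[R]_d) : R :=
  \prod_(p <- enum {: 'I_d * bool})
    step (k * (rho p.1 + (-1) ^+ p.2 * dotp x (f p.1))).

Lemma cutoff01 k rho x : 0 <= cutoff k rho x <= 1.
Proof.
apply: (big_ind (fun y => 0 <= y <= 1)) => //; first by rewrite ler01 lexx.
  by move=> a b /andP[a0 a1] /andP[b0 b1]; rewrite mulr_ge0//= mulr_ile1.
by move=> p _; exact: step01.
Qed.

Lemma cutoff_eq0 k rho x : 0 < k -> ~ cbox rho x -> cutoff k rho x = 0.
Proof.
move=> k0 /existsNP[j /negP]; rewrite -ltNge => h.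
have [b hb] : exists b : bool, rho j + (-1) ^+ b * dotp x (f j) <= 0.
  have [x0|x0] := leP 0 (dotp x (f j)).
    by exists true; rewrite expr1 mulN1r; move: h; rewrite ger0_norm//; lra.
  by exists false; rewrite expr0 mul1r; move: h; rewrite ltr0_norm//; lra.
rewrite /cutoff (bigD1_seq (j, b)) ?mem_enum ?enum_uniq//=.
by rewrite step_le0 ?mul0r// pmulr_rle0.
Qed.

Lemma cutoff_eq1 k rho x : 0 < k -> (forall j, `|dotp x (f j)| <= rho j - k^-1) ->
  cutoff k rho x = 1.
Proof.
move=> k0 h; apply: big1_seq => -[j b] _ /=; apply: step_ge1.
rewrite -ler_pdivrMl// mulr1; have := h j; rewrite ler_norml => /andP[h1 h2].
by case: b; rewrite ?expr1 ?expr0 ?mulN1r ?mul1r; lra.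
Qed.

Lemma Ck_cutoff k rho m : Ck (fun i : 'I_d => delta_mx 0 i : 'rV[R]_d) m (cutoff k rho).
Proof.
apply: Ck_prod => -[j b] /=.
apply: (@Ck_comp_affine R 'rV[R]_d _ _ m (@step R)
  (fun x => k * (rho j + (-1) ^+ b * dotp x (f j))) (fun i => k * ((-1) ^+ b * f j 0 i))).
- apply: (@CkZ R 'rV[R]_d unit (fun=> 0) 0).
  apply: (@CkD R 'rV[R]_d unit (fun=> 0) 0); first exact: Ck_cst.
  by apply: (@CkZ R 'rV[R]_d unit (fun=> 0) 0); exact: dotp_continuous.
- by move=> i h x; rewrite dotpDl dotpZl dotp_delta; ring.
- exact: C1_step.
Qed.

Lemma smooth_cutoff k rho : smooth (cutoff k rho).
Proof. by apply/smoothP => m; exact: Ck_cutoff. Qed.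

(** The bound is independent of the box, which later makes the layer density independent of the
    radius. *)
Lemma pd_cutoff_bound B k rho i x : (forall t : R, `|'D_1 (@step R) t| <= B) -> 0 < k ->
  `|pd i (cutoff k rho) x| <= (d * 2)%:R * (k * B).
Proof.
move=> hB k0.
have step_aff (p : 'I_d * bool) :
    derivable (fun x => step (k * (rho p.1 + (-1) ^+ p.2 * dotp x (f p.1)))) x (delta_mx 0 i) /\
    `|'D_(delta_mx 0 i) (fun x => step (k * (rho p.1 + (-1) ^+ p.2 * dotp x (f p.1)))) x| <= k * B.
  have [_ /(_ tt) [ds _]] := @C1_step R 1.
  have := @derive_comp_affine R 'rV[R]_d (@step R)
    (fun x => k * (rho p.1 + (-1) ^+ p.2 * dotp x (f p.1))) (delta_mx 0 i)
    (k * ((-1) ^+ p.2 * f p.1 0 i)) x _ (ds _).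
  case=> [h y|dd De]; first by rewrite dotpDl dotpZl dotp_delta; ring.
  split; first exact: dd.
  rewrite [X in `|X|]De normrM; apply: ler_pM => //.
  rewrite normrM [X in X * _]gtr0_norm// normrM normrX normrN1 expr1n mul1r.
  by rewrite ler_piMr ?(ltW k0)// frame_coord_le1.
have [_] := @derive_prod_bound R 'rV[R]_d _ (enum {: 'I_d * bool})
  (fun p x => step (k * (rho p.1 + (-1) ^+ p.2 * dotp x (f p.1)))) (k * B) x (delta_mx 0 i)
  (fun p x => step01 _) (fun p => (step_aff p).1) (fun p => (step_aff p).2).
by rewrite -cardE card_prod card_ord card_bool.
Qed.

Lemma test_cutoff k rho rho' : 0 < k -> (forall j, rho j < rho' j) ->
  test_fun (obox rho') (cutoff k rho).
Proof.
move=> k0 h; split; first exact: smooth_cutoff.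
exists (cbox rho); split; first exact: compact_cbox.
split; first by move=> x hx j; exact: le_lt_trans (hx j) (h j).
by move=> x; exact: cutoff_eq0.
Qed.

Lemma cutoff_exhaustion rho : exists eta : nat -> 'rV[R]_d -> R,
  [/\ forall k, test_fun (obox rho) (eta k), forall k x, 0 <= eta k x <= 1 &
      forall x, obox rho x -> eta k x @[k --> \oo] --> (1 : R)].
Proof.
exists (fun k => cutoff k.+1%:R (fun j => rho j - k.+1%:R^-1)); split.
- by move=> k; apply: test_cutoff => // j; rewrite ltrBlDr ltrDl invr_gt0.
- by move=> k x; exact: cutoff01.
move=> x hx; apply: cvg_near_cst.
(* The box was shrunk by 1/(k+1) and the transition takes another 1/(k+1), so the cutoff is 1 at a
   point once both fit between the point and the faces. *)
have : \forall k \near \oo, forall j, `|dotp x (f j)| <= rho j - k.+1%:R^-1 - k.+1%:R^-1.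
  apply: filter_forall => j.
  have e0 : 0 < (rho j - `|dotp x (f j)|) / 2 by rewrite divr_gt0// subr_gt0.
  have /cvgrPdist_lt/(_ _ e0) := @cvg_harmonic R.
  apply: filterS => k; rewrite /harmonic /= sub0r normrN ger0_norm ?invr_ge0//.
  by move: (k.+1%:R^-1 : R) => z; lra.
by apply: filterS => k h; apply: cutoff_eq1.
Qed.

End frame.

Section strip_frame.
Variables (R : realType) (n : nat) (bs : 'I_n -> 'rV[R]_n) (e : 'rV[R]_n.+1).
Variable O : 'rV[R]_n -> 'rV[R]_n.+1.
Hypothesis hbs : forall i j, dotp (bs i) (bs j) = (i == j)%:R.
Hypothesis he : usphere e.
Hypothesis hOlin : forall (a : R) x y, O (a *: x + y) = a *: O x + O y.
Hypothesis hOiso : forall x, enorm (O x) = enorm x.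
Hypothesis hOim : forall y, dotp y e = 0 <-> exists x, O x = y.

Definition strip_frame (j : 'I_n.+1) : 'rV[R]_n.+1 :=
  if unlift ord0 j is Some i then O (bs i) else e.

(** Half-widths: the base cube has side [r], while the strip extends to height [r] on both sides
    along [e]. *)
Definition strip_rho (r : R) (j : 'I_n.+1) : R :=
  if unlift ord0 j is Some _ then r / 2 else r.

Let dotp_ee : dotp e e = 1.
Proof. by rewrite -enorm_sqr he expr1n. Qed.

Let OD x y : O (x + y) = O x + O y.
Proof. by rewrite -[x in LHS]scale1r hOlin scale1r. Qed.

(** Polarization: an additive map preserving norms preserves the scalar product. *)
Let dotp_O x y : dotp (O x) (O y) = dotp x y.
Proof.
have sq z : dotp (O z) (O z) = dotp z z by rewrite -!enorm_sqr hOiso.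
have := sq (x + y); rewrite OD !dotpDl !(dotpC _ (_ + _)) !dotpDl !sq.
by rewrite (dotpC (O y) (O x)) (dotpC y x); lra.
Qed.

Let dotp_Oe x : dotp (O x) e = 0.
Proof. by apply/hOim; exists x. Qed.

Lemma strip_frame_orth i j : dotp (strip_frame i) (strip_frame j) = (i == j)%:R.
Proof.
rewrite /strip_frame; case: (unliftP ord0 i) => [i' ->|->];
  case: (unliftP ord0 j) => [j' ->|->].
- by rewrite dotp_O hbs (inj_eq (lift_inj)).
- by rewrite dotp_Oe eq_sym (negbTE (neq_lift _ _)).
- by rewrite dotpC dotp_Oe (negbTE (neq_lift _ _)).
- by rewrite dotp_ee eqxx.
Qed.

Lemma strip_obox r : strip O e (cube bs 0 r) r = obox strip_frame (strip_rho r).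
Proof.
apply/seteqP; split => x.
  move=> [a [b [ha [/andP[b1 b2] ->]]]] j; rewrite /strip_frame /strip_rho.
  case: (unliftP ord0 j) => [i _|_]; rewrite dotpDl dotpZl.
    rewrite dotp_O (dotpC e) dotp_Oe mulr0 addr0.
    by have := ha i; rewrite subr0.
  by rewrite dotp_Oe dotp_ee mulr1 add0r ltr_norml b1.
move=> h.
(* The component orthogonal to [e] is in the range of [O], which is the whole hyperplane. *)
have [a ha] : exists a, O a = x - dotp x e *: e.
  by apply/hOim; rewrite dotpBl dotpZl dotp_ee mulr1 subrr.
exists a, (dotp x e); split; [|split].
- move=> i; rewrite subr0 -dotp_O ha dotpBl dotpZl (dotpC e) dotp_Oe mulr0 subr0.
  by have := h (lift ord0 i); rewrite /strip_frame /strip_rho liftK.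
- by have := h ord0; rewrite /strip_frame /strip_rho unlift_none ltr_norml.
- by rewrite ha subrK.
Qed.

End strip_frame.

(** * Sobolev functions and their extension by translation *)

Section square_integrable.
Variables (R : realType) (d : nat).
Notation mu := (vmu R d).
Implicit Types (D : set 'rV[R]_d) (f g : 'rV[R]_d -> R).

Definition sqi D f := measurable_fun D f /\ (\int[mu]_(x in D) ((f x) ^+ 2)%:E < +oo)%E.

Lemma L2P D f : measurable D -> L2 D f <-> sqi D f.
Proof.
move=> mD; rewrite /L2 /sqi.
have -> : rmeasurable (fun x => if `[< D x >] then f x else 0) <-> measurable_fun D f.
  rewrite rmeasurableP (measurable_restrictT _ mD).
  by rewrite (_ : (fun x => _) = f \_ D)//; apply/funext => x; rewrite patchE.
split=> -[mf]; rewrite lintE//; try by move=> x _; rewrite lee_fin sqr_ge0.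
- by apply/measurable_EFinP; exact: measurable_funX.
- by apply/measurable_EFinP; exact: measurable_funX.
Qed.

Let msq D f : measurable_fun D f -> measurable_fun D (fun x => ((f x) ^+ 2)%:E).
Proof. by move=> mf; apply/measurable_EFinP; exact: measurable_funX. Qed.

Lemma sqi_le D f (h : 'rV[R]_d -> \bar R) : measurable D -> measurable_fun D f ->
  measurable_fun D h -> (forall x, D x -> ((f x ^+ 2)%:E <= h x)%E) ->
  (\int[mu]_(x in D) h x < +oo)%E -> sqi D f.
Proof.
move=> mD mf mh fh hoo; split => //; apply: le_lt_trans hoo.
apply: ge0_le_integral => //; last exact: msq.
by move=> x _; rewrite lee_fin sqr_ge0.
Qed.

Lemma sqi_int D f : measurable D -> sqi D f ->
  mu.-integrable D (fun x => ((f x) ^+ 2)%:E).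
Proof.
move=> mD [mf ff]; apply/integrableP; split; first exact: msq.
rewrite (eq_integral (fun x => ((f x) ^+ 2)%:E))// => x _.
by rewrite gee0_abs// lee_fin sqr_ge0.
Qed.

Lemma sqiD D f g : measurable D -> sqi D f -> sqi D g -> sqi D (fun x => f x + g x).
Proof.
move=> mD sf sg; have mf := sf.1; have mg := sg.1.
have h := integrableD mD (sqi_int mD sf) (sqi_int mD sg).
have h2 := integrableZl mD 2 h.
apply: (sqi_le mD _ (measurable_int _ h2)); first exact: measurable_funD.
- move=> x _; rewrite /= -EFinD -EFinM lee_fin.
  have := sqr_ge0 (f x - g x); rewrite !sqrrD !sqrrN; lra.
- by have := integrable_lty mD h2.
Qed.

Lemma sqiZ D f (a : R) : measurable D -> sqi D f -> sqi D (fun x => a * f x).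
Proof.
move=> mD sf; have mf := sf.1.
have h2 := integrableZl mD (a ^+ 2) (sqi_int mD sf).
apply: (sqi_le mD _ (measurable_int _ h2)); first exact: measurable_funM.
- by move=> x _; rewrite exprMn EFinM.
- by have := integrable_lty mD h2.
Qed.

Lemma sqiB D f g : measurable D -> sqi D f -> sqi D g -> sqi D (fun x => f x - g x).
Proof.
move=> mD sf sg; rewrite (_ : (fun x => _) = fun x => f x + (-1) * g x).
  by apply: sqiD => //; exact: sqiZ.
by apply/funext => x; rewrite mulN1r.
Qed.

Lemma sqi_bounded D f (B : R) : measurable D -> (mu D < +oo)%E -> measurable_fun D f ->
  (forall x, D x -> `|f x| <= B) -> sqi D f.
Proof.
move=> mD fD mf fB.
apply: (@sqi_le D f (fun=> (B ^+ 2)%:E)) => //.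
  move=> x Dx; rewrite lee_fin -real_normK ?num_real// ler_pXn2r ?nnegrE//.
    exact: fB.
  by apply: le_trans (fB x Dx).
by rewrite integral_cst// lte_mul_pinfty// lee_fin sqr_ge0.
Qed.

Lemma sqiS D E f : measurable D -> measurable E -> D `<=` E -> sqi E f -> sqi D f.
Proof.
move=> mD mE DE sf; have mf := measurable_funS mE DE sf.1.
have := integrableS mE mD DE (sqi_int mE sf) => h.
apply: (sqi_le mD mf (measurable_int _ h)) => //; exact: integrable_lty.
Qed.

Lemma sqiM D f g : measurable D -> sqi D f -> sqi D g ->
  mu.-integrable D (EFin \o (fun x => f x * g x)).
Proof.
move=> mD sf sg; have mf := sf.1; have mg := sg.1.
have h := integrableD mD (sqi_int mD sf) (sqi_int mD sg).
apply: (le_integrable mD _ _ h); first by apply/measurable_EFinP; exact: measurable_funM.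
move=> x _; rewrite -EFinD /= lee_fin [leRHS]ger0_norm ?addr_ge0 ?sqr_ge0//.
rewrite normrM -(real_normK (num_real (f x))) -(real_normK (num_real (g x))).
have := sqr_ge0 (`|f x| - `|g x|); rewrite sqrrB.
have := normr_ge0 (f x); have := normr_ge0 (g x); nra.
Qed.

(** Pointwise, |fg| is at most [dl * g ^+ 2 + dl^-1 * f ^+ 2]. With [g] fixed, choosing [dl] and
    then [a] small makes the pairing small, which is how L2 limits are passed through weak
    formulations. *)
Lemma sqi_young D f g (a b dl : R) : measurable D -> sqi D f -> sqi D g -> 0 < dl ->
  (\int[mu]_(x in D) ((f x) ^+ 2)%:E <= a%:E)%E ->
  (\int[mu]_(x in D) ((g x) ^+ 2)%:E <= b%:E)%E ->
  `|\int[mu]_(x in D) (f x * g x)| <= dl * b + dl^-1 * a.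
Proof.
move=> mD sf sg dl0 fa gb.
have iM := sqiM mD sf sg.
have i1 := sqi_int mD sf; have i2 := sqi_int mD sg.
apply: (le_trans (le_normr_Rintegral mD iM)).
have j1 : mu.-integrable D (EFin \o (fun x => dl * g x ^+ 2)).
  by apply: eq_integrable (integrableZl mD dl i2) => // x _.
have j2 : mu.-integrable D (EFin \o (fun x => dl^-1 * f x ^+ 2)).
  by apply: eq_integrable (integrableZl mD dl^-1 i1) => // x _.
apply: (@le_trans _ _ (\int[mu]_(x in D) (dl * g x ^+ 2 + dl^-1 * f x ^+ 2))).
  apply: le_Rintegral => //.
  - by have := integrable_abse iM.
  - by apply: eq_integrable (integrableD mD j1 j2).
  - move=> x _; rewrite normrM -(real_normK (num_real (f x))) -(real_normK (num_real (g x))).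
    have := normr_ge0 (f x); have := normr_ge0 (g x).
    move: `|f x| `|g x| => u v v0 u0.
    rewrite -(ler_pM2l dl0) mulrDr !mulrA mulfV ?gt_eqF// mul1r.
    by have := sqr_ge0 (dl * v - u); rewrite sqrrB exprMn; nra.
rewrite RintegralD// RintegralZl// RintegralZl//.
apply: lerD.
  apply: ler_wpM2l; first exact: ltW.
  by rewrite -lee_fin /Rintegral fineK// integrable_fin_num.
apply: ler_wpM2l; first by rewrite invr_ge0 ltW.
by rewrite -lee_fin /Rintegral fineK// integrable_fin_num.
Qed.

Lemma LintE D f : measurable D -> mu.-integrable D (EFin \o f) ->
  Lint D f = \int[mu]_(x in D) f x.
Proof.
move=> mD intf; have /measurable_EFinP mf := measurable_int _ intf.
have Ep : lint D (fun x => (Num.max (f x) 0)%:E) = (\int[mu]_(x in D) (EFin \o f)^\+ x)%E.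
  rewrite lintE//; first by apply: eq_integral => x _; rewrite funeposE/= EFin_max.
    by apply/measurable_EFinP; apply: measurable_maxr.
  by move=> x _; rewrite lee_fin le_max lexx orbT.
have En : lint D (fun x => (Num.max (- f x) 0)%:E) = (\int[mu]_(x in D) (EFin \o f)^\- x)%E.
  rewrite lintE//; first by apply: eq_integral => x _; rewrite funenegE/= EFin_max.
    by apply/measurable_EFinP; apply: measurable_maxr => //; exact: measurableT_comp.
  by move=> x _; rewrite lee_fin le_max lexx orbT.
rewrite /Lint Ep En /Rintegral [in RHS]integralE [RHS]fineB//.
  exact: integrable_pos_fin_num.
exact: integrable_neg_fin_num.
Qed.

Lemma integrable_shift f (a : 'rV[R]_d) : mu.-integrable setT (EFin \o f) ->
  mu.-integrable setT (EFin \o (fun x => f (x + a))).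
Proof.
move=> /integrableP[mf fi].
have mfa : measurable_fun setT (EFin \o (fun x => f (x + a))).
  exact: (measurableT_comp mf (measurable_addv a)).
apply/integrableP; split => //.
have := @ge0_integral_vmu_shift R d a (fun x => `|(f x)%:E|)%E.
by move=> -> //; apply: measurableT_comp.
Qed.

Lemma Rintegral_shift f (a : 'rV[R]_d) : mu.-integrable setT (EFin \o f) ->
  \int[mu]_x f (x + a) = \int[mu]_x f x.
Proof.
move=> fi; have mf := measurable_int _ fi.
rewrite /Rintegral integralE [in RHS]integralE; congr (fine (_ - _)%E).
  rewrite -[RHS](@ge0_integral_vmu_shift R d a)//; last exact: measurable_funepos.
  by apply: eq_integral => x _; rewrite !funeposE.
rewrite -[RHS](@ge0_integral_vmu_shift R d a)//; last exact: measurable_funeneg.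
by apply: eq_integral => x _; rewrite !funenegE.
Qed.

End square_integrable.

Section compact_support.
Variables (R : realType) (d : nat).
Notation mu := (vmu R d).
Implicit Types (D : set 'rV[R]_d) (f g : 'rV[R]_d -> R) (K : set 'rV[R]_d).

Lemma continuous_compact_bound K f : compact K -> continuous f ->
  exists2 B : R, 0 <= B & forall x, K x -> `|f x| <= B.
Proof.
move=> cK cf.
have : compact (f @` K) by apply: continuous_compact => //; exact: continuous_subspaceT.
move=> /compact_bounded[M [_ hM]].
exists (`|M| + 1) => [|x Kx]; first by rewrite addr_ge0.
by apply: hM; [rewrite (le_lt_trans (ler_norm M))// ltrDl|exists x].
Qed.

Lemma compact_vcube K : compact K -> exists2 C : R, 0 < C & K `<=` vcube 0 C.
Proof.
move=> cK.
have h (i : 'I_d) : exists B : R, forall x, K x -> `|x 0 i| <= B.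
  have [B _ hB] := @continuous_compact_bound K (fun x => x 0 i) cK (@coord_continuous _ _ _ 0 i).
  by exists B.
have [B hB] := choice h.
exists (1 + \sum_i `|B i|); first by rewrite ltr_pwDl// sumr_ge0.
move=> x Kx i; rewrite mxE subr0; apply: (le_lt_trans (hB i x Kx)).
rewrite (le_lt_trans (ler_norm _))// (@le_lt_trans _ _ (\sum_i `|B i|)) ?ltrDr//.
by rewrite (bigD1 i)//= lerDl sumr_ge0.
Qed.

Lemma compact_support_bound K f : compact K -> continuous f -> (forall x, ~ K x -> f x = 0) ->
  exists2 B : R, 0 <= B & forall x, `|f x| <= B.
Proof.
move=> cK cf f0; have [B B0 hB] := continuous_compact_bound cK cf.
exists B => // x; have [Kx|nKx] := pselect (K x); first exact: hB.
by rewrite f0// normr0.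
Qed.

Lemma sqi_compact_support K f : compact K -> continuous f -> (forall x, ~ K x -> f x = 0) ->
  sqi setT f.
Proof.
move=> cK cf f0; have [B B0 hB] := compact_support_bound cK cf f0.
have [C C0 KC] := compact_vcube cK.
have mf := continuous_measurable_row cf.
apply: (@sqi_le _ _ _ _ (fun x => (B ^+ 2)%:E * (\1_(vcube 0 C) x)%:E)%E) => //.
- by apply: measurable_funeM; apply/measurable_EFinP/measurable_indic; exact: measurable_vcube.
- move=> x _; have [Kx|nKx] := pselect (K x).
    rewrite indicE mem_set ?mule1; last exact: KC.
    by rewrite lee_fin -real_normK ?num_real// ler_pXn2r ?nnegrE.
  by rewrite f0// expr0n/= mule_ge0// lee_fin ?sqr_ge0.
- rewrite ge0_integralZl//; last 2 first.
  + by apply/measurable_EFinP/measurable_indic; exact: measurable_vcube.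
  + by rewrite lee_fin sqr_ge0.
  rewrite -vmuE; last exact: measurable_vcube.
  by rewrite vmu_cube// -EFinM ltry.
Qed.

Lemma integrable_compact_support K f : compact K -> continuous f ->
  (forall x, ~ K x -> f x = 0) -> mu.-integrable setT (EFin \o f).
Proof.
move=> cK cf f0; have [B B0 hB] := compact_support_bound cK cf f0.
have [C C0 KC] := compact_vcube cK.
have mC : measurable (vcube (0 : 'rV[R]_d) C) by exact: measurable_vcube.
have mf := continuous_measurable_row cf.
have iC : mu.-integrable setT (fun x => B%:E * (\1_(vcube 0 C) x)%:E)%E.
  apply: integrableZl => //; apply/integrableP; split.
    by apply/measurable_EFinP/measurable_indic.
  rewrite (eq_integral (fun x => (\1_(vcube 0 C) x)%:E)) -?vmuE//.
    by rewrite vmu_cube// ltry.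
  by move=> x _; rewrite gee0_abs// lee_fin.
apply: (le_integrable measurableT _ _ iC); first exact/measurable_EFinP.
move=> x _; have [Kx|nKx] := pselect (K x).
  rewrite indicE mem_set ?mule1; last exact: KC.
  by rewrite /= lee_fin [leRHS]ger0_norm.
by rewrite [(EFin \o f) x]/= f0// abse0 abse_ge0.
Qed.

Lemma pd_support K f (i : 'I_d) x : compact K -> (forall x, ~ K x -> f x = 0) -> ~ K x ->
  pd i f x = 0.
Proof.
move=> cK f0 nKx; rewrite /pd.
have -> : 'D_(delta_mx 0 i) f x = 'D_(delta_mx 0 i) (cst (0 : R)) x.
  apply: near_eq_derive.
  have oK : open (~` K) by apply: closed_openC; apply: compact_closed => //; exact: norm_hausdorff.
  have := open_nbhs_nbhs (conj oK nKx).
  by apply: filterS => y /f0.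
exact: derive_cst.
Qed.

(* Difference quotients integrate to zero by translation invariance, and they
   converge boundedly to the partial derivative. *)
Lemma Rintegral_pd K f (i : 'I_d) : compact K -> continuous f ->
  (forall x, derivable f x (delta_mx 0 i)) -> continuous (pd i f) ->
  (forall x, ~ K x -> f x = 0) -> \int[mu]_x pd i f x = 0.
Proof.
move=> cK cf df cpf f0; pose v : 'rV[R]_d := delta_mx 0 i.
have [B B0 hB] := compact_support_bound cK cpf (fun x => @pd_support K f i x cK f0).
have [C C0 KC] := compact_vcube cK.
have C10 : 0 < C + 1 by rewrite addr_gt0.
have mC : measurable (vcube (0 : 'rV[R]_d) (C + 1)) by exact: measurable_vcube.
have fi := integrable_compact_support cK cf f0.
pose G k x := k.+1%:R * (f (x + k.+1%:R^-1 *: v) - f x).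
have iG k : mu.-integrable setT (EFin \o (fun x => f (x + k.+1%:R^-1 *: v) - f x)).
  by apply: eq_integrable (integrableB measurableT (integrable_shift (k.+1%:R^-1 *: v) fi) fi).
have G0 k : \int[mu]_x G k x = 0.
  rewrite RintegralZl// RintegralB//; last exact: integrable_shift.
  by rewrite Rintegral_shift// subrr mulr0.
have line x (s : R) : is_derive s 1 (fun s : R => f (s *: v + x)) (pd i f (s *: v + x)).
  have E : (fun h : R => h^-1 *: (((fun s : R => f (s *: v + x)) \o shift s) (h *: 1) - f (s *: v + x))) =
      (fun h : R => h^-1 *: ((f \o shift (s *: v + x)) (h *: v) - f (s *: v + x))).
    by apply/funext => h; rewrite /= scalerDl addrA /GRing.scale/= mulr1.
  by apply: DeriveDef; [rewrite /derivable E; exact: df|rewrite /pd /derive E].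
(* By the mean value theorem the quotient is a value of the partial derivative. *)
have GB k x : `|G k x| <= B.
  have k0 : 0 <= k.+1%:R^-1 :> R by rewrite invr_ge0.
  have [|c _] := @MVT_segment R (fun s : R => f (s *: v + x)) (fun s => pd i f (s *: v + x))
    0 k.+1%:R^-1 k0 (fun s _ => line x s).
    apply: continuous_subspaceT => s; apply: differentiable_continuous.
    by apply/derivable1_diffP; exact: (@ex_derive _ _ _ _ _ _ _ (line x s)).
  rewrite scale0r add0r subr0 /G [x + _]addrC => ->.
  by rewrite mulrC divfK.
(* The increment 1/(k+1) is at most 1, so enlarging the cube by 1 contains the supports of all
   quotients. *)
have Gout k x : ~ vcube 0 (C + 1) x -> G k x = 0.
  move=> nx; rewrite /G (f0 x); last first.
    move=> /KC h; apply: nx => j; apply: (lt_trans (h j)); by rewrite ltrDl.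
  rewrite (f0 (x + _)) ?subrr ?mulr0//.
  move=> /KC h; apply: nx => j; have := h j; rewrite !mxE !subr0 eqxx /= => {}h.
  have -> : x 0 j = (x 0 j + k.+1%:R^-1 * (j == i)%:R) - k.+1%:R^-1 * (j == i)%:R.
    by rewrite addrK.
  apply: (le_lt_trans (ler_normB _ _)); apply: ltr_leD => //.
  rewrite normrM ger0_norm ?invr_ge0//.
  case: (j == i); rewrite ?normr1 ?normr0 ?mulr1 ?mulr0//.
  by rewrite invf_le1// ler1n.
have mpf := continuous_measurable_row cpf.
have iC : mu.-integrable setT (fun x => B%:E * (\1_(vcube 0 (C + 1)) x)%:E)%E.
  apply: integrableZl => //; apply/integrableP; split.
    by apply/measurable_EFinP/measurable_indic.
  rewrite (eq_integral (fun x => (\1_(vcube 0 (C + 1)) x)%:E)) -?vmuE//.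
    by rewrite vmu_cube// ltry.
  by move=> x _; rewrite gee0_abs// lee_fin.
have mG k : measurable_fun setT (fun x => (G k x)%:E).
  apply/measurable_EFinP; apply: measurable_funM => //.
  by have /measurable_EFinP := measurable_int _ (iG k).
have [] := @dominated_convergence _ _ _ mu setT measurableT (fun k x => (G k x)%:E)
  (fun x => (pd i f x)%:E) _ mG _ _ iC.
- exact/measurable_EFinP.
- apply: aeW => x _; apply/cvg_EFin; first by near=> k.
  have := df x => /cvg_ex[l hl].
  have lE : pd i f x = l by apply: (cvg_lim _ hl).
  rewrite lE.
  have hk : k.+1%:R^-1 @[k --> \oo] --> (0 : R)^'.
    move=> A [e /= e0 hA]; have /cvgrPdist_lt/(_ _ e0) := @cvg_harmonic R.
    by apply: filterS => k /= h; apply: hA => //=; rewrite invr_eq0.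
  apply: cvg_trans (cvg_comp _ _ hk hl).
  apply: near_eq_cvg; apply: nearW => k /=.
  by rewrite invrK /G /GRing.scale/= [x + _]addrC.
- apply: aeW => x k _; have [hx|hx] := pselect (vcube 0 (C + 1) x).
    by rewrite indicE mem_set// mule1 lee_fin.
  by rewrite Gout// abse0 mule_ge0// lee_fin.
move=> ipf _ h; rewrite /Rintegral.
have : (\int[mu]_x (pd i f x)%:E)%E = 0%E.
  apply/esym; apply: (@cvg_unique _ _ _ _ _ _ _ h) => //.
  rewrite (_ : [sequence _]_k = cst 0%E); first exact: cvg_cst.
  apply/funext => k /=; rewrite -[LHS]fineK; first by congr EFin; exact: G0.
  apply: integrable_fin_num => //.
  by apply: eq_integrable (integrableZl measurableT k.+1%:R (iG k)).
by move=> ->.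
Unshelve. all: by end_near. Qed.

Lemma Rintegral_by_parts K f phi (i : 'I_d) : compact K ->
  continuous f -> (forall x, derivable f x (delta_mx 0 i)) -> continuous (pd i f) ->
  continuous phi -> (forall x, derivable phi x (delta_mx 0 i)) -> continuous (pd i phi) ->
  (forall x, ~ K x -> phi x = 0) ->
  \int[mu]_x (f x * pd i phi x) = - \int[mu]_x (pd i f x * phi x).
Proof.
move=> cK cf df cpf cp dp cpp p0.
have pp0 x : ~ K x -> pd i phi x = 0 by exact: pd_support.
have E : pd i (fun x => f x * phi x) = fun x => f x * pd i phi x + pd i f x * phi x.
  by apply/funext => x; rewrite /pd [LHS]deriveM// /GRing.scale/= [phi x * _]mulrC.
have c1 : continuous (fun x => f x * pd i phi x) by move=> x; apply: continuousM; [exact: cf|exact: cpp].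
have c2 : continuous (fun x => pd i f x * phi x) by move=> x; apply: continuousM; [exact: cpf|exact: cp].
have := @Rintegral_pd K (fun x => f x * phi x) i cK _ _ _ _.
rewrite E RintegralD//; last 2 first.
- by apply: (integrable_compact_support cK c1) => x /pp0 ->; rewrite mulr0.
- by apply: (integrable_compact_support cK c2) => x /p0 ->; rewrite mulr0.
move=> h; apply/eqP; rewrite -addr_eq0; apply/eqP; apply: h.
- by move=> x; apply: continuousM; [exact: cf|exact: cp].
- by move=> x; apply: derivableM.
- exact: (@CkD R 'rV[R]_d unit (fun=> 0) 0 _ _ c1 c2).
- by move=> x /p0 ->; rewrite mulr0.
Qed.

End compact_support.

Section test_functions.
Variables (R : realType) (d : nat).
Notation mu := (vmu R d).
Implicit Types (D U : set 'rV[R]_d) (f g phi : 'rV[R]_d -> R) (K : set 'rV[R]_d).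

Lemma smooth_C1 f (i : 'I_d) : smooth f ->
  [/\ continuous f, (forall x, derivable f x (delta_mx 0 i)) & continuous (pd i f)].
Proof.
move=> sf; have [cf df] := sf [::]; have [cpf _] := sf [:: i].
by split => //; exact: df.
Qed.

Lemma smooth_continuous f : smooth f -> continuous f.
Proof. by move=> sf; have [] := sf [::]. Qed.

Lemma smoothD f g : smooth f -> smooth g -> smooth (fun x => f x + g x).
Proof. by move=> /smoothP sf /smoothP sg; apply/smoothP => k; exact: CkD. Qed.

Lemma smoothB f g : smooth f -> smooth g -> smooth (fun x => f x - g x).
Proof. by move=> /smoothP sf /smoothP sg; apply/smoothP => k; exact: CkB. Qed.

Lemma smoothM f g : smooth f -> smooth g -> smooth (fun x => f x * g x).
Proof. by move=> /smoothP sf /smoothP sg; apply/smoothP => k; exact: CkM. Qed.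

Lemma smooth_translate f (a : 'rV[R]_d) : smooth f -> smooth (fun x => f (x + a)).
Proof. by move=> /smoothP sf; apply/smoothP => k; exact: Ck_translate. Qed.

Lemma pd_translate f (a x : 'rV[R]_d) i : pd i (fun y => f (y + a)) x = pd i f (x + a).
Proof. exact: (derive_translate f a x (delta_mx 0 i)).2. Qed.

Lemma pdD f g i x : smooth f -> smooth g -> pd i (fun x => f x + g x) x = pd i f x + pd i g x.
Proof.
by move=> /(smooth_C1 i)[_ df _] /(smooth_C1 i)[_ dg _]; rewrite /pd [LHS]deriveD.
Qed.

Lemma pdB f g i x : smooth f -> smooth g -> pd i (fun x => f x - g x) x = pd i f x - pd i g x.
Proof.
by move=> /(smooth_C1 i)[_ df _] /(smooth_C1 i)[_ dg _]; rewrite /pd [LHS]deriveB.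
Qed.

Lemma pdM f g i x : smooth f -> smooth g ->
  pd i (fun x => f x * g x) x = f x * pd i g x + pd i f x * g x.
Proof.
move=> /(smooth_C1 i)[_ df _] /(smooth_C1 i)[_ dg _].
by rewrite /pd [LHS]deriveM// /GRing.scale/= [g x * _]mulrC.
Qed.

Lemma test_fun_mulr U f phi : smooth f -> test_fun U phi -> test_fun U (fun x => f x * phi x).
Proof.
move=> sf [sp [K [cK [KU p0]]]]; split; first exact: smoothM.
by exists K; split => //; split => // x /p0 ->; rewrite mulr0.
Qed.

Lemma test_funW U phi : test_fun U phi -> test_fun setT phi.
Proof. by move=> [sp [K [cK [KU p0]]]]; split => //; exists K. Qed.

Lemma addv_continuous (V : normedModType R) (a : V) : continuous (fun x : V => x + a).
Proof. by move=> x; apply: cvgD; [exact: cvg_id|exact: cvg_cst]. Qed.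

Lemma compact_translate K (a : 'rV[R]_d) : compact K -> compact [set x | K (x - a)].
Proof.
move=> cK; rewrite (_ : [set x | _] = (fun x => x + a) @` K); last first.
  apply/seteqP; split => x /=; first by move=> h; exists (x - a) => //; rewrite subrK.
  by move=> [y Ky <-]; rewrite addrK.
apply: continuous_compact => //; apply: continuous_subspaceT => x.
exact: addv_continuous.
Qed.

Lemma test_fun_translate U phi (a : 'rV[R]_d) : test_fun U phi ->
  test_fun [set x | U (x - a)] (fun x => phi (x - a)).
Proof.
move=> [sp [K [cK [KU p0]]]]; split; first exact: smooth_translate.
exists [set x | K (x - a)]; split; first exact: compact_translate.
by split => [x /KU//|x /p0].
Qed.

Lemma test_fun_sqi U phi : test_fun U phi -> sqi setT phi.
Proof.
move=> [sp [K [cK [_ p0]]]]; apply: sqi_compact_support cK _ p0.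
exact: smooth_continuous.
Qed.

Lemma test_fun_pd_sqi U phi i : test_fun U phi -> sqi setT (pd i phi).
Proof.
move=> [sp [K [cK [_ p0]]]]; have [cp dp cpp] := smooth_C1 i sp.
by apply: (sqi_compact_support cK cpp) => x; exact: pd_support.
Qed.

Lemma test_fun_sqiS D U phi : measurable D -> test_fun U phi -> sqi D phi.
Proof.
move=> mD tp; apply: (sqiS mD measurableT (@subsetT _ _)); exact: test_fun_sqi tp.
Qed.

Lemma test_fun_pd_sqiS D U phi i : measurable D -> test_fun U phi -> sqi D (pd i phi).
Proof.
move=> mD tp; apply: (sqiS mD measurableT (@subsetT _ _)); exact: test_fun_pd_sqi tp.
Qed.

Lemma smooth_sqi D K f : measurable D -> (mu D < +oo)%E -> compact K -> D `<=` K ->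
  continuous f -> sqi D f.
Proof.
move=> mD fD cK DK cf; have [B B0 hB] := continuous_compact_bound cK cf.
apply: (sqi_bounded mD fD (B := B)).
  by apply: measurable_funTS; exact: continuous_measurable_row.
by move=> x /DK; exact: hB.
Qed.

Lemma Rintegral_outside0 D f : (forall x, ~ D x -> f x = 0) ->
  \int[mu]_(x in D) f x = \int[mu]_x f x.
Proof.
move=> f0; rewrite Rintegral_mkcond; congr (Rintegral _ _ _); apply/funext => x.
by rewrite patchE; case: ifPn => // /negP; rewrite inE => /f0 ->.
Qed.

Lemma test_fun_by_parts U f phi i : smooth f -> test_fun U phi ->
  \int[mu]_x (f x * pd i phi x) = - \int[mu]_x (pd i f x * phi x).
Proof.
move=> sf [sp [K [cK [_ p0]]]].
have [cf df cpf] := smooth_C1 i sf; have [cp dp cpp] := smooth_C1 i sp.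
exact: (Rintegral_by_parts cK).
Qed.

Lemma Rintegral_sqiBM D f g h : measurable D -> sqi D f -> sqi D g -> sqi D h ->
  \int[mu]_(x in D) ((f x - g x) * h x) =
  \int[mu]_(x in D) (f x * h x) - \int[mu]_(x in D) (g x * h x).
Proof.
move=> mD sf sg sh; rewrite -(RintegralB mD (sqiM mD sf sh) (sqiM mD sg sh)).
by apply: eq_Rintegral => x _; rewrite mulrBl.
Qed.

Lemma Rintegral_sqiDM D f g h : measurable D -> sqi D f -> sqi D g -> sqi D h ->
  \int[mu]_(x in D) ((f x + g x) * h x) =
  \int[mu]_(x in D) (f x * h x) + \int[mu]_(x in D) (g x * h x).
Proof.
move=> mD sf sg sh; rewrite -(RintegralD mD (sqiM mD sf sh) (sqiM mD sg sh)).
by apply: eq_Rintegral => x _; rewrite mulrDl.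
Qed.

Lemma weak_gradP D u G : measurable D -> sqi D u -> (forall i, sqi D (G i)) ->
  weak_grad D u G <-> forall i phi, test_fun D phi ->
    \int[mu]_(x in D) (u x * pd i phi x) = - \int[mu]_(x in D) (G i x * phi x).
Proof.
move=> mD su sG.
have iu i phi : test_fun D phi -> mu.-integrable D (EFin \o (fun x => u x * pd i phi x)).
  by move=> tp; apply: sqiM => //; exact: (test_fun_pd_sqiS _ mD tp).
have iG i phi : test_fun D phi -> mu.-integrable D (EFin \o (fun x => G i x * phi x)).
  by move=> tp; apply: sqiM => //; exact: (test_fun_sqiS mD tp).
split=> h i phi tp; have := h i phi tp.
  by rewrite !LintE//; [exact: iG|exact: iu].
by rewrite !LintE//; [exact: iG|exact: iu].
Qed.

End test_functions.

(** * Zero trace and extension by zero *)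

Section zero_trace.
Variables (R : realType) (d : nat).
Notation mu := (vmu R d).
Variables (D K0 : set 'rV[R]_d).
Hypotheses (mD : measurable D) (fD : (mu D < +oo)%E) (cK0 : compact K0) (DK0 : D `<=` K0).

(** The test functions may cross the boundary of [D]. Integration by parts without a boundary term
    expresses the zero trace in exactly the form that extension by zero needs. *)
Definition weak_grad_ext (v : 'rV[R]_d -> R) (G : 'I_d -> 'rV[R]_d -> R) :=
  forall i phi, test_fun setT phi ->
    \int[mu]_(x in D) (v x * pd i phi x) = - \int[mu]_(x in D) (G i x * phi x).

Lemma H10_approx (v : 'rV[R]_d -> R) (G : 'I_d -> 'rV[R]_d -> R)
    (psi : nat -> 'rV[R]_d -> R) :
  sqi D v -> (forall i, sqi D (G i)) -> (forall k, test_fun D (psi k)) ->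
  ((fun k => (lint D (fun x => ((v x - psi k x) ^+ 2)%:E) +
          \sum_(i < d) lint D (fun x => ((G i x - pd i (psi k) x) ^+ 2)%:E))%E)
        @ \oo --> 0%E) ->
  forall e : R, 0 < e -> exists k,
    (\int[mu]_(x in D) ((v x - psi k x) ^+ 2)%:E <= e%:E)%E /\
    forall i, (\int[mu]_(x in D) ((G i x - pd i (psi k) x) ^+ 2)%:E <= e%:E)%E.
Proof.
move=> sv sG tpsi h e e0.
move: h => /fine_cvgP[[N1 _ h1] /cvgrPdist_lt/(_ _ e0)[N2 _ h2]].
pose k := maxn N1 N2; exists k.
have := h2 k (leq_maxr _ _); have := h1 k (leq_maxl _ _) => /=.
have sqD (f g : 'rV[R]_d -> R) : sqi D f -> sqi setT g ->
    lint D (fun x => ((f x - g x) ^+ 2)%:E) = (\int[mu]_(x in D) ((f x - g x) ^+ 2)%:E)%E.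
  move=> sf sg; apply: lintE => //; last by move=> x _; rewrite lee_fin sqr_ge0.
  apply/measurable_EFinP/measurable_funX; apply: measurable_funB; first exact: sf.1.
  by apply: measurable_funTS; exact: sg.1.
have i0 (f g : 'rV[R]_d -> R) : (0 <= \int[mu]_(x in D) ((f x - g x) ^+ 2)%:E)%E.
  by apply: integral_ge0 => x _; rewrite lee_fin sqr_ge0.
rewrite sqD//; last exact: test_fun_sqi (tpsi k).
rewrite (eq_bigr (fun i => \int[mu]_(x in D) ((G i x - pd i (psi k) x) ^+ 2)%:E)%E); last first.
  by move=> i _; rewrite sqD//; exact: test_fun_pd_sqi (tpsi k).
set S := (_ + _)%E => fS.
have S0 : (0 <= S)%E by apply: adde_ge0 => //; apply: sume_ge0.
rewrite sub0r normrN ger0_norm ?fine_ge0// => Se.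
have {}Se : (S <= e%:E)%E by rewrite -(fineK fS) lee_fin ltW.
split; first by apply: le_trans Se; rewrite leeDl// sume_ge0.
move=> i; apply: le_trans Se; rewrite (@le_trans _ _ (\sum_(i < d) \int[mu]_(x in D) ((G i x - pd i (psi k) x) ^+ 2)%:E)%E)//.
  by rewrite (bigD1 i)//= leeDl// sume_ge0.
by rewrite leeDr.
Qed.

(** For the approximants [psi k], compactly supported in [D], the identity is integration by parts
    on the whole space; [sqi_young] passes it to the limit. *)
Lemma H10_weak_grad_ext (v : 'rV[R]_d -> R) (G : 'I_d -> 'rV[R]_d -> R)
    (psi : nat -> 'rV[R]_d -> R) :
  sqi D v -> (forall i, sqi D (G i)) -> (forall k, test_fun D (psi k)) ->
  ((fun k => (lint D (fun x => ((v x - psi k x) ^+ 2)%:E) +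
          \sum_(i < d) lint D (fun x => ((G i x - pd i (psi k) x) ^+ 2)%:E))%E)
        @ \oo --> 0%E) ->
  weak_grad_ext v G.
Proof.
move=> sv sG tpsi h i phi tp.
have sp : sqi D phi by exact: (test_fun_sqiS mD tp).
have spp : sqi D (pd i phi) by exact: (test_fun_pd_sqiS _ mD tp).
pose b : R := fine (\int[mu]_(x in D) ((phi x) ^+ 2)%:E)%E + fine (\int[mu]_(x in D) ((pd i phi x) ^+ 2)%:E)%E.
have q0 (f : 'rV[R]_d -> R) : 0 <= fine (\int[mu]_(x in D) ((f x) ^+ 2)%:E)%E.
  by apply: fine_ge0; apply: integral_ge0 => x _; rewrite lee_fin sqr_ge0.
have b0 : 0 <= b by rewrite addr_ge0.
have bp : (\int[mu]_(x in D) ((phi x) ^+ 2)%:E <= b%:E)%E.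
  by rewrite -[leLHS]fineK ?lee_fin ?lerDl// integrable_fin_num//; exact: sqi_int.
have bpp : (\int[mu]_(x in D) ((pd i phi x) ^+ 2)%:E <= b%:E)%E.
  by rewrite -[leLHS]fineK ?lee_fin ?lerDr// integrable_fin_num//; exact: sqi_int.
apply/eqP; rewrite -addr_eq0 -normr_le0; apply/ler_addgt0Pl => e e0; rewrite addr0.
(* With squared L2 errors at most [dl * (e / 4)], each of the two pairings is at most
   [dl * b + e / 4 <= e / 2]. *)
pose dl := e / (4 * (b + 1)).
have b1 : 0 < b + 1 by rewrite ltr_wpDl.
have dl0 : 0 < dl by rewrite divr_gt0// mulr_gt0.
have [k [hk1 hk2]] := H10_approx sv sG tpsi h (mulr_gt0 dl0 (divr_gt0 e0 (ltr0n R 4))).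
have sps : sqi D (psi k) by exact: (test_fun_sqiS mD (tpsi k)).
have spps : sqi D (pd i (psi k)).
  by exact: (test_fun_pd_sqiS _ mD (tpsi k)).
have [spk [Kk [cKk [KkD pk0]]]] := tpsi k.
have ibp : \int[mu]_(x in D) (psi k x * pd i phi x) + \int[mu]_(x in D) (pd i (psi k) x * phi x) = 0.
  have o1 : \int[mu]_(x in D) (psi k x * pd i phi x) = \int[mu]_x (psi k x * pd i phi x).
    by apply: Rintegral_outside0 => x nDx; rewrite pk0 ?mul0r// => /KkD.
  have o2 : \int[mu]_(x in D) (pd i (psi k) x * phi x) = \int[mu]_x (pd i (psi k) x * phi x).
    by apply: Rintegral_outside0 => x nDx; rewrite (@pd_support _ _ Kk)// ?mul0r// => /KkD.
  by rewrite o1 o2 (test_fun_by_parts i spk tp) addrC subrr.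
have s1 := sqiB mD sv sps; have s2 := sqiB mD (sG i) spps.
have -> : \int[mu]_(x in D) (v x * pd i phi x) + \int[mu]_(x in D) (G i x * phi x) =
  \int[mu]_(x in D) ((v x - psi k x) * pd i phi x) +
  \int[mu]_(x in D) ((G i x - pd i (psi k) x) * phi x).
  rewrite (Rintegral_sqiBM mD sv sps spp) (Rintegral_sqiBM mD (sG i) spps sp).
  by rewrite addrACA -opprD ibp subr0.
apply: (le_trans (ler_normD _ _)).
have y1 := sqi_young mD s1 spp dl0 hk1 bpp.
have y2 := sqi_young mD s2 sp dl0 (hk2 i) bp.
apply: (le_trans (lerD y1 y2)).
rewrite !mulKf ?gt_eqF//.
have : dl * b <= e / 4.
  rewrite /dl mulrAC ler_pdivrMr ?mulr_gt0//.
  have -> : e / 4 * (4 * (b + 1)) = e * (b + 1) by field.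
  by rewrite ler_pM2l// lerDl.
lra.
Qed.

(* The gradient of [v = u - Q] produced by [H10] may differ from [G - DQ] on a
   null set; both act alike on test functions of [D], hence, by cutting off, on
   all smooth compactly supported functions. *)
Lemma H1_H10_weak_grad_ext (eta : nat -> 'rV[R]_d -> R) (u Q : 'rV[R]_d -> R)
    (G Gv : 'I_d -> 'rV[R]_d -> R) :
  (forall k, test_fun D (eta k)) -> (forall k x, 0 <= eta k x <= 1) ->
  (forall x, D x -> eta k x @[k --> \oo] --> (1 : R)) ->
  smooth Q -> H1 D u G -> H1 D (fun x => u x - Q x) Gv ->
  weak_grad_ext (fun x => u x - Q x) Gv ->
  weak_grad_ext (fun x => u x - Q x) (fun i x => G i x - pd i Q x).
Proof.
move=> teta eta01 etacvg sQ [/L2P-/(_ mD) su [/(_ _)/L2P-/(_ _ mD) sG wu]].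
move=> [/L2P-/(_ mD) sv [/(_ _)/L2P-/(_ _ mD) sGv wv]] hext i phi tp.
have sQ1 : sqi D Q by apply: (smooth_sqi mD fD cK0 DK0); exact: smooth_continuous.
have sQ2 j : sqi D (pd j Q) by apply: (smooth_sqi mD fD cK0 DK0); have [] := smooth_C1 j sQ.
have sp : sqi D phi by exact: (test_fun_sqiS mD tp).
have spp j : sqi D (pd j phi) by exact: (test_fun_pd_sqiS _ mD tp).
have sE := sqiB mD (sqiB mD (sG i) (sQ2 i)) (sGv i).
have E0 theta : test_fun D theta ->
    \int[mu]_(x in D) ((G i x - pd i Q x - Gv i x) * theta x) = 0.
  move=> tt.
  have st : sqi D theta by exact: (test_fun_sqiS mD tt).
  have stt : sqi D (pd i theta) by exact: (test_fun_pd_sqiS _ mD tt).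
  have e1 := (weak_gradP mD su sG).1 wu i theta tt.
  have e2 := (weak_gradP mD sv sGv).1 wv i theta tt.
  have e3 : \int[mu]_(x in D) (Q x * pd i theta x) = - \int[mu]_(x in D) (pd i Q x * theta x).
    have [spt [Kt [cKt [KtD t0]]]] := tt.
    have o1 : \int[mu]_(x in D) (Q x * pd i theta x) = \int[mu]_x (Q x * pd i theta x).
      by apply: Rintegral_outside0 => x nDx; rewrite (@pd_support _ _ Kt)// ?mulr0// => /KtD.
    have o2 : \int[mu]_(x in D) (pd i Q x * theta x) = \int[mu]_x (pd i Q x * theta x).
      by apply: Rintegral_outside0 => x nDx; rewrite t0 ?mulr0// => /KtD.
    by rewrite o1 o2; exact: test_fun_by_parts tt.
  have e4 : \int[mu]_(x in D) ((u x - Q x) * pd i theta x) =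
      \int[mu]_(x in D) (u x * pd i theta x) - \int[mu]_(x in D) (Q x * pd i theta x).
    exact: (Rintegral_sqiBM mD su sQ1 stt).
  rewrite (Rintegral_sqiBM mD (sqiB mD (sG i) (sQ2 i)) (sGv i) st).
  rewrite (Rintegral_sqiBM mD (sG i) (sQ2 i) st).
  by move: e4; rewrite e1 e2 e3; lra.
have Ephi : \int[mu]_(x in D) ((G i x - pd i Q x - Gv i x) * phi x) = 0.
  have iEp := sqiM mD sE sp.
  (* These products are admissible in [E0] and converge boundedly to [phi] on [D]. *)
  have tk k : test_fun D (fun x => phi x * eta k x) by exact: (test_fun_mulr tp.1 (teta k)).
  have [] := @dominated_convergence _ _ _ mu D mD
    (fun k x => ((G i x - pd i Q x - Gv i x) * (phi x * eta k x))%:E)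
    (fun x => ((G i x - pd i Q x - Gv i x) * phi x)%:E)
    (fun x => `|((G i x - pd i Q x - Gv i x) * phi x)%:E|)%E.
  - move=> k; apply/measurable_EFinP; apply: measurable_funM; first exact: sE.1.
    apply: measurable_funTS; apply: continuous_measurable_row.
    by have [+ _] := tk k; exact: smooth_continuous.
  - by have := measurable_int _ iEp.
  - apply: aeW => x Dx; apply/cvg_EFin; first by near=> k.
    rewrite -[X in _ --> X]mulr1 -mulrA.
    apply: cvgM; first exact: cvg_cst.
    by apply: cvgM; [exact: cvg_cst|exact: etacvg].
  - by have := integrable_abse iEp.
  - apply: aeW => x k Dx; rewrite lee_fin mulrA normrM ler_piMr//.
    by have /andP[h0 h1] := eta01 k x; rewrite ger0_norm.
  move=> _ _ h; rewrite /Rintegral.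
  have -> : (\int[mu]_(x in D) ((G i x - pd i Q x - Gv i x) * phi x)%:E)%E = 0%E.
    apply/esym; apply: (@cvg_unique _ _ _ _ _ _ _ h) => //.
    rewrite (_ : [sequence _]_k = cst 0%E); first exact: cvg_cst.
    apply/funext => k /=; rewrite -[LHS]fineK; first by congr EFin; exact: (E0 _ (tk k)).
    apply: integrable_fin_num => //.
    by apply: sqiM => //; exact: (test_fun_sqiS mD (tk k)).
  by [].
rewrite hext//; congr (- _); apply/esym/eqP; rewrite -subr_eq0; apply/eqP.
by rewrite -Ephi (Rintegral_sqiBM mD (sqiB mD (sG i) (sQ2 i)) (sGv i) sp).
Unshelve. all: by end_near. Qed.

End zero_trace.

Section extension.
Variables (R : realType) (d : nat).
Notation mu := (vmu R d).
Variables (D D' K' : set 'rV[R]_d) (a : 'rV[R]_d).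
Hypotheses (mD : measurable D) (mD' : measurable D') (fD' : (mu D' < +oo)%E).
Hypotheses (cK' : compact K') (DK' : D' `<=` K').
Hypothesis sub : forall y, D (y - a) -> D' y.

(** Extension by zero outside [D], then translation by [a]. *)
Definition ext (h : 'rV[R]_d -> R) (y : 'rV[R]_d) : R := (h \_ D) (y - a).

Lemma ext_in h y : D (y - a) -> ext h y = h (y - a).
Proof. by move=> Dy; rewrite /ext patchE mem_set. Qed.

Lemma ext_out h y : ~ D (y - a) -> ext h y = 0.
Proof. by move=> Dy; rewrite /ext patchE memNset. Qed.

Lemma measurable_ext h : measurable_fun D h -> measurable_fun setT (ext h).
Proof.
move=> mh; apply: (measurableT_comp (f := h \_ D) _ (measurable_addv (- a))).
exact/(measurable_restrictT _ mD).
Qed.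

Lemma integral_ext_sq h : measurable_fun D h ->
  (\int[mu]_y ((ext h y) ^+ 2)%:E = \int[mu]_(x in D) ((h x) ^+ 2)%:E)%E.
Proof.
move=> mh.
rewrite (@ge0_integral_vmu_shift R d (- a) (fun x => (((h \_ D) x) ^+ 2)%:E)).
- rewrite [RHS]integral_mkcond; apply: eq_integral => x _; rewrite !patchE.
  by case: ifPn => // _; rewrite expr0n.
- by apply/measurable_EFinP/measurable_funX; exact/(measurable_restrictT _ mD).
- by move=> x; rewrite lee_fin sqr_ge0.
Qed.

Lemma sqi_ext h : sqi D h -> sqi setT (ext h).
Proof.
by move=> [mh fh]; split; [exact: measurable_ext|rewrite integral_ext_sq].
Qed.

Lemma integral_ext_sq_in h : measurable_fun D h ->
  (\int[mu]_(y in D') ((ext h y) ^+ 2)%:E = \int[mu]_(x in D) ((h x) ^+ 2)%:E)%E.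
Proof.
move=> mh; rewrite -integral_ext_sq// [LHS]integral_mkcond.
apply: eq_integral => y _; rewrite patchE; case: ifPn => // /negP; rewrite inE => nDy.
by rewrite ext_out ?expr0n// => /sub.
Qed.

Lemma Rintegral_ext h phi : sqi D h -> sqi setT phi ->
  \int[mu]_(y in D') (ext h y * phi y) = \int[mu]_(z in D) (h z * phi (z + a)).
Proof.
move=> sh sp; rewrite Rintegral_outside0; last first.
  by move=> y nDy; rewrite ext_out ?mul0r// => /sub.
rewrite -(Rintegral_shift a (sqiM measurableT (sqi_ext sh) sp)).
rewrite [RHS]Rintegral_mkcond; apply: eq_Rintegral => z _.
rewrite patchE /ext addrK patchE; case: ifPn => // _; exact: mul0r.
Qed.

(** Here [W] is a smooth background, not the potential. Testing on [D'] and translating back by [a]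
    yields a test function whose support need not lie in [D], which is why [weak_grad_ext] is
    assumed. *)
Lemma H1_extension (W v : 'rV[R]_d -> R) (Gv : 'I_d -> 'rV[R]_d -> R) : smooth W ->
  sqi D v -> (forall i, sqi D (Gv i)) -> weak_grad_ext D v Gv ->
  H1 D' (fun y => W y + ext v y) (fun i y => pd i W y + ext (Gv i) y).
Proof.
move=> sW sv sGv hv.
have sub' (f : 'rV[R]_d -> R) : sqi setT f -> sqi D' f.
  exact: (sqiS mD' measurableT (@subsetT _ _)).
have sW1 : sqi D' W by apply: (smooth_sqi mD' fD' cK' DK'); exact: smooth_continuous.
have sW2 i : sqi D' (pd i W) by apply: (smooth_sqi mD' fD' cK' DK'); have [] := smooth_C1 i sW.
have sev := sub' _ (sqi_ext sv).
have seG i := sub' _ (sqi_ext (sGv i)).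
have s1 := sqiD mD' sW1 sev.
have s2 i := sqiD mD' (sW2 i) (seG i).
split; first exact/L2P.
split; first by move=> i; exact/L2P.
apply/(weak_gradP mD' s1 s2) => i phi tp.
have sp := test_fun_sqi tp; have spp := test_fun_pd_sqi i tp.
rewrite (Rintegral_sqiDM mD' sW1 sev (sub' _ spp)).
rewrite (Rintegral_sqiDM mD' (sW2 i) (seG i) (sub' _ sp)).
rewrite (Rintegral_ext sv spp) (Rintegral_ext (sGv i) sp).
have o1 : \int[mu]_(x in D') (W x * pd i phi x) = - \int[mu]_(x in D') (pd i W x * phi x).
  have [_ [Kp [cKp [KpD p0]]]] := tp.
  have o1 : \int[mu]_(x in D') (W x * pd i phi x) = \int[mu]_x (W x * pd i phi x).
    by apply: Rintegral_outside0 => x nDx; rewrite (@pd_support _ _ Kp)// ?mulr0// => /KpD.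
  have o2 : \int[mu]_(x in D') (pd i W x * phi x) = \int[mu]_x (pd i W x * phi x).
    by apply: Rintegral_outside0 => x nDx; rewrite p0 ?mulr0// => /KpD.
  by rewrite o1 o2; exact: test_fun_by_parts tp.
have tpa : test_fun setT (fun x => phi (x + a)).
  by have := test_fun_translate (- a) (test_funW tp); rewrite opprK.
have := hv i _ tpa.
under eq_Rintegral do rewrite pd_translate.
by move=> ->; rewrite o1 opprD.
Qed.

Lemma test_funS (U U' : set 'rV[R]_d) f : U `<=` U' -> test_fun U f -> test_fun U' f.
Proof.
move=> UU' [sf [K [cK [KU f0]]]]; split => //; exists K; split => //; split => //.
exact: subset_trans UU'.
Qed.

Lemma test_funD (U : set 'rV[R]_d) f g : test_fun U f -> test_fun U g ->
  test_fun U (fun x => f x + g x).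
Proof.
move=> [sf [K [cK [KU f0]]]] [sg [L [cL [LU g0]]]]; split; first exact: smoothD.
exists (K `|` L); split; first exact: compactU.
split; first by move=> x [/KU|/LU].
by move=> x /not_orP[/f0 -> /g0 ->]; rewrite addr0.
Qed.

(** The glued function is [w] plus the translated zero extension of [u - Q], since [w] equals the
    translate of [Q] on the translate of [D]. The gradient is given pointwise, so that the energy
    splits exactly over the two regions. *)
Lemma admissible_extension (K : set 'rV[R]_d) (eta : nat -> 'rV[R]_d -> R)
    (u Q w : 'rV[R]_d -> R) (G : 'I_d -> 'rV[R]_d -> R) :
  (mu D < +oo)%E -> compact K -> D `<=` K ->
  (forall k, test_fun D (eta k)) -> (forall k x, 0 <= eta k x <= 1) ->
  (forall x, D x -> eta k x @[k --> \oo] --> (1 : R)) ->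
  smooth Q -> smooth w -> test_fun D' (fun y => w y - Q y) ->
  (forall y, D (y - a) -> w y = Q (y - a)) ->
  (forall y i, D (y - a) -> pd i w y = pd i Q (y - a)) ->
  H1 D u G -> H10 D (fun x => u x - Q x) ->
  let u' := fun y => if `[< D (y - a) >] then u (y - a) else w y in
  H1 D' u' (fun i y => if `[< D (y - a) >] then G i (y - a) else pd i w y) /\
  H10 D' (fun y => u' y - Q y).
Proof.
move=> fD cK DK teta eta01 etacvg sQ sw twQ wQ pwQ hu hv u'.
have [Gv [hGv [psi [tpsi hpsi]]]] := hv.
have [/L2P-/(_ mD) su [/(_ _)/L2P-/(_ _ mD) sG _]] := hu.
have [/L2P-/(_ mD) sv [/(_ _)/L2P-/(_ _ mD) sGv _]] := hGv.
have sQ2 i : sqi D (pd i Q) by apply: (smooth_sqi mD fD cK DK); have [] := smooth_C1 i sQ.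
have wv := H10_weak_grad_ext mD sv sGv tpsi hpsi.
have wu := H1_H10_weak_grad_ext mD fD cK DK teta eta01 etacvg sQ hu hGv wv.
have u'E y : u' y = w y + ext (fun x => u x - Q x) y.
  rewrite /u'; case: asboolP => Dy; last by rewrite ext_out// addr0.
  by rewrite ext_in// wQ//; ring.
split.
  have -> : u' = fun y => w y + ext (fun x => u x - Q x) y by exact/funext.
  rewrite (_ : (fun i y => _) = fun i y => pd i w y + ext (fun x => G i x - pd i Q x) y).
    by apply: H1_extension => // i; exact: sqiB.
  apply/funext => i; apply/funext => y; case: asboolP => Dy; last by rewrite ext_out// addr0.
  by rewrite ext_in// pwQ//; ring.
have u'QE y : u' y - Q y = (w y - Q y) + ext (fun x => u x - Q x) y by rewrite u'E addrAC.
exists (fun i y => pd i (fun y => w y - Q y) y + ext (Gv i) y); split.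
  have -> : (fun y => u' y - Q y) = fun y => (w y - Q y) + ext (fun x => u x - Q x) y.
    exact/funext.
  exact: (H1_extension (smoothB sw sQ) sv sGv wv).
(* The smooth part [w - Q] is reproduced exactly, so the errors on [D'] equal those of [psi k] on
   [D]. *)
exists (fun k y => (w y - Q y) + psi k (y - a)); split.
  move=> k; apply: (test_funD twQ (test_funS _ (test_fun_translate a (tpsi k)))).
  by move=> y /sub.
apply: (cvg_trans _ hpsi); apply: near_eq_cvg; apply: nearW => k.
have [spk [Kk [cKk [KkD pk0]]]] := tpsi k.
have lE (h : 'rV[R]_d -> R) (F : 'rV[R]_d -> R) : sqi D h -> F =1 ext h ->
    lint D (fun x => ((h x) ^+ 2)%:E) = lint D' (fun y => ((F y) ^+ 2)%:E).
  move=> sh /funext ->.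
  rewrite lintE//; last 2 first.
  - by apply/measurable_EFinP/measurable_funX; exact: sh.1.
  - by move=> x _; rewrite lee_fin sqr_ge0.
  rewrite lintE//; last 2 first.
  - by apply/measurable_EFinP/measurable_funX; apply: measurable_funTS; exact: measurable_ext sh.1.
  - by move=> x _; rewrite lee_fin sqr_ge0.
  by rewrite integral_ext_sq_in//; exact: sh.1.
congr (_ + _)%E.
  apply: lE; first exact: (sqiB mD sv (test_fun_sqiS mD (tpsi k))).
  move=> y; rewrite u'QE; have [Dy|Dy] := pselect (D (y - a)).
    by rewrite !ext_in//; ring.
  by rewrite !ext_out// pk0 ?addr0 ?subrr// => /KkD.
apply: eq_bigr => i _.
apply: lE; first exact: (sqiB mD (sGv i) (test_fun_pd_sqiS i mD (tpsi k))).
move=> y; rewrite (pdD i y (smoothB sw sQ) (smooth_translate (- a) spk)) pd_translate.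
have [Dy|Dy] := pselect (D (y - a)).
  by rewrite !ext_in//; ring.
rewrite !ext_out// (@pd_support _ _ Kk (psi k) i (y - a)) ?addr0 ?subrr//.
by move=> /KkD.
Qed.

End extension.

(** * Measurability of the minimal energy *)

Section hom_ext_theory.
Variables (R : realType) (d : nat).
Implicit Types (p x y : 'rV[R]_d).

Lemma enorm_ge0 p : 0 <= enorm p. Proof. exact: sqrtr_ge0. Qed.

Lemma enorm0 : enorm (0 : 'rV[R]_d) = 0.
Proof. by rewrite /enorm /dotp big1 ?sqrtr0// => i _; rewrite mxE mul0r. Qed.

Lemma enorm_gt0 p : p != 0 -> 0 < enorm p.
Proof.
move=> p0; rewrite sqrtr_gt0 lt_def dotp_ge0 andbT; apply: contra p0 => /eqP h.
apply/eqP/rowP => i; rewrite mxE; apply/eqP; rewrite -sqrf_eq0.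
have : dotp p p == 0 by rewrite h.
by rewrite psumr_eq0 => [/allP/(_ i)|j _]; rewrite ?mem_index_enum -?expr2 ?sqr_ge0// => /(_ isT).
Qed.

Lemma enormZ (c : R) p : 0 <= c -> enorm (c *: p) = c * enorm p.
Proof.
move=> c0; rewrite /enorm dotpZl dotpC dotpZl mulrA -expr2 sqrtrM ?sqr_ge0//.
by rewrite sqrtr_sqr ger0_norm.
Qed.

Lemma enormN p : enorm (- p) = enorm p.
Proof. by rewrite /enorm dotpNl dotpC dotpNl opprK. Qed.

Lemma enorm_continuous : continuous (@enorm R d).
Proof.
move=> x; apply: (@continuous_comp _ _ _ (fun x : 'rV[R]_d => dotp x x) (@Num.sqrt R)).
  apply: (@Ck_sum R 'rV[R]_d unit _ (fun=> 0) 0) => i y.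
  by apply: continuousM; exact: coord_continuous.
exact: sqrt_continuous.
Qed.

Variables (lam Lam : R) (phi : 'rV[R]_d -> R).
Hypotheses (Lam0 : 0 < Lam) (Fphi : Fd lam Lam phi).

Lemma hom_extZ (c : R) p : 0 <= c -> hom_ext phi (c *: p) = c * hom_ext phi p.
Proof.
rewrite le_eqVlt => /predU1P[<-|c0]; first by rewrite scale0r mul0r /hom_ext eqxx.
rewrite /hom_ext scaler_eq0 gt_eqF//=; case: ifPn => [_|p0]; first by rewrite mulr0.
rewrite enormZ ?ltW// -mulrA; congr (_ * (_ * phi _)).
by rewrite scalerA invfM mulrAC mulVf ?mul1r// gt_eqF.
Qed.

Lemma enorm_normalize p : p != 0 -> usphere ((enorm p)^-1 *: p).
Proof.
move=> p0; rewrite /usphere/= enormZ ?invr_ge0 ?enorm_ge0// mulVf// gt_eqF//.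
exact: enorm_gt0.
Qed.

Lemma hom_ext_bound p : 0 <= hom_ext phi p <= Num.sqrt Lam * enorm p.
Proof.
rewrite /hom_ext; case: ifPn => [/eqP ->|p0]; first by rewrite enorm0 mulr0 lexx.
have /andP[h1 h2] := Fphi.2.1 _ (enorm_normalize p0).
rewrite mulr_ge0 ?enorm_ge0//; last by rewrite (le_trans _ h1)// sqrtr_ge0.
by rewrite mulrC ler_wpM2r// enorm_ge0.
Qed.

(** Convexity at the midpoint of [2 *: x] and [2 *: y], then homogeneity. *)
Lemma hom_extD x y : hom_ext phi (x + y) <= hom_ext phi x + hom_ext phi y.
Proof.
have := Fphi.2.2 (2 *: x) (2 *: y) (2^-1).
rewrite !scalerA !hom_extZ//.
have -> : 1 - 2^-1 = 2^-1 :> R by lra.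
rewrite mulVf// !scale1r !mulrA mulVf// !mul1r; apply.
by apply/andP; split; lra.
Qed.

(** Subadditivity and the bound on the sphere give a Lipschitz constant common to the whole class,
    hence to all environments. *)
Lemma hom_ext_lip x y : hom_ext phi y <= hom_ext phi x + Num.sqrt Lam * enorm (y - x).
Proof.
have -> : y = x + (y - x) by rewrite addrC subrK.
apply: (le_trans (hom_extD _ _)); rewrite lerD2l.
have -> : x + (y - x) - x = y - x by rewrite addrC addKr.
by have /andP[] := hom_ext_bound (y - x).
Qed.

Lemma hom_ext_continuous : continuous (hom_ext phi).
Proof.
move=> x; apply/(cvgrPdist_lt (FF := fmap_filter _ (@nbhs_filter 'rV[R]_d x))) => e e0.
have c : continuous (fun y => Num.sqrt Lam * enorm (y - x)).
  apply: (@CkZ R 'rV[R]_d unit (fun=> 0) 0).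
  exact: (@Ck_translate R 'rV[R]_d unit (fun=> 0) 0 _ (- x) enorm_continuous).
have := c x; rewrite /continuous_at subrr enorm0 mulr0 => /(cvgrPdist_lt (FF := fmap_filter _ (@nbhs_filter 'rV[R]_d x)))/(_ _ e0).
apply: filterS => y /=; rewrite sub0r normrN.
rewrite ger0_norm ?mulr_ge0 ?sqrtr_ge0 ?enorm_ge0// => h.
rewrite ltr_norml; have h1 := hom_ext_lip x y; have h2 := hom_ext_lip y x.
move: h2; rewrite -opprB enormN => h2; apply/andP; split; lra.
Qed.

(** The square of a sum split with weight [c]: the loss is a small multiple of the energy itself
    plus a multiple of the squared distance of the gradients. *)
Lemma hom_ext_sqr (c : R) x y : 0 < c ->
  hom_ext phi y ^+ 2 <= (1 + c) * hom_ext phi x ^+ 2 +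
    (1 + c^-1) * Lam * \sum_i (y 0 i - x 0 i) ^+ 2.
Proof.
move=> c0.
have -> : \sum_i (y 0 i - x 0 i) ^+ 2 = enorm (y - x) ^+ 2.
  by rewrite enorm_sqr; apply: eq_bigr => i _; rewrite !mxE -expr2.
have /andP[y0 _] := hom_ext_bound y; have /andP[x0 _] := hom_ext_bound x.
have := hom_ext_lip x y.
have -> : (1 + c^-1) * Lam * enorm (y - x) ^+ 2 =
    (1 + c^-1) * (Num.sqrt Lam * enorm (y - x)) ^+ 2.
  by rewrite -{1}(sqr_sqrtr (ltW Lam0)); move: (Num.sqrt Lam) => l; ring.
have : 0 <= Num.sqrt Lam * enorm (y - x) by rewrite mulr_ge0 ?sqrtr_ge0 ?enorm_ge0.
move: (_ * enorm _) (hom_ext _ y) (hom_ext _ x) y0 x0 => g b a b0 a0 g0 bag.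
have cV : c * c^-1 = 1 by rewrite mulfV// gt_eqF.
have ci : 0 < c^-1 by rewrite invr_gt0.
apply: (@le_trans _ _ ((a + g) ^+ 2)); first by rewrite ler_pXn2r ?nnegrE ?addr_ge0.
have h : 2 * (a * g) <= c * a ^+ 2 + c^-1 * g ^+ 2.
  rewrite -(ler_pM2l c0) [leRHS]mulrDr [c * (c^-1 * _)]mulrA cV mul1r.
  by have := sqr_ge0 (c * a - g); nra.
by rewrite sqrrD; move: h; rewrite !mulrDl -mulr_natl; lra.
Qed.

End hom_ext_theory.

Section energy_measurable.
Variables (R : realType) (d : nat) (lam Lam : R).
Hypotheses (Lam0 : 0 < Lam).
Variables (dO : measure_display) (Omega : measurableType dO).
Variables (Phi : Omega -> 'rV[R]_d -> R) (tau : 'rV[R]_d -> Omega -> Omega).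
Hypothesis hPhiF : forall w, Fd lam Lam (Phi w).
Hypothesis hPhim : forall B, Fd_borel lam Lam B -> measurable (Phi @^-1` B).
Hypothesis htaum : measurable_fun [set: d.-tuple R * Omega]
             (fun p => tau (rowt p.1) p.2).
Notation mu := (vmu R d).

(** A strict upper bound at one point of the sphere defines a set of [Fd] that is open for the sup
    distance. *)
Lemma measurable_Phi (e : 'rV[R]_d) : usphere e -> measurable_fun setT (fun w => Phi w e).
Proof.
move=> he; apply: (measurability _ (RGenInftyO.measurableE R)) => //.
move=> /= _ [_ [r ->] <-]; rewrite setTI.
rewrite (_ : _ @^-1` _ = Phi @^-1` [set f | Fd lam Lam f /\ f e < r]); last first.
  by apply/seteqP; split => w /=; rewrite in_itv/=; [move=> h; split|case].
apply: hPhim; apply: sub_sigma_algebra; split => [f []//|f [Ff fr]].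
exists (r - f e); split; first by rewrite subr_gt0.
move=> g Fg fg; split => //.
have : ((`|f e - g e|)%:E < (r - f e)%:E)%E.
  by apply: le_lt_trans fg; apply: ereal_sup_ubound; exists e.
rewrite lte_fin ltr_norml => /andP[h1 h2]; lra.
Qed.

Lemma measurable_hom_ext_Phi (p : 'rV[R]_d) : measurable_fun setT (fun w => hom_ext (Phi w) p).
Proof.
rewrite /hom_ext; move: (@enorm_normalize _ _ p); case: eqP => [//|/eqP p0 /(_ isT) hp].
by apply: measurable_funM => //; exact: measurable_Phi.
Qed.

Lemma measurable_hom_ext_joint :
  measurable_fun setT (fun z : Omega * 'rV[R]_d => hom_ext (Phi z.1) z.2).
Proof.
apply: (@measurable_caratheodory R _ Omega d (fun w p => hom_ext (Phi w) p)) => [p|w]; first exact: measurable_hom_ext_Phi.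
exact: (hom_ext_continuous (hPhiF w)).
Qed.

Lemma measurable_tau_joint :
  measurable_fun setT (fun z : Omega * 'rV[R]_d => tau z.2 z.1).
Proof.
have m : measurable_fun setT (fun z : Omega * 'rV[R]_d => (trow z.2, z.1)).
  apply: measurable_fun_pair => //.
  exact: (measurableT_comp (@measurable_trow R d) measurable_snd).
rewrite (_ : (fun z => _) = (fun p => tau (rowt p.1) p.2) \o (fun z => (trow z.2, z.1))).
  exact: (measurableT_comp htaum m).
by apply/funext => z /=; rewrite trowK.
Qed.

(** By definition [phiw Phi tau w x p] is [hom_ext (Phi (tau x w)) p], so the joint measurability of
    the action and of [hom_ext] compose. *)
Lemma measurable_phiw_joint (g : 'rV[R]_d -> 'rV[R]_d) : measurable_fun setT g ->
  measurable_fun setT (fun z : Omega * 'rV[R]_d => phiw Phi tau z.1 z.2 (g z.2)).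
Proof.
move=> mg.
have m : measurable_fun setT (fun z : Omega * 'rV[R]_d => (tau z.2 z.1, g z.2)).
  apply: measurable_fun_pair; first exact: measurable_tau_joint.
  exact: (measurableT_comp mg measurable_snd).
exact: (measurableT_comp measurable_hom_ext_joint m).
Qed.

Variable W : R -> R.
Hypothesis hWc : {within `[-1, 1], continuous W}.
Hypothesis hW0 : forall s, -1 <= s <= 1 -> 0 <= W s.
Variable D : set 'rV[R]_d.
Hypotheses (mD : measurable D) (fD : (mu D < +oo)%E).
Variables (u : 'rV[R]_d -> R) (G : 'I_d -> 'rV[R]_d -> R).
Hypotheses (mu_ : measurable_fun D u) (mG : forall i, measurable_fun D (G i)).
Hypothesis u11 : forall x, D x -> -1 <= u x <= 1.

Definition eint (w : Omega) (x : 'rV[R]_d) : R :=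
  2^-1 * phiw Phi tau w x (\row_i G i x) ^+ 2 + W (u x).

Lemma measurable_Wu : measurable_fun D (fun x => W (u x)).
Proof.
have mW : measurable_fun [set` `[-1, 1 : R]] W by exact: subspace_continuous_measurable_fun.
apply: (measurable_comp (F := [set` `[-1, 1 : R]]) _ _ mW mu_) => //.
by move=> _ [x Dx <-] /=; rewrite in_itv/= u11.
Qed.

Lemma eint_ge0 w x : D x -> 0 <= eint w x.
Proof.
move=> Dx; apply: addr_ge0; last by apply: hW0; exact: u11.
by rewrite mulr_ge0 ?sqr_ge0 ?invr_ge0.
Qed.

Lemma measurable_eint_joint :
  measurable_fun setT (fun z : Omega * 'rV[R]_d => (eint z.1 \_ D) z.2).
Proof.
have mg : measurable_fun setT (fun x => \row_i (G i \_ D) x : 'rV[R]_d).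
  apply: measurable_fun_row => i; under eq_fun do rewrite mxE.
  exact/(measurable_restrictT _ mD).
(* [G] is controlled on [D] only; cutting it off and multiplying by the indicator makes each factor
   measurable on the whole space. *)
rewrite (_ : (fun z => _) = fun z : Omega * 'rV[R]_d => \1_D z.2 *
    (2^-1 * phiw Phi tau z.1 z.2 (\row_i (G i \_ D) z.2) ^+ 2) +
    ((fun x => W (u x)) \_ D) z.2); last first.
  apply/funext => -[w x] /=; rewrite !patchE indicE.
  have [Dx|nDx] := boolP (x \in D); last by rewrite mul0r addr0.
  rewrite mul1r /eint; congr (2^-1 * phiw Phi tau w x _ ^+ 2 + _).
  by apply/rowP => i; rewrite !mxE patchE Dx.
apply: measurable_funD.
  apply: measurable_funM.
    exact: (measurableT_comp (measurable_indic mD) measurable_snd).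
  apply: measurable_funM => //; apply: measurable_funX.
  exact: (measurable_phiw_joint mg).
apply: (measurableT_comp (f := (fun x => W (u x)) \_ D) _ measurable_snd).
by apply/(measurable_restrictT _ mD); exact: measurable_Wu.
Qed.

Lemma measurable_eint w : measurable_fun D (eint w).
Proof.
apply/(measurable_restrictT _ mD).
exact: (measurableT_comp measurable_eint_joint (@pair1_measurable _ _ _ _ w)).
Qed.

Lemma energyE w : energy Phi tau W w u G D = (\int[mu]_(x in D) (eint w x)%:E)%E.
Proof.
rewrite /energy lintE//.
  by apply/measurable_EFinP; exact: measurable_eint.
by move=> x Dx; rewrite lee_fin; exact: eint_ge0.
Qed.

Lemma measurable_energy : measurable_fun setT (fun w => energy Phi tau W w u G D).
Proof.
have -> : (fun w => energy Phi tau W w u G D) =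
    fun w => (\int[mu]_x ((eint w \_ D) x)%:E)%E.
  apply/funext => w; rewrite energyE integral_mkcond; apply: eq_integral => x _.
  by rewrite !patchE; case: ifPn.
apply: (@measurable_section_int R d _ Omega (fun z => ((eint z.1 \_ D) z.2)%:E)).
  by apply/measurable_EFinP; exact: measurable_eint_joint.
move=> [w x] /=; rewrite patchE lee_fin; case: ifPn => //.
by rewrite inE; exact: eint_ge0.
Qed.

End energy_measurable.

Lemma measurable_ereal_inf_count d (T : measurableType d) (R : realType) (J : countType)
    (f : J -> T -> \bar R) : (forall j, measurable_fun setT (f j)) ->
  measurable_fun setT (fun w => ereal_inf [set f j w | j in setT]).
Proof.
move=> mf; apply: (measurability _ (ErealGenInftyO.measurableE R)) => //.
move=> /= _ [_ [r ->] <-]; rewrite setTI.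
rewrite (_ : _ @^-1` _ = [set w | exists j, (f j w < r%:E)%E]).
  apply: measurable_exists_count => j.
  rewrite -[X in measurable X]setTI; exact: (emeasurable_fun_infty_o _ (mf j)).
apply/seteqP; split => w /=; rewrite in_itv/=.
  by move=> /ereal_inf_lt[_ [j _ <-] h]; exists j.
by move=> [j h]; apply: le_lt_trans h; apply: ereal_inf_lbound; exists j.
Qed.

(** * Continuity of the energy and countable families of competitors *)

Section potential_estimate.
Variables (R : realType) (W : R -> R).
Hypothesis hWc : {within `[-1, 1], continuous W}.
Hypothesis hW0 : forall s, -1 <= s <= 1 -> 0 <= W s.

Lemma potential_bound : exists2 M, 0 <= M & forall s, -1 <= s <= 1 -> W s <= M.
Proof.
have [|c c11 cmax] := EVT_max _ hWc; first by lra.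
exists (W c) => [|s hs]; last by apply: cmax; rewrite in_itv.
by apply: hW0; rewrite in_itv/= in c11.
Qed.

(** Uniform continuity on the segment, by compactness. *)
Lemma potential_unif (e : R) : 0 < e -> exists2 dl, 0 < dl &
  forall s t, -1 <= s <= 1 -> -1 <= t <= 1 -> `|s - t| < dl -> W t <= W s + e.
Proof.
move=> e0; have := @segment_compact R (-1) 1.
move=> /compact_near_coveringP/near_covering_withinP H.
have := H R 0^'+ (fun dl s => forall t, -1 <= t <= 1 -> `|s - t| < dl -> W t <= W s + e).
move=> /(_ (at_right_proper_filter 0)) {}H.
have : \forall dl \near 0^'+, `[-1, 1] `<=`
    (fun s => forall t, -1 <= t <= 1 -> `|s - t| < dl -> W t <= W s + e).
  apply: H => s hs.
  have /subspace_continuousP/(_ s hs)/cvgrPdist_lt/(_ (e / 2)) := hWc.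
  rewrite divr_gt0// => /(_ isT); rewrite near_withinE => -[/= r r0 hr].
  (* Half radii keep both [s'] and [t] within the radius of continuity at [s]. *)
  exists (ball s (r / 2), [set dl | dl < r / 2]); first split => /=.
  - by apply: nbhsx_ballx; rewrite divr_gt0.
  - by apply: nbhs_right_lt; rewrite divr_gt0.
  move=> [s' dl]/= [ss' dlr] hs' t ht s't.
  have h1 : `|W s - W s'| < e / 2.
    by apply: hr => //; apply: (lt_trans ss'); rewrite ltr_pdivrMr// ltr_pMr// ltr1n.
  have h2 : `|W s - W t| < e / 2.
    apply: hr; last by rewrite /= in_itv.
    rewrite /=.
    rewrite (_ : s - t = (s - s') + (s' - t)); last by ring.
    apply: (le_lt_trans (ler_normD _ _)); rewrite [ltRHS]splitr ltrD//.
    exact: lt_trans s't dlr.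
  move: h1 h2; rewrite !ltr_norml => /andP[h1 h2] /andP[h3 h4]; lra.
move=> H1; have [dl [dl0 hdl]] := @filter_ex _ _ (at_right_proper_filter (0 : R)) _
  (filterI (nbhs_right_gt 0) H1).
by exists dl => // s t hs ht st; apply: (hdl s) => //; rewrite /= in_itv.
Qed.

(** Nearby values are handled by uniform continuity; for distant ones [M / dl ^+ 2] times the
    squared distance exceeds the maximum [M]. The variation of a merely continuous potential is thus
    controlled by L2 distances. *)
Lemma potential_quad (e : R) : 0 < e -> exists2 C, 0 <= C &
  forall s t, -1 <= s <= 1 -> -1 <= t <= 1 -> W t <= W s + e + C * (s - t) ^+ 2.
Proof.
move=> e0; have [dl dl0 hdl] := potential_unif e0; have [M M0 hM] := potential_bound.
have C0 : 0 <= M / dl ^+ 2 by rewrite divr_ge0// sqr_ge0.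
exists (M / dl ^+ 2) => // s t hs ht.
have [/(hdl _ _ hs ht) h|h] := ltP `|s - t| dl.
  by apply: (le_trans h); rewrite lerDl mulr_ge0// sqr_ge0.
have h2 : dl ^+ 2 <= (s - t) ^+ 2 by rewrite -[leRHS]real_normK ?num_real// ler_sqr ?nnegrE// ltW.
apply: (le_trans (hM _ ht)); apply: (@le_trans _ _ (M / dl ^+ 2 * (s - t) ^+ 2)).
  by rewrite mulrAC ler_pdivlMr ?exprn_gt0// ler_wpM2l.
by rewrite lerDr addr_ge0 ?(ltW e0)// hW0.
Qed.

End potential_estimate.

Section countable_dense.
Variables (R : realType) (d : nat) (D : set 'rV[R]_d).
Notation mu := (vmu R d).
Hypotheses (mD : measurable D) (fD : (mu D < +oo)%E).

(** A subset of a separable metric space is separable, but the dense functions [C] need not come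
    from [S]. For every tuple of them and every precision a nearby member of [S] is selected when
    there is one, and [t0] otherwise. *)
Lemma L2_dense_subfamily (I : finType) (T : Type) (F : T -> I -> 'rV[R]_d -> R) (S : set T) :
  (forall t i, S t -> sqi D (F t i)) -> S !=set0 ->
  exists (J : countType) (c : J -> T), (forall j, S (c j)) /\
    forall t dl, S t -> 0 < dl -> exists j, forall i,
      (\int[mu]_(x in D) ((F t i x - F (c j) i x) ^+ 2)%:E < dl%:E)%E.
Proof.
move=> sF [t0 St0]; have [J0 [C [mC hC]]] := L2_separable_row mD fD.
pose near_ (z : {ffun I -> J0} * nat) t := S t /\ forall i,
  (\int[mu]_(x in D) ((F t i x - C (z.1 i) x) ^+ 2)%:E < (z.2.+1%:R^-1)%:E)%E.
pose c z := if pselect (exists t, near_ z t) is left h then projT1 (cid h) else t0.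
exists ({ffun I -> J0} * nat)%type, c; split.
  by move=> z; rewrite /c; case: pselect => // h; case: cid => t [].
move=> t dl St dl0.
(* Both [t] and the selected member are within 1/(n+1) of [C] in squared distance; the triangle
   inequality for squares costs a factor 2 on each. *)
have [n hn] : exists n : nat, n.+1%:R^-1 < dl / 4.
  have := @near_infty_natSinv_lt R (PosNum (divr_gt0 dl0 (ltr0n _ 4))) => -[n _ h].
  by exists n; exact: (h n (leqnn n)).
have hi i : exists j, (\int[mu]_(x in D) ((F t i x - C j x) ^+ 2)%:E < (n.+1%:R^-1)%:E)%E.
  have [mF iF] := sF _ i St.
  have [|||j hj] := hC (F t i \_ D) n.+1%:R^-1.
  - exact/(measurable_restrictT _ mD).
  - rewrite (eq_integral (fun x => ((F t i x) ^+ 2)%:E))// => x xD.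
    by rewrite patchE xD.
  - by rewrite invr_gt0.
  exists j; rewrite (eq_integral (fun x => (((F t i \_ D) x - C j x) ^+ 2)%:E))// => x xD.
  by rewrite patchE xD.
have [k hk] := choice hi.
pose z : {ffun I -> J0} * nat := ([ffun i => k i], n).
exists z => i; rewrite /c; case: pselect => [h|[]]; last first.
  by exists t; split => // i'; rewrite ffunE.
case: cid => /= t' [St' /(_ i)]; rewrite ffunE /= => h1.
have [mF iF] := sF _ i St; have [mF' iF'] := sF _ i St'.
have m1 : measurable_fun D (fun x => ((F t i x - C (k i) x) ^+ 2)%:E).
  by apply/measurable_EFinP/measurable_funX/measurable_funB => //; exact: measurable_funTS.
have m2 : measurable_fun D (fun x => ((F t' i x - C (k i) x) ^+ 2)%:E).
  by apply/measurable_EFinP/measurable_funX/measurable_funB => //; exact: measurable_funTS.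
apply: (@le_lt_trans _ _ (\int[mu]_(x in D) (2%:E *
    (((F t i x - C (k i) x) ^+ 2)%:E + ((F t' i x - C (k i) x) ^+ 2)%:E)))%E).
  apply: ge0_le_integral => //.
  - by move=> x _; rewrite lee_fin sqr_ge0.
  - by apply/measurable_EFinP/measurable_funX/measurable_funB.
  - by apply: measurable_funeM; exact: emeasurable_funD.
  move=> x _; rewrite -EFinD -EFinM lee_fin.
  by have := sqr_ge0 (F t i x - C (k i) x + (F t' i x - C (k i) x)); nra.
rewrite ge0_integralZl_EFin//; last 2 first.
- by move=> x _; rewrite -EFinD lee_fin addr_ge0 ?sqr_ge0.
- exact: emeasurable_funD.
rewrite ge0_integralD//; try by move=> x _; rewrite lee_fin sqr_ge0.
rewrite (_ : dl%:E = 2%:E * ((dl / 4)%:E + (dl / 4)%:E))%E; last first.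
  by rewrite -EFinD -EFinM; congr EFin; lra.
rewrite lte_pmul2l//; apply: lteD; apply: (@lt_trans _ _ (n.+1%:R^-1)%:E) => //.
Qed.

End countable_dense.

Section energy_inf.
Variables (R : realType) (d : nat) (lam Lam : R).
Hypotheses (Lam0 : 0 < Lam).
Variables (dO : measure_display) (Omega : measurableType dO).
Variables (Phi : Omega -> 'rV[R]_d -> R) (tau : 'rV[R]_d -> Omega -> Omega).
Hypothesis hPhiF : forall w, Fd lam Lam (Phi w).
Hypothesis hPhim : forall B, Fd_borel lam Lam B -> measurable (Phi @^-1` B).
Hypothesis htaum : measurable_fun [set: d.-tuple R * Omega]
             (fun p => tau (rowt p.1) p.2).
Notation mu := (vmu R d).
Variable W : R -> R.
Hypothesis hWc : {within `[-1, 1], continuous W}.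
Hypothesis hW0 : forall s, -1 <= s <= 1 -> 0 <= W s.
Variable D : set 'rV[R]_d.
Hypotheses (mD : measurable D) (fD : (mu D < +oo)%E).

Let T := (('rV[R]_d -> R) * ('I_d -> 'rV[R]_d -> R))%type.
(** A function and its gradient seen as [d.+1] components, index 0 being the function, to match
    [L2_dense_subfamily]. *)
Let F (t : T) (o : 'I_d.+1) := if unlift ord0 o is Some i then t.2 i else t.1.
Let F0 t : F t ord0 = t.1. Proof. by rewrite /F unlift_none. Qed.
Let FS t i : F t (lift ord0 i) = t.2 i. Proof. by rewrite /F liftK. Qed.

Definition admissible_pair (t : T) :=
  [/\ sqi D t.1, forall i, sqi D (t.2 i) & forall x, D x -> -1 <= t.1 x <= 1].
Let E w (t : T) := energy Phi tau W w t.1 t.2 D.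

Let sF t o : admissible_pair t -> sqi D (F t o).
Proof. by move=> [t1 t2 _]; rewrite /F; case: (unlift _ _). Qed.

Let mE w t : admissible_pair t -> measurable_fun D (eint Phi tau W t.1 t.2 w).
Proof.
move=> [t1 t2 t11]; apply: (measurable_eint hPhiF hPhim htaum hWc mD t1.1 _ t11).
by move=> i; have [] := t2 i.
Qed.

Let EE w t : admissible_pair t ->
  E w t = (\int[mu]_(x in D) (eint Phi tau W t.1 t.2 w x)%:E)%E.
Proof.
move=> [t1 t2 t11]; apply: (energyE hPhiF hPhim htaum hWc hW0 mD t1.1 _ t11) => i.
by have [] := t2 i.
Qed.

(** [hom_ext_sqr] for the gradient part and [potential_quad] for the potential; [K] is the same for
    all environments. *)
Lemma eint_comparison (c e : R) : 0 < c -> 0 < e -> exists2 K, 0 <= K &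
  forall w t t' x, -1 <= t.1 x <= 1 -> -1 <= t'.1 x <= 1 ->
    eint Phi tau W t'.1 t'.2 w x <= (1 + c) * eint Phi tau W t.1 t.2 w x + e +
      K * \sum_o (F t o x - F t' o x) ^+ 2.
Proof.
move=> c0 e0; have [C C0 hC] := potential_quad hWc hW0 e0.
have L0 : 0 <= (1 + c^-1) * Lam by rewrite mulr_ge0 ?(ltW Lam0)// addr_ge0// invr_ge0 ltW.
exists (C + (1 + c^-1) * Lam); first by rewrite addr_ge0.
move=> w t t' x ht ht'.
have h1 := hC _ _ ht ht'.
have := hom_ext_sqr Lam0 (hPhiF (tau x w)) (\row_i t.2 i x) (\row_i t'.2 i x) c0.
rewrite -![hom_ext _ _]/(phiw Phi tau w x _).
rewrite (eq_bigr (fun i => (t.2 i x - t'.2 i x) ^+ 2)); last first.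
  by move=> i _; rewrite !mxE -sqrrN opprB.
rewrite big_ord_recl !F0; under [in X in _ -> X]eq_bigr do rewrite !FS.
have : 0 <= \sum_i (t.2 i x - t'.2 i x) ^+ 2 by apply: sumr_ge0 => i _; exact: sqr_ge0.
have W0 := hW0 ht; have := sqr_ge0 (t.1 x - t'.1 x).
rewrite /eint.
move: (\sum_i _) ((t.1 x - t'.1 x) ^+ 2) h1 => A B.
move: L0 (phiw _ _ _ _ _ ^+ 2) (phiw _ _ _ _ _ ^+ 2) W0.
move: (W _) (W _) (_ * Lam) => W1 W2 L L0 p1 p2 W10 h1 B0 A0 h2.
have := mulr_ge0 L0 A0; have := mulr_ge0 L0 B0; have := mulr_ge0 C0 A0.
have := mulr_ge0 (ltW c0) W10.
move: h2; rewrite !mulrDl !mulrDr !mul1r; lra.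
Qed.

Lemma integral_quadratic_comb (a b K : R) (f : 'rV[R]_d -> R) (g : 'I_d.+1 -> 'rV[R]_d -> R) :
  0 <= a -> 0 <= b -> 0 <= K -> measurable_fun D f -> (forall x, D x -> 0 <= f x) ->
  (forall o, measurable_fun D (g o)) ->
  (\int[mu]_(x in D) (a * f x + b + K * \sum_o (g o x) ^+ 2)%:E =
   a%:E * \int[mu]_(x in D) (f x)%:E + b%:E * mu D +
   K%:E * \sum_o \int[mu]_(x in D) ((g o x) ^+ 2)%:E)%E.
Proof.
move=> a0 b0 K0 mf f0 mg.
have mS : measurable_fun D (fun x => \sum_o (g o x) ^+ 2).
  by apply: measurable_sum => o; exact: measurable_funX.
have S0 x : 0 <= \sum_o (g o x) ^+ 2 by apply: sumr_ge0 => o _; exact: sqr_ge0.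
under eq_integral do rewrite EFinD EFinD.
rewrite ge0_integralD//; last 4 first.
- by move=> x Dx; rewrite -EFinD lee_fin addr_ge0// mulr_ge0// f0.
- apply/measurable_EFinP; apply: measurable_funD => //; exact: measurable_funM.
- by move=> x Dx; rewrite lee_fin mulr_ge0.
- by apply/measurable_EFinP; exact: measurable_funM.
rewrite ge0_integralD//; last 2 first.
- by move=> x Dx; rewrite lee_fin mulr_ge0// f0.
- by apply/measurable_EFinP; exact: measurable_funM.
congr (_ + _ + _)%E.
- under eq_integral do rewrite EFinM.
  rewrite ge0_integralZl_EFin//; last exact/measurable_EFinP.
- by rewrite integral_cst.
- under eq_integral do rewrite EFinM.
  rewrite ge0_integralZl_EFin//; last 2 first.
  + by move=> x Dx; rewrite lee_fin.
  + exact/measurable_EFinP.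
  congr (_ * _)%E; under eq_integral do rewrite -sumEFin.
  rewrite ge0_integral_sum// => o.
  + by apply/measurable_EFinP; exact: measurable_funX.
  + by move=> x Dx; rewrite lee_fin sqr_ge0.
Qed.

Lemma energy_comparison (c e : R) : 0 < c -> 0 < e -> exists2 K, 0 <= K &
  forall w t t', admissible_pair t -> admissible_pair t' ->
  (E w t' <= (1 + c)%:E * E w t + e%:E * mu D +
    K%:E * \sum_o \int[mu]_(x in D) ((F t o x - F t' o x) ^+ 2)%:E)%E.
Proof.
move=> c0 e0; have [K K0 hK] := eint_comparison c0 e0; exists K => // w t t' at_ at'.
have c10 : 0 <= 1 + c by rewrite addr_ge0// ltW.
have mF o : measurable_fun D (fun x => F t o x - F t' o x).
  by apply: measurable_funB; [have [] := sF o at_ | have [] := sF o at'].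
have t11 : forall x, D x -> -1 <= t.1 x <= 1 by case: at_.
have t'11 : forall x, D x -> -1 <= t'.1 x <= 1 by case: at'.
have e0t x : D x -> 0 <= eint Phi tau W t.1 t.2 w x.
  by move=> Dx; exact: (eint_ge0 Phi tau hW0 t.2 t11).
rewrite !EE// -(integral_quadratic_comb c10 (ltW e0) K0 (mE w at_) e0t mF).
apply: ge0_le_integral => //.
- by move=> x Dx; rewrite lee_fin; exact: (eint_ge0 Phi tau hW0 t'.2 t'11).
- by apply/measurable_EFinP; exact: mE.
- apply/measurable_EFinP; apply: measurable_funD.
    by apply: measurable_funD => //; apply: measurable_funM => //; exact: mE.
  by apply: measurable_funM => //; apply: measurable_sum => o; exact: measurable_funX.
- by move=> x Dx; rewrite lee_fin; apply: hK; [exact: t11|exact: t'11].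
Qed.

Let finD : mu D \is a fin_num. Proof. by rewrite ge0_fin_numE. Qed.

Lemma energy_fin w t : admissible_pair t -> E w t \is a fin_num.
Proof.
move=> at_; have [t1 t2 t11] := at_.
have E0 : (0 <= E w t)%E.
  rewrite EE//; apply: integral_ge0 => x Dx; rewrite lee_fin.
  exact: (eint_ge0 Phi tau hW0 t.2 t11).
rewrite ge0_fin_numE//.
have [K K0 hK] := energy_comparison (@ltr01 R) (@ltr01 R).
have z11 x : D x -> -1 <= (0 : R) <= 1 by move=> _; lra.
(* Comparison with the zero pair, whose energy is [W 0] times the volume of [D]. *)
pose z : T := (fun=> 0, fun _ _ => 0).
have s0 : sqi D (fun=> 0 : R).
  by split => //; rewrite expr0n/= integral0.
have az : admissible_pair z by split.
apply: (le_lt_trans (hK w z t az at_)).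
have -> : E w z = ((W 0)%:E * mu D)%E.
  rewrite EE// -integral_cst//; apply: eq_integral => x _; rewrite /eint /phiw /=.
  by rewrite ifT ?expr0n/= ?mulr0 ?add0r//; apply/eqP/rowP => i; rewrite !mxE.
apply: lte_add_pinfty.
  by rewrite -(fineK finD) -!EFinM -EFinD ltry.
rewrite lte_mul_pinfty// lte_sum_pinfty// => o _.
rewrite (eq_integral (fun x => ((F t o x) ^+ 2)%:E)).
  by have [] := sF o at_.
move=> x _; rewrite (_ : F z o x = 0) ?sub0r ?sqrrN// /F.
by case: (unlift _ _).
Qed.

(** Upper semicontinuity for the L2 distance. The relative loss, the constant loss and the distance
    term each get a third of [e]; the added 1 in the denominators avoids dividing by 0. *)
Lemma energy_approx w t (e : R) : admissible_pair t -> 0 < e -> exists2 dl, 0 < dl &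
  forall t', admissible_pair t' ->
    (forall o, (\int[mu]_(x in D) ((F t o x - F t' o x) ^+ 2)%:E < dl%:E)%E) ->
    (E w t' <= E w t + e%:E)%E.
Proof.
move=> at_ e0; have fE := energy_fin w at_; have [t1 t2 t11] := at_.
pose A := fine (E w t); pose m := fine (mu D).
have A0 : 0 <= A.
  apply: fine_ge0; rewrite EE//; apply: integral_ge0 => x Dx; rewrite lee_fin.
  exact: (eint_ge0 Phi tau hW0 t.2 t11).
have m0 : 0 <= m by exact: fine_ge0.
have c0 : 0 < e / 3 / (A + 1) by rewrite !divr_gt0// ltr_wpDl.
have e10 : 0 < e / 3 / (m + 1) by rewrite !divr_gt0// ltr_wpDl.
have [K K0 hK] := energy_comparison c0 e10.
have B0 : 0 < K * d.+1%:R + 1 by rewrite ltr_wpDl// mulr_ge0.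
exists (e / 3 / (K * d.+1%:R + 1)); first by rewrite !divr_gt0.
move=> t' at' ht'; apply: (le_trans (hK w t t' at_ at')).
have hs : (\sum_o \int[mu]_(x in D) ((F t o x - F t' o x) ^+ 2)%:E <=
    (d.+1%:R * (e / 3 / (K * d.+1%:R + 1)))%:E)%E.
  apply: (@le_trans _ _ (\sum_(o < d.+1) (e / 3 / (K * d.+1%:R + 1))%:E)%E).
    by apply: lee_sum => o _; exact: ltW.
  by rewrite sumEFin sumr_const card_ord -[_ *+ d.+1]mulr_natl.
have hK2 : (K%:E * \sum_o \int[mu]_(x in D) ((F t o x - F t' o x) ^+ 2)%:E <=
    (e / 3)%:E)%E.
  apply: (le_trans (lee_wpmul2l _ hs)); first by rewrite lee_fin.
  rewrite -EFinM lee_fin.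
  have -> : K * (d.+1%:R * (e / 3 / (K * d.+1%:R + 1))) =
      (K * d.+1%:R * (e / 3)) / (K * d.+1%:R + 1) by ring.
  by rewrite ler_pdivrMr// mulrC ler_wpM2l ?divr_ge0 ?(ltW e0)// lerDl.
rewrite -(fineK fE) -(fineK finD) -!EFinM -!EFinD.
apply: (le_trans (leeD (lexx _) hK2)); rewrite -EFinD lee_fin -/A -/m.
have h1 : e / 3 / (A + 1) * A <= e / 3.
  rewrite mulrAC ler_pdivrMr ?ltr_wpDl// ler_wpM2l ?divr_ge0 ?(ltW e0)//; lra.
have h2 : e / 3 / (m + 1) * m <= e / 3.
  rewrite mulrAC ler_pdivrMr ?ltr_wpDl// ler_wpM2l ?divr_ge0 ?(ltW e0)//; lra.
rewrite mulrDl mul1r; lra.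
Qed.

(** The dense family is chosen before [w]. Upper semicontinuity, for each [w], is enough for the
    infimum over this family to be the infimum over [S]. *)
Lemma measurable_energy_inf (S : set T) : (forall t, S t -> admissible_pair t) ->
  measurable_fun setT (fun w => ereal_inf [set E w t | t in S]).
Proof.
move=> hS; have [->|S0] := eqVneq S set0.
  by under eq_fun do rewrite image_set0; exact: measurable_cst.
have /set0P S0' := S0.
have [J [c [Sc hc]]] := L2_dense_subfamily mD fD (fun t o St => sF o (hS t St)) S0'.
have -> : (fun w => ereal_inf [set E w t | t in S]) =
    fun w => ereal_inf [set E w (c j) | j in setT].
  apply/funext => w; apply/eqP; rewrite eq_le; apply/andP; split.
    apply: ereal_inf_le_tmp => _ [j _ <-]; exists (c j) => //; exact: Sc.
  apply: le_ereal_inf_tmp => _ [t St <-].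
  apply/lee_addgt0Pr => e e0.
  have [dl dl0 hdl] := energy_approx w (hS t St) e0.
  have [j hj] := hc t dl St dl0.
  apply: (le_trans _ (hdl (c j) (hS _ (Sc j)) hj)).
  by apply: ereal_inf_lbound; exists j.
apply: measurable_ereal_inf_count => j.
have [t1 t2 t11] := hS _ (Sc j).
apply: (measurable_energy hPhiF hPhim htaum hWc hW0 mD t1.1 _ t11) => i.
by have [] := t2 i.
Qed.

End energy_inf.

(** * Energy of the layer *)

Section tail.
Variable R : realType.
Notation leb := (@lebesgue_measure R).

Lemma lebesgue_itvcc (a b : R) : a <= b -> leb (`[a, b]%classic : set R) = (b - a)%:E.
Proof.
move=> ab; rewrite lebesgue_measure_itv/= lte_fin; case: ltP => [_|ba].
  by rewrite EFinB.
by have -> : b = a; [lra|rewrite subrr].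
Qed.

Lemma integral_indic_itvcc (a b : R) : a <= b ->
  (\int[leb]_s (\1_(`[a, b]%classic) s)%:E = (b - a)%:E)%E.
Proof. by move=> ab; rewrite integral_indic// setIT; exact: lebesgue_itvcc. Qed.

Lemma measurable_norm_ge (r : R) : measurable [set s : R | r <= `|s|].
Proof.
rewrite (_ : [set s | _] = (fun s => `|s|) @^-1` `[r, +oo[%classic).
  by rewrite -[X in measurable X]setTI; exact: (@normr_measurable _ setT).
by apply/seteqP; split => x /=; rewrite in_itv/= andbT.
Qed.

Lemma tail_integral (h : R -> R) (e : R) : measurable_fun setT h -> (forall s, 0 <= h s) ->
  (\int[leb]_s (h s)%:E < +oo)%E -> 0 < e ->
  exists r0, forall r, r0 <= r ->
    (\int[leb]_s (\1_[set s | r <= `|s|] s * h s)%:E <= e%:E)%E.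
Proof.
move=> mh h0 hoo e0.
have mI (r : R) : measurable_fun setT (fun s : R => (\1_[set s : R | r <= `|s|] s * h s)%:E).
  apply/measurable_EFinP; apply: measurable_funM => //.
  by apply: measurable_indic; exact: measurable_norm_ge.
have ih : leb.-integrable setT (EFin \o h).
  apply/integrableP; split; first exact/measurable_EFinP.
  by under eq_integral do rewrite /= ger0_norm//.
have := @dominated_cvg _ _ _ leb setT measurableT
  (fun k s => (\1_[set s | k%:R <= `|s|] s * h s)%:E) (cst 0%E) (EFin \o h).
rewrite integral0 => /(_ _ _ _ ih _) H.
have {}H : (\int[leb]_s (\1_[set s | k%:R <= `|s|] s * h s)%:E)%E @[k --> \oo] --> 0%E.
  apply: H => //.
  - by move=> k; exact: mI.
  - move=> s _; apply: cvg_near_cst; near=> k.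
    rewrite indicE memNset ?mul0r//=; apply/negP; rewrite -ltNge.
    by near: k; exact: nbhs_infty_gtr.
  - by move=> k s _ /=; rewrite lee_fin ger0_norm ?mulr_ge0// ler_piMl.
have /fine_cvgP[fk /cvgrPdist_lt/(_ _ e0) ck] := H.
near \oo => k; exists k%:R => r kr.
apply: (@le_trans _ _ (\int[leb]_s (\1_[set s | k%:R <= `|s|] s * h s)%:E)%E).
  apply: ge0_le_integral => //.
  - by move=> s _; rewrite lee_fin mulr_ge0.
  - exact: mI.
  - exact: mI.
  - move=> s _; rewrite lee_fin ler_wpM2r// !indicE ler_nat.
    have [rs|] := boolP (s \in [set s | r <= `|s|]); last by [].
    by rewrite mem_set//=; move: rs; rewrite inE/=; exact: le_trans.
have : `|0 - fine (\int[leb]_s (\1_[set s | k%:R <= `|s|] s * h s)%:E)| < e by near: k.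
rewrite sub0r normrN => /ltW/(le_trans (ler_norm _)).
by rewrite -lee_fin fineK//; near: k.
Unshelve. all: by end_near.
Qed.

End tail.

Lemma sqr_gap_le (R : realType) (z a a' dl : R) : `|z - a| < dl -> `|z - a'| < dl ->
  dl <= 1 -> (a' - a) ^+ 2 <= 4 * dl.
Proof. by rewrite !ltr_norml => /andP[z1 z2] /andP[z3 z4] dl1; nra. Qed.

Lemma scaled_gap_le (R : realType) (K X dl e : R) : 0 <= K -> 0 <= dl -> X <= 4 * dl ->
  dl * (8 * (K + 1)) <= e -> K * X <= e / 2.
Proof. by move=> K0 dl0 h1 h2; have := ler_wpM2l K0 h1; nra. Qed.

(** * The profile along the normal direction *)

Section profile.
Variables (R : realType) (W q : R -> R).
Hypothesis hWc : {within `[-1, 1], continuous W}.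
Hypothesis hW0 : forall s, -1 <= s <= 1 -> 0 <= W s.
Hypothesis hWz : forall s, -1 <= s <= 1 -> (W s = 0 <-> s = -1 \/ s = 1).
Hypothesis hqr : forall s, -1 <= q s <= 1.
Hypothesis hqs : forall k s, derivable (derive1n k q) s 1.
Hypothesis hqp : q s @[s --> +oo] --> (1 : R).
Hypothesis hqm : q s @[s --> -oo] --> (-1 : R).
Notation leb := (@lebesgue_measure R).
Variable Lam : R.
Hypothesis Lam0 : 0 < Lam.
Hypothesis hqE : (\int[leb]_(s in [set: R])
            ((Lam / 2) * (derive1 q s) ^+ 2 + W (q s))%:E < +oo)%E.

Lemma profile_continuous : continuous q.
Proof. exact: (C1_derive1n hqs 0). Qed.

Lemma profile_derive_continuous : continuous (derive1 q).
Proof.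
have [_ /(_ tt) [_ c]] := C1_derive1n hqs 1.
by rewrite (_ : derive1 q = 'D_1 q)//; apply/funext => s; rewrite derive1E.
Qed.

Let mq1 : measurable_fun setT (fun s => derive1 q s ^+ 2).
Proof. by apply: measurable_funX; exact: continuous_measurable_fun profile_derive_continuous. Qed.

Lemma profile_derive_int : (\int[leb]_s ((derive1 q s) ^+ 2)%:E < +oo)%E.
Proof.
have h : (\int[leb]_s ((Lam / 2)%:E * ((derive1 q s) ^+ 2)%:E) < +oo)%E.
  apply: le_lt_trans hqE; apply: ge0_le_integral => //.
  - by move=> s _; rewrite -EFinM lee_fin mulr_ge0 ?sqr_ge0 ?divr_ge0 ?(ltW Lam0).
  - by apply: measurable_funeM; exact/measurable_EFinP.
  - apply/measurable_EFinP; apply: measurable_funD; first exact: measurable_funM.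
    have mW : measurable_fun [set` `[-1, 1 : R]] W by exact: subspace_continuous_measurable_fun.
    apply: (measurable_comp (F := [set` `[-1, 1 : R]]) _ _ mW) => //.
      by move=> _ [x _ <-] /=; rewrite in_itv/= hqr.
    exact: continuous_measurable_fun profile_continuous.
  - by move=> s _; rewrite -EFinM lee_fin lerDl hW0.
move: h; rewrite ge0_integralZl_EFin//; last 3 first.
- by move=> s _; rewrite lee_fin sqr_ge0.
- exact/measurable_EFinP.
- by rewrite divr_ge0 ?(ltW Lam0).
set I := (\int[leb]_s _)%E; have I0 : (0 <= I)%E.
  by apply: integral_ge0 => s _; rewrite lee_fin sqr_ge0.
case: I I0 => [r| |//] _; first by move=> _; exact: ltry.
by rewrite gt0_muley ?lte_fin ?divr_gt0.
Qed.

(** The conditions on [t] say that it lies on the same side of 0 as [s] and at least as far, so one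
    well [z] serves the whole half-line beyond [s]. *)
Lemma profile_tail (dl : R) : 0 < dl -> exists2 S, 0 <= S & forall s, S < `|s| ->
  exists2 z, (z = 1 \/ z = -1) & forall t, 0 < s * t -> `|s| <= `|t| -> `|z - q t| < dl.
Proof.
move=> dl0.
have /cvgrPdist_lt/(_ _ dl0)[M1 [_ h1]] := hqp.
have /cvgrPdist_lt/(_ _ dl0)[M2 [_ h2]] := hqm.
exists (`|M1| + `|M2|) => [|s]; first by rewrite addr_ge0.
have [s0|s0] := ltP 0 s.
  rewrite (gtr0_norm s0) => h; exists 1; [by left|move=> t st].
  have t0 : 0 < t by rewrite -(pmulr_rgt0 _ s0).
  rewrite gtr0_norm// => h'; apply: h1.
  by apply: (le_lt_trans (ler_norm _)); have := normr_ge0 M2; lra.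
rewrite (ler0_norm s0) => h; exists (-1); [by right|move=> t st].
have s0' : s < 0 by rewrite lt_neqAle s0 andbT; apply: contraTneq st => ->; rewrite mul0r ltxx.
have t0 : t < 0 by rewrite -(nmulr_rgt0 _ s0').
rewrite ltr0_norm// => h'; apply: h2.
by have := ler_norm (- M2); rewrite normrN; have := normr_ge0 M1; lra.
Qed.

(** The point [s'] is [s] moved by |b| towards 0. Both [s] and [s - b] lie beyond it on the same
    side, so [profile_tail] gives them the same well. *)
Lemma away_from_zero (S b s : R) : 0 <= S -> S + `|b| < `|s| ->
  exists2 s', S < `|s'| & [/\ 0 < s' * s, `|s'| <= `|s|, 0 < s' * (s - b) & `|s'| <= `|s - b|].
Proof.
have b1 := ler_norm b; have b2 := ler_norm (- b); rewrite normrN in b2.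
have b3 := normr_ge0 b; move=> S0; have [s0|s0] := leP 0 s.
  rewrite (ger0_norm s0) => h; have p : 0 < s - `|b| by lra.
  exists (s - `|b|); rewrite (gtr0_norm p); first by lra.
  have p2 : 0 < s - b by lra.
  have p3 : 0 < s by lra.
  by rewrite (gtr0_norm p2); split; [exact: mulr_gt0|lra|exact: mulr_gt0|lra].
rewrite (ltr0_norm s0) => h; have p : s + `|b| < 0 by lra.
exists (s + `|b|); rewrite (ltr0_norm p); first by lra.
have p2 : s - b < 0 by lra.
by rewrite (ltr0_norm p2); split; [rewrite nmulr_rgt0|lra|rewrite nmulr_rgt0|lra].
Qed.

(** On a large interval the gap and the potential are bounded by constants, which are integrable
    there. Beyond it [q s] and [q (s - b)] are close to the same well, hence so is every
    interpolation, and both terms fall below [e / 2]. *)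
Lemma profile_bound (b K1 K2 e : R) : 0 <= K1 -> 0 <= K2 -> 0 < e ->
  exists h : R -> R, [/\ measurable_fun setT h, forall s, 0 <= h s,
    (\int[leb]_s (h s)%:E < +oo)%E &
    forall s theta, 0 <= theta <= 1 ->
      K1 * (derive1 q s ^+ 2 + derive1 q (s - b) ^+ 2) + K2 * (q (s - b) - q s) ^+ 2 +
      W (q s + theta * (q (s - b) - q s)) <= h s + e].
Proof.
have N11 : (-1 : R) <= 1 by lra.
move=> K10 K20 e0; have [M M0 hM] := potential_bound hWc hW0.
have e20 : 0 < e / 2 by rewrite divr_gt0.
have [dl0 dl00 hdl0] := potential_unif hWc e20.
(* The three bounds serve in turn the continuity of [W] at the wells, the inequality
   [(2 * dl) ^+ 2 <= 4 * dl], and [K2 * (4 * dl) <= e / 2]. *)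
pose dl := Num.min (dl0 / 2) (Num.min 1 (e / (8 * (K2 + 1)))).
have dlp : 0 < dl by rewrite !lt_min (divr_gt0 dl00)// ltr01 divr_gt0// mulr_gt0// ltr_wpDl.
have [dl1 dl2 dl3] : [/\ dl < dl0, dl <= 1 & dl <= e / (8 * (K2 + 1))].
  split; rewrite ?gt_min ?ge_min ?lexx ?orbT//.
  by rewrite ltr_pdivrMr// ltr_pMr// ltr1n.
have [S S0 hS] := profile_tail dlp.
pose S' := S + `|b| + 1.
have mh : measurable_fun setT (fun s => K1 * (derive1 q s ^+ 2 + derive1 q (s - b) ^+ 2)).
  apply: measurable_funM => //; apply: measurable_funD => //.
  have mb : measurable_fun setT (fun s : R => s - b) by exact: measurable_funB.
  exact: (measurableT_comp mq1 mb).
have mI : measurable_fun setT (fun s => (4 * K2 + M) * \1_(`[- S', S']%classic) s : R).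
  by apply: measurable_funM => //; exact: measurable_indic.
have C0 : 0 <= 4 * K2 + M by rewrite addr_ge0// mulr_ge0.
have h10 s : 0 <= K1 * (derive1 q s ^+ 2 + derive1 q (s - b) ^+ 2).
  by rewrite mulr_ge0// addr_ge0// sqr_ge0.
have interp s t theta : 0 <= theta <= 1 -> -1 <= q s + theta * (q t - q s) <= 1.
  by move=> /andP[th0 th1]; have := hqr s; have := hqr t; nra.
exists (fun s => K1 * (derive1 q s ^+ 2 + derive1 q (s - b) ^+ 2) +
  (4 * K2 + M) * \1_(`[- S', S']%classic) s); split.
- exact: measurable_funD.
- by move=> s; rewrite addr_ge0// mulr_ge0.
- under eq_integral do rewrite EFinD.
  rewrite ge0_integralD//; last 4 first.
  + by move=> s _; rewrite lee_fin.
  + exact/measurable_EFinP.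
  + by move=> s _; rewrite lee_fin mulr_ge0.
  + exact/measurable_EFinP.
  apply: lte_add_pinfty.
    under eq_integral do rewrite EFinM EFinD.
    rewrite ge0_integralZl_EFin//; last 2 first.
    * by move=> s _; rewrite -EFinD lee_fin addr_ge0// sqr_ge0.
    * apply: emeasurable_funD; first exact/measurable_EFinP.
      have mb : measurable_fun setT (fun s : R => s - b) by exact: measurable_funB.
      by apply/measurable_EFinP; exact: (measurableT_comp mq1 mb).
    rewrite lte_mul_pinfty//.
    rewrite ge0_integralD//; last 4 first.
    * by move=> s _; rewrite lee_fin sqr_ge0.
    * exact/measurable_EFinP.
    * by move=> s _; rewrite lee_fin sqr_ge0.
    * have mb : measurable_fun setT (fun s : R => s - b) by exact: measurable_funB.
      by apply/measurable_EFinP; exact: (measurableT_comp mq1 mb).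
    have /= -> := @ge0_integral_lebesgue_shift R (- b) (fun s => ((derive1 q s) ^+ 2)%:E).
    * by apply: lte_add_pinfty; exact: profile_derive_int.
    * exact/measurable_EFinP.
    * by move=> s; rewrite lee_fin sqr_ge0.
  under eq_integral do rewrite EFinM.
  rewrite ge0_integralZl_EFin//; last exact/measurable_EFinP/measurable_indic.
  have SS : - S' <= S' by rewrite /S'; have := normr_ge0 b; lra.
  by rewrite lte_mul_pinfty//; have -> := integral_indic_itvcc SS; rewrite ltry.
- move=> s theta th; rewrite -addrA -[leRHS]addrA lerD2l indicE.
  have := interp s (s - b) theta th; set t := q s + _ => ht.
  have [sS|sS] := boolP (s \in `[- S', S']%classic).
    rewrite mulr1; apply: (@le_trans _ _ (4 * K2 + M)); last by rewrite lerDl ltW.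
    (* Two values of [q] differ by at most 2, whence the factor 4. *)
    apply: lerD; last exact: hM.
    rewrite mulrC ler_wpM2r//; have := hqr s; have := hqr (s - b).
    by move: (q _) (q _) => x y; nra.
  rewrite mulr0 add0r.
  have {}sS : S' < `|s|.
    by move: sS; rewrite notin_setE/= in_itv/= -ler_norml => /negP; rewrite -ltNge.
  have [s' s's [bs1 bs2 bs3 bs4]] : exists2 s', S < `|s'| & [/\ 0 < s' * s, `|s'| <= `|s|,
      0 < s' * (s - b) & `|s'| <= `|s - b|].
    by apply: away_from_zero => //; apply: le_lt_trans sS; rewrite /S' lerDl.
  have [z hz hq] := hS _ s's.
  have z1 := hq _ bs1 bs2; have z2 := hq _ bs3 bs4.
  have zt : `|z - t| <= dl.
    move: (ltW z1) (ltW z2) th; rewrite /t !ler_norml.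
    move: (q s) (q (s - b)) => a a' /andP[z3 z4] /andP[z5 z6] /andP[th0 th1].
    by clear -z3 z4 z5 z6 th0 th1; apply/andP; split; nra.
  have z11 : -1 <= z <= 1 by case: hz => ->; rewrite lexx N11.
  have Wz : W z = 0 by apply/hWz => //; case: hz => ->; [right|left].
  have := hdl0 _ _ z11 ht (le_lt_trans zt dl1); rewrite Wz add0r => hW.
  rewrite [leRHS]splitr; apply: lerD; last exact: hW.
  have h5 : dl * (8 * (K2 + 1)) <= e by rewrite -ler_pdivlMr// mulr_gt0// ltr_wpDl.
  exact: (scaled_gap_le K20 (ltW dlp) (sqr_gap_le z1 z2 dl2) h5).
Qed.

End profile.

(** The usual bound [n * r' ^+ (n - 1) * (r' - r)], with [r'] as a denominator so that [n = 0] needs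
    no special exponent. *)
Lemma power_gap (R : realType) (r r' : R) n : 0 < r' -> 0 <= r <= r' ->
  r' ^+ n - r ^+ n <= r' ^+ n * (n%:R * (r' - r) / r').
Proof.
move=> r'0 /andP[r0 rr']; elim: n => [|n IH]; first by rewrite !expr0 subrr !mul0r mulr0.
have -> : r' ^+ n.+1 - r ^+ n.+1 = r' ^+ n * (r' - r) + r * (r' ^+ n - r ^+ n) by rewrite !exprS; ring.
have p0 : 0 <= r' ^+ n by rewrite exprn_ge0// ltW.
have h : r * (r' ^+ n - r ^+ n) <= r' * (r' ^+ n * (n%:R * (r' - r) / r')).
  apply: le_trans (_ : r' * (r' ^+ n - r ^+ n) <= _); last by rewrite ler_wpM2l// ltW.
  by rewrite ler_wpM2r// subr_ge0 lerXn2r// nnegrE// ltW.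
apply: (le_trans (lerD (lexx _) h)); rewrite le_eqVlt; apply/orP; left; apply/eqP.
by rewrite exprS -natr1; field; rewrite gt_eqF.
Qed.

(** * Slicing the layer orthogonally to [e] *)

Section slices.
Variables (R : realType) (n : nat) (f : 'I_n.+1 -> 'rV[R]_n.+1).
Hypothesis hf : forall i j, dotp (f i) (f j) = (i == j)%:R.
Notation leb := (@lebesgue_measure R).

Definition box (r : R) := obox f (strip_rho r).

Definition layer (x : 'rV[R]_n.+1) (r r' : R) := box r' `\` [set y | box r (y - x)].

Lemma measurable_box_shift x r : measurable [set y | box r (y - x)].
Proof.
have := measurable_addv (- x) measurableT (measurable_obox f (strip_rho r)).
by rewrite setTI.
Qed.

Lemma measurable_layer x r r' : measurable (layer x r r').
Proof. by apply: measurableD; [exact: measurable_obox|exact: measurable_box_shift]. Qed.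

(* The weight bounds the n-dimensional measure of the slice {<y,e> = s} of the layer,
   relative to r'^n: the full slice near the two ends, a thin frame in between. *)
Definition layer_weight (b r r' : R) (s : R) : R :=
  \1_[set s | `|s| < r'] s * (\1_[set s | r <= `|s - b|] s + n%:R * (r' - r) / r').

Lemma layer_weight_ge0 b r r' s : 0 < r' -> r <= r' -> 0 <= layer_weight b r r' s.
Proof.
move=> r'0 rr'; rewrite mulr_ge0// addr_ge0// divr_ge0 ?(ltW r'0)// mulr_ge0// subr_ge0//.
Qed.

Lemma measurable_layer_weight b r r' : measurable_fun setT (layer_weight b r r').
Proof.
have m1 : measurable [set s : R | `|s| < r'].
  by apply: (@measurable_ballR R id 0) => x; rewrite subr0.
have m2 : measurable [set s : R | r <= `|s - b|].
  have mb : measurable_fun setT (fun s : R => s - b) by exact: measurable_funB.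
  by have := mb measurableT _ (measurable_norm_ge r); rewrite setTI.
apply: measurable_funM; first exact: measurable_indic.
by apply: measurable_funD => //; exact: measurable_indic.
Qed.

Lemma layer_slices : exists2 c, 0 <= c & forall x (r r' : R) (h : R -> R),
  measurable_fun setT h -> (forall s, 0 <= h s) -> 0 < r ->
  (forall j, strip_rho r j + `|dotp x (f j)| <= strip_rho r' j) ->
  (\int[vmu R n.+1]_(y in layer x r r') (h (dotp y (f ord0)))%:E <=
   (c * r' ^+ n)%:E * \int[leb]_s (h s * layer_weight (dotp x (f ord0)) r r' s)%:E)%E.
Proof.
have [c [c0 hc]] := vmu_linear_change (frame_mx_orthT hf) (frame_mx_orth hf).
exists c => // x r r' h mh h0 r0 rr'.
pose b := dotp x (f ord0); pose xi := \row_j dotp x (f (lift ord0 j)) : 'rV[R]_n.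
have rr1 : r + `|b| <= r' by have := rr' ord0; rewrite /strip_rho unlift_none.
have rr2 j : r / 2 + `|xi 0 j| <= r' / 2.
  by have := rr' (lift ord0 j); rewrite /strip_rho liftK mxE.
have rler' : r <= r' by have := normr_ge0 b; lra.
have r'0 : 0 < r' by lra.
pose A : set 'rV[R]_n.+1 := [set a | (forall j, `|a 0 j| < strip_rho r' j) /\
  ~ (forall j, `|a 0 j - dotp x (f j)| < strip_rho r j)].
have mA : measurable A.
  have mb (z : R) j (t : R) : measurable [set a : 'rV[R]_n.+1 | `|a 0 j - z| < t].
    have := @measurable_ballR R (fun x => x - z) z t (fun=> erefl).
    by move=> /(@measurable_coord R n.+1 j measurableT); rewrite setTI.
  rewrite (_ : A = [set a | forall j, `|a 0 j - 0| < strip_rho r' j] `\`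
      [set a | forall j, `|a 0 j - dotp x (f j)| < strip_rho r j]).
    by apply: measurableD; apply: measurable_forall_ord => j; exact: mb.
  by apply/seteqP; split => a /= [h1 h2]; split => // j; have := h1 j; rewrite subr0.
pose F (a : 'rV[R]_n.+1) := (\1_A a * h (a 0 ord0))%:E.
have mF : measurable_fun setT F.
  apply/measurable_EFinP; apply: measurable_funM; first exact: measurable_indic.
  exact: (measurableT_comp mh (@measurable_coord R n.+1 ord0)).
have F0 a : (0 <= F a)%E by rewrite lee_fin mulr_ge0.
have LA y : layer x r r' y <-> A (y *m (frame_mx f)^T).
  split=> -[h1 h2]; split.
  - by move=> j; rewrite frame_mxT.
  - by move=> h3; apply: h2 => j; rewrite dotpBl; have := h3 j; rewrite frame_mxT.
  - by move=> j; have := h1 j; rewrite frame_mxT.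
  - by move=> h3; apply: h2 => j; rewrite frame_mxT -dotpBl; exact: h3.
have -> : (\int[vmu R n.+1]_(y in layer x r r') (h (dotp y (f ord0)))%:E =
    \int[vmu R n.+1]_y F (y *m (frame_mx f)^T))%E.
  rewrite integral_mkcond; apply: eq_integral => y _; rewrite patchE /F indicE.
  have [Ly|Ly] := boolP (y \in layer x r r').
    rewrite mem_set ?mul1r ?frame_mxT//; apply/LA; exact: set_mem.
  by rewrite memNset ?mul0r// => /LA Ly'; move/negP: Ly; apply; exact: mem_set.
rewrite hc// integral_vmuS// EFinM -muleA; apply: lee_wpmul2l; first by rewrite lee_fin.
have mw := measurable_layer_weight b r r'.
have w0 s := layer_weight_ge0 b s r'0 rler'.
rewrite -ge0_integralZl_EFin//; last 3 first.
- by move=> s _; rewrite lee_fin mulr_ge0.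
- by apply/measurable_EFinP; exact: measurable_funM.
- by rewrite exprn_ge0// ltW.
apply: ge0_le_integral => //.
- by move=> s _; exact: integral_ge0.
- apply: (@measurable_section_int R n _ (measurableTypeR R) (fun p => F (row_cons p.1 p.2))) => //.
  exact: (measurableT_comp mF (@measurable_row_cons R n)).
- by apply: measurable_funeM; apply/measurable_EFinP; exact: measurable_funM.
move=> s _.
pose V' := vcube (0 : 'rV[R]_n) (r' / 2); pose V := vcube xi (r / 2).
have mV' : measurable V' by exact: measurable_vcube.
have mV : measurable V by exact: measurable_vcube.
have VV' : V `<=` V'.
  move=> a ha i; rewrite mxE subr0.
  have := ha i; have := rr2 i; have := ler_normD (a 0 i - xi 0 i) (xi 0 i).
  by rewrite subrK; lra.
have r2' : r' / 2 * 2 = r' by rewrite mulfVK.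
have r2 : r / 2 * 2 = r by rewrite mulfVK.
have mu' : vmu R n V' = (r' ^+ n)%:E by rewrite vmu_cube ?r2'// divr_gt0.
have muV : vmu R n V = (r ^+ n)%:E by rewrite vmu_cube ?r2// divr_gt0.
have muD : vmu R n (V' `\` V) = (r' ^+ n - r ^+ n)%:E.
  have VE : V' `&` V = V by apply/seteqP; split => [a []//|a Va]; split => //; exact: VV'.
  have fV' : (vmu R n V' < +oo)%E by rewrite mu' ltry.
  by rewrite EFinB -mu' -muV -[in RHS]VE; exact: measureD.
pose i1 := \1_[set s : R | `|s| < r'] s : R; pose i2 := \1_[set s : R | r <= `|s - b|] s : R.
have i10 : 0 <= i1 by []. have i20 : 0 <= i2 by [].
(* At height [s] a point of the layer is either beyond the ends of the shifted box, where the slice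
   may be all of [V'], or between them, where the slice avoids [V]. *)
apply: (@le_trans _ _ (\int[vmu R n]_a
   (((i1 * i2 * h s)%:E * (\1_V' a)%:E) + (i1 * h s)%:E * (\1_(V' `\` V) a)%:E))%E).
  apply: ge0_le_integral => //.
  - apply: (measurableT_comp mF).
    exact: (measurableT_comp (@measurable_row_cons R n) (@pair1_measurable _ _ (measurableTypeR R) _ s)).
  - by apply: emeasurable_funD; apply: measurable_funeM; apply/measurable_EFinP;
      apply: measurable_indic => //; exact: measurableD.
  move=> a _; rewrite /F row_cons0 -!EFinM -EFinD lee_fin.
  rewrite [\1_A _]indicE; have [hA|_] := boolP (_ \in A); last first.
    by rewrite mul0r addr_ge0// mulr_ge0// mulr_ge0// mulr_ge0.
  rewrite mul1r; move: hA => /set_mem[hA1 hA2].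
  have -> : i1 = 1.
    by rewrite /i1 indicE mem_set//=; have := hA1 ord0; rewrite row_cons0 /strip_rho unlift_none.
  have aV' : V' a.
    by move=> i; rewrite mxE subr0; have := hA1 (lift ord0 i); rewrite row_consS /strip_rho liftK.
  rewrite !mul1r [\1_V' _]indicE mem_set// mulr1.
  have [hs|hs] := leP r `|s - b|.
    have -> : i2 = 1 by rewrite /i2 indicE mem_set.
    by rewrite mul1r lerDl mulr_ge0.
  rewrite [\1_(V' `\` V) _]indicE mem_set ?mulr1 ?lerDr ?mulr_ge0//.
  split => // aV; apply: hA2 => j; case: (unliftP ord0 j) => [i ->|->].
    by rewrite row_consS /strip_rho liftK; have := aV i; rewrite mxE.
  by rewrite row_cons0 /strip_rho unlift_none.
rewrite ge0_integralD//; last 4 first.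
- by move=> a _; rewrite -EFinM lee_fin mulr_ge0// mulr_ge0// mulr_ge0.
- by apply: measurable_funeM; apply/measurable_EFinP; exact: measurable_indic.
- by move=> a _; rewrite -EFinM lee_fin mulr_ge0// mulr_ge0.
- apply: measurable_funeM; apply/measurable_EFinP; apply: measurable_indic.
  exact: measurableD.
rewrite !ge0_integralZl_EFin//; last 4 first.
- apply/measurable_EFinP; apply: measurable_indic; exact: measurableD.
- by rewrite mulr_ge0.
- by apply/measurable_EFinP; exact: measurable_indic.
- by rewrite mulr_ge0// mulr_ge0.
rewrite -!vmuE//; last exact: measurableD.
rewrite mu' muD -!EFinM -EFinD lee_fin /layer_weight -/i1 -/i2.
have r00 : 0 <= r <= r' by rewrite (ltW r0).
have hp := ler_wpM2l (mulr_ge0 i10 (h0 s)) (@power_gap R r r' n r'0 r00).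
apply: (le_trans (lerD (lexx _) hp)).
by rewrite le_eqVlt; apply/orP; left; apply/eqP; ring.
Qed.

End slices.

Section layer_weight_integral.
Variables (R : realType) (n : nat).
Notation leb := (@lebesgue_measure R).

(** Five contributions: the tail of [h] near the ends and the frame term [k * H], at most [e] each;
    [e] on two end intervals of length at most [C + |b|]; and [e * k] on an interval of length
    [2 * r'], which gives [2 * (n * C)] because [k = n * C / r']. *)
Lemma layer_weight_integral (h : R -> R) (b C e : R) : measurable_fun setT h ->
  (forall s, 0 <= h s) -> (\int[leb]_s (h s)%:E < +oo)%E -> 0 < e ->
  exists2 r0, 0 < r0 & forall r r', r0 <= r -> r + `|b| <= r' -> r' <= r + C ->
    (\int[leb]_s ((h s + e) * layer_weight n b r r' s)%:E <=
     (e * (2 + 2 * (C + `|b|) + 2 * (n%:R * C)))%:E)%E.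
Proof.
move=> mh h0 hoo e0; have [r1 hr1] := tail_integral mh h0 hoo e0.
pose H := fine (\int[leb]_s (h s)%:E)%E.
have HE : (\int[leb]_s (h s)%:E = H%:E)%E.
  by rewrite fineK// ge0_fin_numE//; apply: integral_ge0 => s _; rewrite lee_fin.
have H0 : 0 <= H by apply: fine_ge0; apply: integral_ge0 => s _; rewrite lee_fin.
(* The first terms put [r - |b|] beyond the tail threshold [r1]; the last one ensures
   [k * H <= e]. *)
pose r0 := `|r1| + `|b| + 1 + n%:R * `|C| * H / e.
have nCH : 0 <= n%:R * `|C| * H / e by rewrite divr_ge0 ?(ltW e0)// !mulr_ge0.
exists r0; first by rewrite /r0; have := normr_ge0 r1; have := normr_ge0 b; lra.
move=> r r' r0r brr' r'C.
have e0' := ltW e0; have b0 := normr_ge0 b; have n0 : 0 <= n%:R :> R by [].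
have r1r : r1 <= r - `|b| by have := ler_norm r1; move: r0r; rewrite /r0; lra.
have rb0 : 0 < r - `|b| by have := normr_ge0 r1; move: r0r; rewrite /r0; lra.
have r'0 : 0 < r' by lra.
have rr' : r <= r' by lra.
have CC : `|C| = C by apply: ger0_norm; lra.
have hk : n%:R * C * H / r' <= e.
  rewrite ler_pdivrMr// [e * r']mulrC -ler_pdivrMr//; move: r0r; rewrite /r0 CC.
  by have := normr_ge0 r1; lra.
pose k := n%:R * C / r'.
have k0 : 0 <= k by rewrite divr_ge0 ?(ltW r'0)// mulr_ge0// -CC.
pose I1 : R -> R := \1_[set s | r - `|b| <= `|s|].
pose I2 : R -> R := \1_(`[r - `|b|, r']%classic).
pose I3 : R -> R := \1_(`[- r', - (r - `|b|)]%classic).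
pose I4 : R -> R := \1_(`[- r', r']%classic).
have mI1 : measurable_fun setT I1 by apply: measurable_indic; exact: measurable_norm_ge.
have mI2 : measurable_fun setT I2 by exact: measurable_indic.
have mI3 : measurable_fun setT I3 by exact: measurable_indic.
have mI4 : measurable_fun setT I4 by exact: measurable_indic.
have I10 s : 0 <= I1 s by []. have I20 s : 0 <= I2 s by [].
have I30 s : 0 <= I3 s by []. have I40 s : 0 <= I4 s by [].
have t2 s : 0 <= e * I2 s := mulr_ge0 e0' (I20 s).
have t3 s : 0 <= e * I3 s := mulr_ge0 e0' (I30 s).
have t4 s : 0 <= e * k * I4 s := mulr_ge0 (mulr_ge0 e0' k0) (I40 s).
have pw s : (h s + e) * layer_weight n b r r' s <=
    I1 s * h s + k * h s + (e * I2 s + e * I3 s + e * k * I4 s).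
  have hs := h0 s.
  have kl : n%:R * (r' - r) / r' <= k by rewrite ler_pM2r ?invr_gt0// ler_wpM2l//; clear -r'C; lra.
  have kl0 : 0 <= n%:R * (r' - r) / r' by rewrite divr_ge0 ?(ltW r'0)// mulr_ge0// subr_ge0.
  rewrite /layer_weight [\1_[set _ | _ < r'] _]indicE.
  have [/set_mem/= sr'|_] := boolP (_ \in [set s | `|s| < r']); last first.
    rewrite mul0r mulr0; apply: addr_ge0; first by rewrite addr_ge0// mulr_ge0.
    by apply: addr_ge0; [apply: addr_ge0|]; rewrite mulr_ge0// mulr_ge0.
  have I4s : I4 s = 1.
    by rewrite /I4 indicE mem_set//=; rewrite in_itv/= -ler_norml ltW.
  rewrite mul1r I4s indicE.
  have kk : (h s + e) * (n%:R * (r' - r) / r') <= k * h s + e * k.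
    by rewrite [e * k]mulrC -mulrDr mulrC ler_wpM2r// addr_ge0// ltW.
  have [/set_mem/= sb|_] := boolP (_ \in [set s | r <= `|s - b|]); last first.
    rewrite add0r mulr1; have : 0 <= I1 s * h s by rewrite mulr_ge0.
    have : 0 <= e * I2 s by rewrite mulr_ge0// ltW.
    have : 0 <= e * I3 s by rewrite mulr_ge0// ltW.
    by clear -kk; lra.
  (* Points near the ends of the shifted box are far from 0, hence in the tail of [h]. *)
  have sb' : r - `|b| <= `|s| by have := ler_normB s b; clear -sb; lra.
  have I1s : I1 s = 1 by rewrite /I1 indicE mem_set.
  have I23 : 1 <= I2 s + I3 s.
    rewrite /I2 /I3 !indicE; have [s0|s0] := leP 0 s.
      rewrite [s \in _](_ : _ = true) ?lerDl//; apply: mem_set => /=.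
      by rewrite in_itv/= -(ger0_norm s0) sb' (ltW sr').
    rewrite [X in _ <= _ + X](_ : _ = 1) ?lerDr// mem_set//= in_itv/=.
    by clear -sb' sr' s0; move: sb' sr'; rewrite (ltr0_norm s0); lra.
  rewrite I1s mulrDr mulr1 mul1r mulr1.
  have : e <= e * I2 s + e * I3 s by rewrite -mulrDr ler_peMr// ltW.
  by clear -kk; lra.
apply: (@le_trans _ _ (\int[leb]_s ((I1 s * h s)%:E + k%:E * (h s)%:E +
   (e%:E * (I2 s)%:E + e%:E * (I3 s)%:E + (e * k)%:E * (I4 s)%:E)))%E).
  apply: ge0_le_integral => //.
  - move=> s _; rewrite lee_fin mulr_ge0//; first by rewrite addr_ge0// ltW.
    exact: layer_weight_ge0.
  - apply/measurable_EFinP; apply: measurable_funM; first exact: measurable_funD.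
    exact: measurable_layer_weight.
  - apply: emeasurable_funD.
      by apply: emeasurable_funD; [|apply: measurable_funeM]; apply/measurable_EFinP => //;
        exact: measurable_funM.
    by apply: emeasurable_funD; [apply: emeasurable_funD|];
      apply: measurable_funeM; apply/measurable_EFinP.
  - by move=> s _; rewrite -!EFinM -!EFinD lee_fin.
rewrite ge0_integralD//; last 4 first.
- by move=> s _; rewrite -EFinM -EFinD lee_fin addr_ge0// mulr_ge0.
- by apply: emeasurable_funD; [|apply: measurable_funeM]; apply/measurable_EFinP => //;
    exact: measurable_funM.
- move=> s _; rewrite -!EFinM -!EFinD lee_fin.
  exact: (addr_ge0 (addr_ge0 (t2 s) (t3 s)) (t4 s)).
- by apply: emeasurable_funD; [apply: emeasurable_funD|];
    apply: measurable_funeM; apply/measurable_EFinP.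
rewrite ge0_integralD//; last 4 first.
- by move=> s _; rewrite lee_fin mulr_ge0.
- by apply/measurable_EFinP; exact: measurable_funM.
- by move=> s _; rewrite -EFinM lee_fin mulr_ge0.
- by apply: measurable_funeM; apply/measurable_EFinP.
rewrite ge0_integralD//; last 4 first.
- move=> s _; rewrite -!EFinM -!EFinD lee_fin.
  exact: (addr_ge0 (t2 s) (t3 s)).
- by apply: emeasurable_funD; apply: measurable_funeM; apply/measurable_EFinP.
- by move=> s _; rewrite -EFinM lee_fin; exact: (t4 s).
- by apply: measurable_funeM; apply/measurable_EFinP.
rewrite ge0_integralD//; last 4 first.
- by move=> s _; rewrite -EFinM lee_fin; exact: (t2 s).
- by apply: measurable_funeM; apply/measurable_EFinP.
- by move=> s _; rewrite -EFinM lee_fin; exact: (t3 s).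
- by apply: measurable_funeM; apply/measurable_EFinP.
have ek0 : 0 <= e * k by rewrite mulr_ge0.
have iI (g : R -> R) (c m : R) : measurable_fun setT g -> (forall s, 0 <= g s) -> 0 <= c ->
    (\int[leb]_s (g s)%:E = m%:E -> \int[leb]_s (c%:E * (g s)%:E) = (c * m)%:E)%E.
  move=> mg g0 c0 gm; rewrite ge0_integralZl_EFin//; first by have -> := gm.
  - by move=> s _; rewrite lee_fin.
  - exact/measurable_EFinP.
have le2 : r - `|b| <= r' by clear -rr' b0; lra.
have le3 : - r' <= - (r - `|b|) by rewrite lerN2.
have le4 : - r' <= r' by clear -r'0; lra.
have -> := iI h k H mh h0 k0 HE.
have -> := iI I2 e _ mI2 _ e0' (integral_indic_itvcc le2) => //.
have -> := iI I3 e _ mI3 _ e0' (integral_indic_itvcc le3) => //.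
have -> := iI I4 (e * k) _ mI4 _ ek0 (integral_indic_itvcc le4) => //.
apply: (@le_trans _ _ (e%:E + (k * H)%:E + ((e * (r' - (r - `|b|)))%:E +
    (e * (- (r - `|b|) - - r'))%:E + (e * k * (r' - - r'))%:E))%E).
  by rewrite leeD// leeD// hr1.
rewrite -!EFinD lee_fin.
have -> : k * H = n%:R * C * H / r' by rewrite /k; ring.
have -> : e * k * (r' - - r') = e * (2 * (n%:R * C)).
  by rewrite /k; field; rewrite gt_eqF.
have h1 : e * (r' - (r - `|b|)) <= e * (C + `|b|) by rewrite ler_wpM2l//; clear -r'C; lra.
have h2 : e * (- (r - `|b|) - - r') <= e * (C + `|b|) by rewrite ler_wpM2l//; clear -r'C; lra.
by clear -hk h1 h2; rewrite !mulrDr; move: hk h1 h2; rewrite !mulrDr; lra.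
Qed.

End layer_weight_integral.

(** * The interpolating competitor and its energy on the layer *)

Section competitor.
Variables (R : realType) (n : nat) (f : 'I_n.+1 -> 'rV[R]_n.+1).
Hypothesis hf : forall i j, dotp (f i) (f j) = (i == j)%:R.
Variable q : R -> R.
Hypothesis hqr : forall s, -1 <= q s <= 1.
Hypothesis hqs : forall k s, derivable (derive1n k q) s 1.
Notation e := (f ord0).

Definition planar (y : 'rV[R]_n.+1) : R := q (dotp y e).

Let affine i (h : R) (x : 'rV[R]_n.+1) :
  dotp (h *: (delta_mx 0 i : 'rV[R]_n.+1) + x) e = h * e 0 i + dotp x e.
Proof. by rewrite dotpDl dotpZl dotp_delta. Qed.

Lemma smooth_planar : smooth planar.
Proof.
apply/smoothP => k.
apply: (@Ck_comp_affine R 'rV[R]_n.+1 'I_n.+1 _ k q (fun y => dotp y e) (fun i => e 0 i)).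
- exact: dotp_continuous.
- by move=> i h x; exact: affine.
- exact: C1_derive1n.
Qed.

Lemma pd_planar i y : pd i planar y = e 0 i * derive1 q (dotp y e).
Proof.
have := @derive_comp_affine R 'rV[R]_n.+1 q (fun y => dotp y e) (delta_mx 0 i) (e 0 i) y.
by move=> /(_ (fun h x => affine i h x) (@hqs 0%N (dotp y e)))[_]; rewrite derive1E.
Qed.

Variables (x : 'rV[R]_n.+1) (r : R).
(** The box is enlarged by 1 and the slope is 1, so the cutoff equals 1 on the translate of
    [box f r] and falls to 0 within unit depth, whatever the radius. *)
Definition shift_cutoff (y : 'rV[R]_n.+1) : R :=
  cutoff f 1 (fun j => strip_rho r j + 1) (y - x).
Definition competitor (y : 'rV[R]_n.+1) : R :=
  planar y + shift_cutoff y * (planar (y - x) - planar y).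

Lemma smooth_shift_cutoff : smooth shift_cutoff.
Proof. exact: (smooth_translate (- x) (smooth_cutoff f 1 _)). Qed.

Let sQ := smooth_planar.
Let sQx : smooth (fun y => planar (y - x)) := smooth_translate (- x) sQ.

Lemma smooth_competitor : smooth competitor.
Proof. exact: (smoothD sQ (smoothM smooth_shift_cutoff (smoothB sQx sQ))). Qed.

Lemma shift_cutoff01 y : 0 <= shift_cutoff y <= 1. Proof. exact: cutoff01. Qed.

Lemma competitor_in y : box f r (y - x) -> competitor y = planar (y - x).
Proof.
move=> hy; rewrite /competitor /shift_cutoff cutoff_eq1//.
  by rewrite mul1r addrC subrK.
by move=> j; rewrite invr1 addrK; exact/ltW/hy.
Qed.

Lemma near_box y : box f r (y - x) -> \forall z \near y, box f r (z - x).
Proof.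
move=> hy.
apply: (@filter_forall 'rV[R]_n.+1 _ (fun j z => `|dotp (z - x) (f j)| < strip_rho r j)
  _ (nbhs_filter y)) => j.
have c := @Ck_translate R 'rV[R]_n.+1 unit (fun=> 0) 0 _ (- x) (@dotp_continuous R n.+1 (f j)).
have N : nbhs (dotp (y - x) (f j)) [set t | `|t| < strip_rho r j].
  exact: (@norm_continuous R R (dotp (y - x) (f j)) _ (lt_nbhsl (hy j))).
exact: (c y _ N).
Qed.

Lemma pd_competitor_in y i : box f r (y - x) -> pd i competitor y = pd i planar (y - x).
Proof.
move=> hy; rewrite -pd_translate; apply: near_eq_derive.
by apply: filterS (near_box hy) => z; exact: competitor_in.
Qed.

Lemma competitor11 y : -1 <= competitor y <= 1.
Proof.
rewrite /competitor /planar; have := shift_cutoff01 y; have := hqr (dotp y e).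
have := hqr (dotp (y - x) e); move: (q _) (q _) (shift_cutoff _) => a b t.
by move=> /andP[a1 a2] /andP[b1 b2] /andP[t0 t1]; apply/andP; split; nra.
Qed.

Lemma test_competitor r' : (forall j, strip_rho r j + 1 + `|dotp x (f j)| < strip_rho r' j) ->
  test_fun (box f r') (fun y => competitor y - planar y).
Proof.
move=> rr'.
have -> : (fun y => competitor y - planar y) =
    fun y => (planar (y - x) - planar y) * shift_cutoff y.
  by apply/funext => y; rewrite /competitor [_ + _ * _]addrC addrK mulrC.
apply: (test_fun_mulr (smoothB sQx sQ)).
apply: (test_funS _ (test_fun_translate x
  (test_cutoff hf ltr01 (_ : forall j, _ < strip_rho r' j - `|dotp x (f j)|)))); last first.
  by move=> j; have := rr' j; lra.
move=> y /= hy j; have := hy j; rewrite dotpBl.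
by have := ler_normD (dotp y (f j) - dotp x (f j)) (dotp x (f j)); rewrite subrK; lra.
Qed.

Lemma pd_competitor_sqr (B s b : R) i y : (forall t : R, `|'D_1 (@step R) t| <= B) ->
  s = dotp y e -> b = dotp x e ->
  pd i competitor y ^+ 2 <= 3 * (derive1 q s ^+ 2 + derive1 q (s - b) ^+ 2) +
    3 * ((n.+1 * 2)%:R * B) ^+ 2 * (q (s - b) - q s) ^+ 2.
Proof.
move=> hB sE bE.
have hz : `|pd i shift_cutoff y| <= (n.+1 * 2)%:R * B.
  rewrite /shift_cutoff pd_translate -[B]mul1r; exact: pd_cutoff_bound.
rewrite /competitor (pdD _ _ sQ (smoothM smooth_shift_cutoff (smoothB sQx sQ))).
rewrite (pdM _ _ smooth_shift_cutoff (smoothB sQx sQ)) (pdB _ _ sQx sQ).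
rewrite pd_translate !pd_planar /planar !dotpBl -sE -bE.
have := shift_cutoff01 y; have := frame_coord_le1 hf i ord0.
move: hz; set z := pd i _ _; set K := _ * B; set ze := shift_cutoff _; set c := e 0 i.
move: (derive1 q s) (derive1 q (s - b)) (q (s - b) - q s) => A A' D hz hc /andP[z0 z1].
have c2 : c ^+ 2 <= 1 by rewrite -real_normK ?num_real// expr_le1.
have z2 : z ^+ 2 <= K ^+ 2.
  rewrite -real_normK ?num_real// ler_pXn2r ?nnegrE//; exact: le_trans hz.
(* The gradient is a convex combination of the two profile gradients plus the cutoff gradient times
   the gap; the square of three terms costs the factor 3. *)
have -> : c * A + (ze * (c * A' - c * A) + z * D) = (1 - ze) * (c * A) + ze * (c * A') + z * D.
  by ring.
have h3 u v t : (u + v + t) ^+ 2 <= 3 * u ^+ 2 + 3 * v ^+ 2 + 3 * t ^+ 2 :> R.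
  have := sqr_ge0 (u - v); have := sqr_ge0 (u - t); have := sqr_ge0 (v - t); nra.
apply: (le_trans (h3 _ _ _)).
have g1 t a : 0 <= t -> t <= 1 -> (t * (c * a)) ^+ 2 <= a ^+ 2.
  move=> t0 t1; rewrite !exprMn mulrA ler_piMl ?sqr_ge0//.
  by rewrite mulr_ile1 ?sqr_ge0// expr_le1.
have h1 : ((1 - ze) * (c * A)) ^+ 2 <= A ^+ 2 by apply: g1; lra.
have h2 := g1 ze A' z0 z1.
have h4 : (z * D) ^+ 2 <= K ^+ 2 * D ^+ 2 by rewrite exprMn ler_wpM2r// sqr_ge0.
by rewrite mulrDr -[3 * K ^+ 2 * _]mulrA; move: h1 h2 h4; move: (_ ^+ 2) (_ ^+ 2) (_ ^+ 2) (_ ^+ 2) (_ ^+ 2) => *; lra.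
Qed.

End competitor.

Section layer_energy.
Variables (R : realType) (n : nat) (f : 'I_n.+1 -> 'rV[R]_n.+1).
Hypothesis hf : forall i j, dotp (f i) (f j) = (i == j)%:R.
Variables (lam Lam : R).
Hypotheses (Lam0 : 0 < Lam).
Variables (dO : measure_display) (Omega : measurableType dO).
Variables (Phi : Omega -> 'rV[R]_n.+1 -> R) (tau : 'rV[R]_n.+1 -> Omega -> Omega).
Hypothesis hPhiF : forall w, Fd lam Lam (Phi w).
Hypothesis hPhim : forall B, Fd_borel lam Lam B -> measurable (Phi @^-1` B).
Hypothesis htaum : measurable_fun [set: n.+1.-tuple R * Omega]
             (fun p => tau (rowt p.1) p.2).
Variables (W q : R -> R).
Hypothesis hWc : {within `[-1, 1], continuous W}.
Hypothesis hW0 : forall s, -1 <= s <= 1 -> 0 <= W s.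
Hypothesis hWz : forall s, -1 <= s <= 1 -> (W s = 0 <-> s = -1 \/ s = 1).
Hypothesis hqr : forall s, -1 <= q s <= 1.
Hypothesis hqs : forall k s, derivable (derive1n k q) s 1.
Hypothesis hqp : q s @[s --> +oo] --> (1 : R).
Hypothesis hqm : q s @[s --> -oo] --> (-1 : R).
Hypothesis hqE : (\int[@lebesgue_measure R]_(s in [set: R])
            ((Lam / 2) * (derive1 q s) ^+ 2 + W (q s))%:E < +oo)%E.
Notation mu := (vmu R n.+1).

(** The constants precede [r] and [w]: they use only [Lam], the dimension and the slope of the
    cutoff. [theta] is the value of the cutoff. *)
Lemma eint_competitor_le (x : 'rV[R]_n.+1) : exists K1 K2, [/\ 0 <= K1, 0 <= K2 &
  forall r w y s b, s = dotp y (f ord0) -> b = dotp x (f ord0) ->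
  exists2 theta, 0 <= theta <= 1 &
  eint Phi tau W (competitor f q x r) (fun i => pd i (competitor f q x r)) w y <=
  K1 * (derive1 q s ^+ 2 + derive1 q (s - b) ^+ 2) + K2 * (q (s - b) - q s) ^+ 2 +
      W (q s + theta * (q (s - b) - q s))].
Proof.
have [B _ hB] := @derive_step_bounded R.
pose K := 2^-1 * (Lam * n.+1%:R).
have K0 : 0 <= K by rewrite mulr_ge0 ?invr_ge0// mulr_ge0// ltW.
exists (K * 3), (K * (3 * ((n.+1 * 2)%:R * B) ^+ 2)); split.
- by rewrite mulr_ge0.
- by rewrite mulr_ge0// mulr_ge0// sqr_ge0.
move=> r w y s b sE bE.
exists (shift_cutoff f x r y); first exact: shift_cutoff01.
rewrite /eint; apply: lerD; last first.
  by rewrite /competitor /planar dotpBl -sE -bE.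
set p := \row_i _.
have /andP[p0 p1] := hom_ext_bound (hPhiF (tau y w)) p.
rewrite -[hom_ext _ _]/(phiw Phi tau w y p) in p0 p1.
have p2 : phiw Phi tau w y p ^+ 2 <= Lam * enorm p ^+ 2.
  apply: (@le_trans _ _ ((Num.sqrt Lam * enorm p) ^+ 2)).
    by rewrite ler_pXn2r ?nnegrE// mulr_ge0 ?sqrtr_ge0 ?enorm_ge0.
  by rewrite exprMn (sqr_sqrtr (ltW Lam0)).
have p3 : enorm p ^+ 2 <= n.+1%:R * (3 * (derive1 q s ^+ 2 + derive1 q (s - b) ^+ 2) +
    3 * ((n.+1 * 2)%:R * B) ^+ 2 * (q (s - b) - q s) ^+ 2).
  rewrite enorm_sqr /dotp mulr_natl; set X := (X in _ <= X *+ _).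
  have -> : X *+ n.+1 = \sum_(i < n.+1) X by rewrite sumr_const card_ord.
  apply: ler_sum => i _; rewrite mxE -expr2.
  exact: (@pd_competitor_sqr R n f hf q hqs x r B s b i y hB sE bE).
have p4 : 2^-1 * phiw Phi tau w y p ^+ 2 <= K * (3 * (derive1 q s ^+ 2 + derive1 q (s - b) ^+ 2) +
    3 * ((n.+1 * 2)%:R * B) ^+ 2 * (q (s - b) - q s) ^+ 2).
  rewrite /K -[2^-1 * _ * _]mulrA ler_pM2l ?invr_gt0//; apply: (le_trans p2).
  by rewrite -[Lam * _ * _]mulrA ler_wpM2l// ltW.
by apply: (le_trans p4); rewrite mulrDr !mulrA.
Qed.

(** Across the strip the half-width grows by half of the gap, which must exceed the shift along each
    frame vector plus the unit transition; hence the factor 2 and a constant above 2. *)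
Definition layer_gap (x : 'rV[R]_n.+1) : R := 4 + 2 * \sum_j `|dotp x (f j)|.

Lemma layer_gap_rho x r r' : r + layer_gap x <= r' ->
  forall j, strip_rho r j + 1 + `|dotp x (f j)| < strip_rho r' j.
Proof.
rewrite /layer_gap => rr' j.
have S0 : 0 <= \sum_j `|dotp x (f j)| by apply: sumr_ge0 => i _.
have : `|dotp x (f j)| <= \sum_j `|dotp x (f j)|.
  by rewrite [leRHS](bigD1 j)//= lerDl sumr_ge0.
move: rr'; rewrite /strip_rho; case: (unlift _ _) => [_|]; lra.
Qed.

(** The threshold is uniform in [w], and [r'] is free in an interval of length 1, so that it can
    later be an integer. *)
Lemma layer_energy_small x (e : R) : 0 < e -> exists2 r0, 0 < r0 &
  forall r r' w, r0 <= r -> r + layer_gap x <= r' -> r' <= r + layer_gap x + 1 ->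
  (\int[mu]_(y in layer f x r r')
     (eint Phi tau W (competitor f q x r) (fun i => pd i (competitor f q x r)) w y)%:E <=
   (e * r' ^+ n)%:E)%E.
Proof.
move=> e0; have [K1 [K2 [K10 K20 hK]]] := eint_competitor_le x.
have [c c0 hc] := layer_slices hf.
pose b := dotp x (f ord0); pose C := layer_gap x + 1.
pose M := 2 + 2 * (C + `|b|) + 2 * (n%:R * C).
have S0 : 0 <= \sum_j `|dotp x (f j)| by apply: sumr_ge0 => i _.
have C0 : 0 <= C by rewrite /C /layer_gap; lra.
have M0 : 0 < M.
  have := mulr_ge0 (ler0n R n) C0; have := normr_ge0 b; rewrite /M; lra.
have cM : 0 < c * M + 1 by rewrite ltr_wpDl// mulr_ge0// ltW.
(* The slices contribute [c] and the weight integral [M], so this choice brings the total down to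
   [e]. *)
have e10 : 0 < e / (c * M + 1) by rewrite divr_gt0.
have [h [mh h0 hoo hb]] := profile_bound hWc hW0 hWz hqr hqs hqp hqm Lam0 hqE b K10 K20 e10.
have [r0 r00 hr0] := layer_weight_integral n b C mh h0 hoo e10.
exists r0 => // r r' w r0r rr' r'r.
have rho := layer_gap_rho rr'.
have r'0 : 0 < r' by move: rr'; rewrite /layer_gap; lra.
have mhe : measurable_fun setT (fun s => h s + e / (c * M + 1)) by exact: measurable_funD.
have he0 s : 0 <= h s + e / (c * M + 1) by rewrite addr_ge0// ltW.
apply: (@le_trans _ _ (\int[mu]_(y in layer f x r r')
    (h (dotp y (f ord0)) + e / (c * M + 1))%:E)%E).
  have sw := smooth_competitor f hqs x r.
  apply: ge0_le_integral => //.
  - exact: measurable_layer.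
  - move=> y _; rewrite lee_fin; apply: (@eint_ge0 _ _ _ _ _ _ _ hW0 setT) => // z _.
    exact: competitor11.
  - apply/measurable_EFinP.
    apply: (measurable_eint hPhiF hPhim htaum hWc (measurable_layer f x r r')).
    + by apply: measurable_funTS; apply: continuous_measurable_row; exact: smooth_continuous.
    + move=> i; apply: measurable_funTS; apply: continuous_measurable_row.
      by have [] := smooth_C1 i sw.
    + by move=> y _; exact: competitor11.
  - apply/measurable_EFinP; apply: measurable_funTS.
    exact: (measurableT_comp mhe (measurable_dotp (f ord0))).
  - move=> y _; rewrite lee_fin.
    have [theta th hth] := hK r w y _ b erefl erefl.
    exact: (le_trans hth (hb _ _ th)).
have hrho j : strip_rho r j + `|dotp x (f j)| <= strip_rho r' j by have := rho j; lra.
apply: (le_trans (hc x r r' _ mhe he0 (lt_le_trans r00 r0r) hrho)).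
have br' : r + `|b| <= r' by have := hrho ord0; rewrite /strip_rho unlift_none.
have r'C : r' <= r + C by rewrite /C addrA.
have crn : 0 <= c * r' ^+ n by rewrite mulr_ge0// exprn_ge0// ltW.
apply: (le_trans (lee_wpmul2l _ (hr0 r r' r0r br' r'C))); first by rewrite lee_fin.
rewrite -EFinM lee_fin -/M.
have -> : c * r' ^+ n * (e / (c * M + 1) * M) = (c * M / (c * M + 1)) * (e * r' ^+ n) by ring.
rewrite ler_piMl//; first by rewrite mulr_ge0 ?(ltW e0)// exprn_ge0// ltW.
by rewrite ler_pdivrMr// mul1r lerDl.
Qed.

End layer_energy.

Lemma measurable_ereal_sup_count d (T : measurableType d) (R : realType) (J : countType)
    (f : J -> T -> \bar R) : (forall j, measurable_fun setT (f j)) ->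
  measurable_fun setT (fun w => ereal_sup [set f j w | j in setT]).
Proof.
move=> mf; apply: (measurability _ (ErealGenOInfty.measurableE R)) => //.
move=> /= _ [_ [r ->] <-]; rewrite setTI.
rewrite (_ : _ @^-1` _ = [set w | exists j, (r%:E < f j w)%E]).
  apply: measurable_exists_count => j.
  rewrite -[X in measurable X]setTI; exact: (emeasurable_fun_o_infty _ (mf j)).
apply/seteqP; split => w /=; rewrite in_itv/= andbT.
  by move=> /ereal_sup_gt[_ [j _ <-] h]; exists j.
by move=> [j h]; apply: (lt_le_trans h); apply: ereal_sup_ubound; exists j.
Qed.

Lemma integral_set_shift (R : realType) d (A : set 'rV[R]_d) (x : 'rV[R]_d)
    (F : 'rV[R]_d -> \bar R) : measurable A -> measurable_fun [set y | A (y - x)] F ->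
  (forall y, A (y - x) -> (0 <= F y)%E) ->
  (\int[vmu R d]_(y in [set y | A (y - x)%R]) F y = \int[vmu R d]_(z in A) F (z + x)%R)%E.
Proof.
move=> mA mF F0.
have mS : measurable [set y | A (y - x)].
  by have := measurable_addv (- x) measurableT mA; rewrite setTI.
rewrite integral_mkcond [RHS]integral_mkcond.
rewrite -(@ge0_integral_vmu_shift R d x (F \_ [set y | A (y - x)])).
- apply: eq_integral => z _; rewrite !patchE.
  have [zA|zA] := boolP (z \in A).
    by rewrite mem_set//= addrK; exact: set_mem.
  by rewrite memNset//= addrK => Az; move/negP: zA; apply; exact: mem_set.
- exact/(measurable_restrictT _ mS).
- by move=> y; rewrite patchE; case: ifPn => //; rewrite inE; exact: F0.
Qed.

(** * Stationarity of the liminf *)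

Section main.
Variables (R : realType) (n : nat) (lam Lam : R).
Hypotheses (Lam0 : 0 < Lam).
Variables (dO : measure_display) (Omega : measurableType dO).
Variables (Phi : Omega -> 'rV[R]_n.+1 -> R) (tau : 'rV[R]_n.+1 -> Omega -> Omega).
Hypothesis hPhiF : forall w, Fd lam Lam (Phi w).
Hypothesis hPhim : forall B, Fd_borel lam Lam B -> measurable (Phi @^-1` B).
Hypothesis htau0 : forall w, tau 0 w = w.
Hypothesis htauD : forall x y w, tau (x + y) w = tau x (tau y w).
Hypothesis htaum : measurable_fun [set: n.+1.-tuple R * Omega]
             (fun p => tau (rowt p.1) p.2).
Variables (W q : R -> R).
Hypothesis hWc : {within `[-1, 1], continuous W}.
Hypothesis hW0 : forall s, -1 <= s <= 1 -> 0 <= W s.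
Hypothesis hWz : forall s, -1 <= s <= 1 -> (W s = 0 <-> s = -1 \/ s = 1).
Hypothesis hqr : forall s, -1 <= q s <= 1.
Hypothesis hqs : forall k s, derivable (derive1n k q) s 1.
Hypothesis hqp : q s @[s --> +oo] --> (1 : R).
Hypothesis hqm : q s @[s --> -oo] --> (-1 : R).
Hypothesis hqE : (\int[@lebesgue_measure R]_(s in [set: R])
            ((Lam / 2) * (derive1 q s) ^+ 2 + W (q s))%:E < +oo)%E.
Variable bs : 'I_n -> 'rV[R]_n.
Hypothesis hbs : forall i j, dotp (bs i) (bs j) = (i == j)%:R.
Variable e : 'rV[R]_n.+1.
Hypothesis he : usphere e.
Variable O : 'rV[R]_n -> 'rV[R]_n.+1.
Hypothesis hOlin : forall (a : R) x y, O (a *: x + y) = a *: O x + O y.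
Hypothesis hOiso : forall x, enorm (O x) = enorm x.
Hypothesis hOim : forall y, dotp y e = 0 <-> exists x, O x = y.

Notation mu := (vmu R n.+1).
Let f := strip_frame bs e O.
Let hf := strip_frame_orth hbs he hOlin hOiso hOim.
Let f0 : f ord0 = e. Proof. by rewrite /f /strip_frame unlift_none. Qed.
Notation g w r := (phit_loc Phi tau W q O w e (cube bs 0 r) r).
Notation EI := (eint Phi tau W).

Let stripE r : strip O e (cube bs 0 r) r = box f r.
Proof. exact: (strip_obox bs he hOlin hOiso hOim). Qed.

Definition local_admissible r (t : ('rV[R]_n.+1 -> R) * ('I_n.+1 -> 'rV[R]_n.+1 -> R)) :=
  [/\ H1 (box f r) t.1 t.2, forall y, box f r y -> -1 <= t.1 y <= 1 &
      H10 (box f r) (fun y => t.1 y - planar f q y)].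

Let phit_locE w r :
  g w r = ereal_inf [set energy Phi tau W w t.1 t.2 (box f r) | t in local_admissible r].
Proof.
rewrite /phit_loc stripE; congr ereal_inf; apply/seteqP; split => E /=.
  move=> [u [G [h1 [h2 [h3 ->]]]]]; exists (u, G); [|by []].
  by split; [exact: h1|exact: h2|rewrite /planar f0; exact: h3].
by move=> [[u G] [h1 h2 h3] <-]; exists u, G; rewrite /planar f0 in h3.
Qed.

Let mbox r : measurable (box f r). Proof. exact: measurable_obox. Qed.
Let fbox r : (mu (box f r) < +oo)%E. Proof. exact: vmu_obox_fin hf _. Qed.

Let adm r t : local_admissible r t -> admissible_pair (box f r) t.
Proof.
move=> [[/L2P-/(_ (mbox r)) h1 [h2 _]] h3 _]; split => // i.
exact/(L2P _ (mbox r)).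
Qed.

Let measurable_phit_loc r : measurable_fun setT (fun w => g w r).
Proof.
rewrite (_ : (fun w => _) = fun w => ereal_inf
  [set energy Phi tau W w t.1 t.2 (box f r) | t in local_admissible r]).
  by apply: (measurable_energy_inf Lam0 hPhiF hPhim htaum hWc hW0 (mbox r) (fbox r)) => t; exact: adm.
by apply/funext => w; exact: phit_locE.
Qed.

Let energy_ge0 w r t : local_admissible r t -> (0 <= energy Phi tau W w t.1 t.2 (box f r))%E.
Proof.
move=> /adm[h1 h2 h3]; rewrite (energyE hPhiF hPhim htaum hWc hW0 (mbox r) h1.1 _ h3).
  by apply: integral_ge0 => y hy; rewrite lee_fin; exact: (eint_ge0 Phi tau hW0 t.2 h3).
by move=> i; have [] := h2 i.
Qed.

Let phit_loc_ge0 w r : (0 <= g w r)%E.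
Proof.
by rewrite phit_locE; apply: le_ereal_inf_tmp => _ [t ht <-]; exact: energy_ge0.
Qed.

(** Each competitor for [tau x w] on the small box is translated and extended to the large box for
    [w]; only the layer costs extra. *)
Lemma phit_loc_shift x (eps : R) : 0 < eps -> exists2 r0, 0 < r0 &
  forall r r' w, r0 <= r -> r + layer_gap f x <= r' -> r' <= r + layer_gap f x + 1 ->
  (g w r' <= g (tau x w) r + (eps * r' ^+ n)%:E)%E.
Proof.
move=> eps0.
have [r0 r00 hr0] := layer_energy_small hf Lam0 hPhiF hPhim htaum hWc hW0 hWz hqr hqs hqp hqm hqE x eps0.
exists r0 => // r r' w r0r rr' r'r.
rewrite !phit_locE -leeBlDr//; apply: le_ereal_inf_tmp => _ [[u G] aut <-].
rewrite leeBlDr//=; have [h1 h2 h3] := aut; have [su sG _] := adm aut.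
rewrite /= in h1 h2 h3 su sG.
have rho := layer_gap_rho rr'.
pose A := [set y | box f r (y - x)]; pose w_ := competitor f q x r.
have sub y : box f r (y - x) -> box f r' y.
  move=> hy j; have := hy j; have := rho j; rewrite dotpBl.
  by have := ler_normD (dotp y (f j) - dotp x (f j)) (dotp x (f j)); rewrite subrK; lra.
have mA : measurable A by exact: measurable_box_shift.
have [eta [et1 et2 et3]] := cutoff_exhaustion hf (strip_rho r).
have DK rr : box f rr `<=` cbox f (strip_rho rr) by move=> y hy j; exact/ltW/hy.
have [h1' h3'] := admissible_extension (mbox r) (mbox r') (fbox r')
  (@compact_cbox R n.+1 f hf (strip_rho r')) (DK r') sub (fbox r) (@compact_cbox R n.+1 f hf (strip_rho r)) (DK r)
  et1 et2 et3 (smooth_planar f hqs) (smooth_competitor f hqs x r)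
  (test_competitor hf hqs rho) (@competitor_in R n f q x r) (@pd_competitor_in R n f q x r) h1 h3.
set u' := (fun y => _) in h1' h3'; set G' := (fun i y => _) in h1'.
have u'11 y : box f r' y -> -1 <= u' y <= 1.
  move=> _; rewrite /u'; case: asboolP => [hy|_]; first exact: h2.
  exact: competitor11.
have aut' : local_admissible r' (u', G') by split; [exact: h1'|exact: u'11|exact: h3'].
apply: (@le_trans _ _ (energy Phi tau W w u' G' (box f r'))).
  by apply: ereal_inf_lbound; exists (u', G').
have [su' sG' _] := adm aut'; rewrite /= in su' sG'.
have mG i : measurable_fun (box f r) (G i) by have [] := sG i.
have mG' i : measurable_fun (box f r') (G' i) by have [] := sG' i.
have mE' := measurable_eint hPhiF hPhim htaum hWc (mbox r') su'.1 mG' u'11 w.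
have E0' y : box f r' y -> 0 <= EI u' G' w y by exact: (eint_ge0 Phi tau hW0 G' u'11).
rewrite (energyE hPhiF hPhim htaum hWc hW0 (mbox r') su'.1 mG' u'11).
rewrite (energyE hPhiF hPhim htaum hWc hW0 (mbox r) su.1 mG h2).
have boxE : box f r' = A `|` layer f x r r'.
  apply/seteqP; split => y.
    by move=> hy; have [hA|hA] := pselect (A y); [left|right].
  by move=> [/sub//|[]].
rewrite [in X in (\int[_]_(_ in X) _)%E]boxE ge0_integral_setU//; last 4 first.
- exact: measurable_layer.
- by rewrite -boxE; exact/measurable_EFinP.
- by rewrite -boxE => y hy; rewrite lee_fin; exact: E0'.
- by apply/disj_setPS => y [hA [_]].
apply: leeD.
  rewrite (integral_set_shift (mbox r)); last 2 first.
  - by apply/measurable_EFinP; apply: measurable_funS mE' => // y; exact: sub.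
  - by move=> y hy; rewrite lee_fin; exact/E0'/sub.
  rewrite le_eqVlt; apply/orP; left; apply/eqP; apply: eq_integral => z /set_mem hz.
  (* Stationarity: [tau (z + x) w = tau z (tau x w)], so the translated competitor has the same
     energy density. *)
  congr EFin; rewrite /eint /phiw htauD.
  have hzx : box f r (z + x - x) by rewrite addrK.
  have -> : u' (z + x) = u z by rewrite /u' asboolT// addrK.
  by have -> : \row_i G' i (z + x) = \row_i G i z; [apply/rowP => i; rewrite !mxE /G' asboolT// addrK|].
apply: le_trans (hr0 r r' w r0r rr' r'r).
rewrite le_eqVlt; apply/orP; left; apply/eqP; apply: eq_integral => y /set_mem[_ hy].
congr EFin; rewrite /eint.
have -> : u' y = w_ y by rewrite /u' asboolF.
by have -> : \row_i G' i y = \row_i pd i w_ y; [apply/rowP => i; rewrite !mxE /G' asboolF|].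
Qed.

Let psi w r := ((r ^- n)%:E * g w r)%E.

(** Dividing by the larger power [r' ^+ n] only lowers the main term, as energies are nonnegative,
    and turns the layer error into [eps]. *)
Lemma psi_shift x (eps : R) : 0 < eps -> exists2 r0, 0 < r0 &
  forall r r' w, r0 <= r -> r + layer_gap f x <= r' -> r' <= r + layer_gap f x + 1 ->
  (psi w r' <= psi (tau x w) r + eps%:E)%E.
Proof.
move=> eps0; have [r0 r00 hr0] := phit_loc_shift x eps0.
exists r0 => // r r' w r0r rr' r'r.
have r_gt0 : 0 < r by exact: lt_le_trans r0r.
have gap0 : 0 <= layer_gap f x.
  by rewrite /layer_gap addr_ge0// mulr_ge0// sumr_ge0.
have r'0 : 0 < r' by apply: lt_le_trans rr'; rewrite ltr_wpDr.
have rler' : r <= r' by apply: le_trans rr'; rewrite lerDl.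
have i0 : 0 <= r' ^- n by rewrite invr_ge0 exprn_ge0// ltW.
rewrite /psi; apply: (@le_trans _ _ ((r' ^- n)%:E * (g (tau x w) r + (eps * r' ^+ n)%:E))%E).
  by apply: lee_wpmul2l; rewrite ?lee_fin// hr0.
rewrite ge0_muleDr//; last by rewrite lee_fin mulr_ge0 ?(ltW eps0)// exprn_ge0// ltW.
apply: leeD.
  apply: lee_wpmul2r; first exact: phit_loc_ge0.
  by rewrite lee_fin lef_pV2 ?posrE ?exprn_gt0// lerXn2r// nnegrE ltW.
by rewrite -EFinM lee_fin mulrCA mulVf ?mulr1// gt_eqF// exprn_gt0.
Qed.

Notation ph w := (phit Phi tau W q O bs w e).

Lemma phit_le_shift x w : (ph w <= ph (tau x w))%E.
Proof.
apply: ge_ereal_sup => _ [M /= M0 <-]; apply/lee_addgt0Pr => eps eps0.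
have [r0 r00 hr0] := psi_shift x eps0.
pose M' := Num.max M r0.
have M'0 : 0 < M' by rewrite lt_max M0.
apply: (@le_trans _ _ (ereal_inf [set psi (tau x w) r | r in [set r | (M' <= r)%R]] + eps%:E)%E).
  rewrite -leeBlDr//; apply: le_ereal_inf_tmp => _ [r M'r <-]; rewrite leeBlDr//.
  rewrite /mkset in M'r.
  have r0r : r0 <= r by apply: le_trans M'r; rewrite le_max lexx orbT.
  have Mr : M <= r by apply: le_trans M'r; rewrite le_max lexx.
  have gap0 : 0 <= layer_gap f x.
    by rewrite /layer_gap addr_ge0// mulr_ge0// sumr_ge0.
  (* Every radius beyond [M'] for [tau x w] is matched by a larger one for [w]. *)
  apply: (@le_trans _ _ (psi w (r + layer_gap f x))).
    apply: ereal_inf_lbound; exists (r + layer_gap f x) => //=.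
    by apply: (le_trans Mr); rewrite lerDl.
  by apply: hr0 => //; rewrite lerDl.
apply: leeD => //; apply: ereal_sup_ubound; by exists M'.
Qed.

(** The reverse inequality is [phit_le_shift] for [- x] at [tau x w]. *)
Lemma phit_shift x w : ph (tau x w) = ph w.
Proof.
apply/eqP; rewrite eq_le; apply/andP; split; last exact: phit_le_shift.
by have := phit_le_shift (- x) (tau x w); rewrite -htauD addNr htau0.
Qed.

(** [psi w] need not be monotone in the radius, so real radii are compared with integers through
    [psi_shift] at [x = 0]: this turns the liminf into countably many suprema and infima. *)
Lemma phit_countable w : ph w =
  ereal_sup [set ereal_inf [set psi w (N.+1 + k)%:R | k in [set: nat]] | N in [set: nat]].
Proof.
apply/eqP; rewrite eq_le; apply/andP; split.
  apply: ge_ereal_sup => _ [M /= M0 <-].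
  pose N := Num.truncn M.
  apply: (@le_trans _ _ (ereal_inf [set psi w (N.+1 + k)%:R | k in [set: nat]])).
    apply: ereal_inf_le_tmp => _ [k _ <-]; exists ((N.+1 + k)%:R) => //=.
    have /andP[_ h] := truncn_itv (ltW M0).
    by apply: (le_trans (ltW h)); rewrite ler_nat leq_addr.
  by apply: ereal_sup_ubound; exists N.
apply: ge_ereal_sup => _ [N _ <-]; apply/lee_addgt0Pr => eps eps0.
have [r0 r00 hr0] := psi_shift 0 eps0.
pose M' := Num.max N.+1%:R r0.
have M'0 : 0 < M' by rewrite lt_max r00 orbT.
apply: (@le_trans _ _ (ereal_inf [set psi w r | r in [set r | (M' <= r)%R]] + eps%:E)%E).
  rewrite -leeBlDr//; apply: le_ereal_inf_tmp => _ [r M'r <-]; rewrite leeBlDr//.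
  rewrite /mkset in M'r.
  have r0r : r0 <= r by apply: le_trans M'r; rewrite le_max lexx orbT.
  have Nr : N.+1%:R <= r by apply: le_trans M'r; rewrite le_max lexx.
  have gap0 : 0 <= layer_gap f 0.
    by rewrite /layer_gap addr_ge0// mulr_ge0// sumr_ge0.
  have rg0 : 0 <= r + layer_gap f 0 by rewrite addr_ge0// (le_trans _ Nr).
  have /andP[t1 t2] := truncn_itv rg0.
  (* The integer in the half-open unit interval just above [r + layer_gap f 0], within the range
     allowed for r'. *)
  pose m := (Num.truncn (r + layer_gap f 0)).+1.
  have Nm : (N.+1 <= m)%N.
    by rewrite -(ler_nat R); apply: (le_trans Nr); apply: ltW; apply: le_lt_trans t2; rewrite lerDl.
  apply: (@le_trans _ _ (psi w m%:R)).
    by apply: ereal_inf_lbound; exists (m - N.+1)%N; [|rewrite subnKC].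
  have := hr0 r m%:R w r0r; rewrite htau0; apply; first exact: ltW.
  by rewrite -natr1 lerD2r.
apply: leeD => //; apply: ereal_sup_ubound; by exists M'.
Qed.

Lemma measurable_phit : measurable_fun setT (fun w => ph w).
Proof.
under eq_fun do rewrite phit_countable.
apply: measurable_ereal_sup_count => N; apply: measurable_ereal_inf_count => k.
by apply: measurable_funeM; exact: measurable_phit_loc.
Qed.

End main.

Theorem theorem4p2 (R : realType) (n : nat) (lam Lam : R)
  (hlam : 0 < lam) (hLam : 0 < Lam)
  (dO : measure_display) (Omega : measurableType dO) (P : probability Omega R)
  (Phi : Omega -> 'rV[R]_n.+1 -> R)
  (hPhiF : forall w, Fd lam Lam (Phi w))
  (hPhim : forall B, Fd_borel lam Lam B -> measurable (Phi @^-1` B))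
  (tau : 'rV[R]_n.+1 -> Omega -> Omega)
  (htau0 : forall w, tau 0 w = w)
  (htauD : forall x y w, tau (x + y) w = tau x (tau y w))
  (htaum : measurable_fun [set: (n.+1).-tuple R * Omega]
             (fun p => tau (rowt p.1) p.2))
  (htauP : forall x A, measurable A -> P (tau x @^-1` A) = P A)
  (htauerg : forall A, measurable A -> (forall x, tau x @^-1` A = A) ->
               P A = 0%E \/ P A = 1%E)
  (W : R -> R)
  (hWc : {within `[-1, 1], continuous W})
  (hW0 : forall s, -1 <= s <= 1 -> 0 <= W s)
  (hWz : forall s, -1 <= s <= 1 -> (W s = 0 <-> s = -1 \/ s = 1))
  (q : R -> R)
  (hqr : forall s, -1 <= q s <= 1)
  (hqs : forall k s, derivable (derive1n k q) s 1)
  (hqp : q s @[s --> +oo] --> (1 : R))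
  (hqm : q s @[s --> -oo] --> (-1 : R))
  (hqE : (\int[@lebesgue_measure R]_(s in [set: R])
            ((Lam / 2) * (derive1 q s) ^+ 2 + W (q s))%:E < +oo)%E)
  (bs : 'I_n -> 'rV[R]_n)
  (hbs : forall i j, dotp (bs i) (bs j) = (i == j)%:R)
  (e : 'rV[R]_n.+1) (he : usphere e)
  (O : 'rV[R]_n -> 'rV[R]_n.+1)
  (hOlin : forall (a : R) x y, O (a *: x + y) = a *: O x + O y)
  (hOiso : forall x, enorm (O x) = enorm x)
  (hOim : forall y, dotp y e = 0 <-> exists x, O x = y) :
  forall B : set (\bar R), measurable B ->
    measurable ((phit Phi tau W q O bs ^~ e) @^-1` B) /\
    (forall x : 'rV[R]_n.+1,
       tau x @^-1` ((phit Phi tau W q O bs ^~ e) @^-1` B) =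
       (phit Phi tau W q O bs ^~ e) @^-1` B).
Proof.
move=> B mB; split.
  rewrite -[X in measurable X]setTI.
  exact: (measurable_phit hLam hPhiF hPhim htau0 htauD htaum hWc hW0 hWz hqr hqs hqp hqm hqE
    hbs he hOlin hOiso hOim).
move=> x; apply/seteqP; split => w /=;
  by rewrite (phit_shift hLam hPhiF hPhim htau0 htauD htaum hWc hW0 hWz hqr hqs hqp hqm hqE
    hbs he hOlin hOiso hOim).
Qed.
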